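(* Let $n$ be a nonzero integer with $3\nmid n$, let $D=-3n^2$, let $p_0=3$ and let $p_1,\dots,p_s$ be the prime factors of $n$. Let $r$ be the rank of $E^{-27D}(\mathbb{Q})$, let $P_0=(0,\sqrt{-27D})$ and let $P_0,P_1,\dots,P_r$ be generators of $E^{-27D}(\mathbb{Q})$. Let $\mathcal{M}$ be the $(r+1)\times(s+1)$ matrix over $\mathbb{F}_3$ whose rows are the coefficient vectors $\overline{\lambda}^i=(\overline{\lambda}^i_0,\dots,\overline{\lambda}^i_s)$ of $P_i$, $i=0,\dots,r$, and let $V\subseteq\mathbb{F}_3^{s+1}$ be the vector space generated by the rows of $\mathcal{M}$. Then $E^{-27D}(\mathbb{Q})/\phi_D(E^D(\mathbb{Q}))$ is isomorphic to $V$ as an $\mathbb{F}_3$-vector space. Moreover, the assignment $$\langle(\overline{\lambda}_0,\dots,\overline{\lambda}_s)\rangle\longmapsto\mathbb{Q}\left(\sqrt[3]{p_1^{\lambda_1}\cdots p_s^{\lambda_s}}\right)$$ is a bijection from the set of subspaces $\langle(\overline{\lambda}_0,\dots,\overline{\lambda}_s)\rangle\subseteq V$ (each generated by one vector) such that $\overline{\lambda}_0=0$, $\overline{\lambda}_i\neq0$ for $i=1,\dots,s$, and $p_1^{\lambda_1}\cdots p_s^{\lambda_s}\equiv\pm1\pmod 9$, to the set of quasi-monogenic cubic number fields of discriminant $D$ (up to isomorphism). Here $\lambda_i\in\{0,1,2\}$ is the lift of $\overline{\lambda}_i$.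
   Context: For $k\in\mathbb{Q}\setminus\{0\}$, $E^k$ denotes the elliptic curve $Y^2=4X^3+k$ over $\mathbb{Q}$. The 3-isogeny $\phi_D:E^D\to E^{-27D}$, $\phi_D(x,y)=\left(\frac{x^3+D}{x^2},\frac{y(x^3-2D)}{x^3}\right)$, has kernel $E^D[\phi_D]=\{\mathcal{O},\pm P_D\}$, $P_D=(0,\sqrt{D})$. Let $\delta:E^{-27D}(\mathbb{Q})\to H^1(\mathbb{Q},E^D[\phi_D])$ be the connecting map $P\mapsto[\sigma\mapsto Q^\sigma-Q]$, where $\phi_D(Q)=P$; its kernel is $\phi_D(E^D(\mathbb{Q}))$. Let $\zeta_3$ be a primitive cube root of unity and, for $0\le i\le s$, let $f_i:\mathrm{Gal}(\overline{\mathbb{Q}}/\mathbb{Q})\to\mathbb{F}_3$ be $f_i(\sigma)=\log_{\zeta_3}\left(\sigma(\sqrt[3]{p_i})/\sqrt[3]{p_i}\right)$. For every $P\in E^{-27D}(\mathbb{Q})$, the class $\delta(P)$ is represented by a cocycle $(\overline{\lambda}_0f_0+\cdots+\overline{\lambda}_sf_s)P_D$ with uniquely determined $\overline{\lambda}_i\in\mathbb{F}_3$; $(\overline{\lambda}_0,\dots,\overline{\lambda}_s)$ is called the coefficient vector of $P$. A cubic number field $L$ is quasi-monogenic if $I(X,Y)=\pm1$ has a solution in $\mathbb{Q}^2$, where $I$ is its index form: for a $\mathbb{Z}$-basis $\{1,\omega_2,\omega_3\}$ of $\mathcal{O}_L$, $1\wedge\gamma\wedge\gamma^2=I(x_2,x_3)\,(1\wedge\omega_2\wedge\omega_3)$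 for $\gamma=x_1+x_2\omega_2+x_3\omega_3$ (this property does not depend on the basis).
   Formalization: The bijection is stated only for squarefree n and for nonzero vectors: it fails for n=80, where ⟨(0,1,1)⟩ is sent to Q(∛10) of discriminant −300, and for n=±1, where the zero subspace would be sent to Q; the isomorphism with V is proved for all n. *)

(* Defs.v *)
From HB Require Import structures.
From mathcomp Require Import all_boot all_order all_algebra all_field.
From mathcomp Require Import boolp.
From mathcomp Require Import ring.
Set Implicit Arguments. Unset Strict Implicit. Unset Printing Implicit Defensive.
Import Order.TTheory GRing.Theory Num.Theory.
Local Open Scope ring_scope.

Section Law.
Variables (K : numFieldType) (k : K).

(* The condition [q != (0, 0)] excludes the only point that can be singular; it
   is vacuous for k != 0 and makes the points a group for every k. *)
Definition on_affine (q : K * K) : bool :=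
  (q.2 ^+ 2 == 4 * q.1 ^+ 3 + k) && (q != (0, 0)).

(* Slope of the line through q1 and q2, the tangent when q1 = q2: implicit
   differentiation of y ^ 2 = 4 x ^ 3 + k gives dy / dx = 6 x ^ 2 / y. *)
Definition slope (q1 q2 : K * K) : K :=
  if q1.1 == q2.1 then 6 * q1.1 ^+ 2 / q1.2 else (q2.2 - q1.2) / (q2.1 - q1.1).

Definition chord (q1 q2 : K * K) : K * K :=
  let m := slope q1 q2 in
  let x := m ^+ 2 / 4 - q1.1 - q2.1 in (x, - (q1.2 + m * (x - q1.1))).

Definition opp_aff (q : K * K) : K * K := (q.1, - q.2).

(* The intersection of the line y = m x + c with the curve is q1 + q2 + q3,
   multiplicities included: 4 X ^ 3 + k - (m X + c) ^ 2 has the three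
   abscissas as its roots. *)
Definition line3 (m c : K) (q1 q2 q3 : K * K) : Prop :=
  [/\ q1.2 = m * q1.1 + c, q2.2 = m * q2.1 + c, q3.2 = m * q3.1 + c,
      4 * (q1.1 + q2.1 + q3.1) = m ^+ 2 &
      4 * (q1.1 * q2.1 + q1.1 * q3.1 + q2.1 * q3.1) = - 2 * m * c /\
      4 * (q1.1 * q2.1 * q3.1) = c ^+ 2 - k].

Lemma nz4 : (4 : K) != 0. Proof. by rewrite pnatr_eq0. Qed.
Lemma nz2 : (2 : K) != 0. Proof. by rewrite pnatr_eq0. Qed.

Lemma line3_chord q1 q2 : on_affine q1 -> on_affine q2 -> q1 != opp_aff q2 ->
  exists m c, line3 m c q1 q2 (opp_aff (chord q1 q2)).
Proof.
case: q1 q2 => [x1 y1] [x2 y2] /andP[/eqP /= h1 n1] /andP[/eqP /= h2 n2] n12.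
pose m := slope (x1, y1) (x2, y2).
have key : y2 - y1 = m * (x2 - x1) /\
    m * (y1 + y2) = 4 * (x1 ^+ 2 + x1 * x2 + x2 ^+ 2).
  rewrite /m /slope /=; case: eqVneq => [e|ne].
    rewrite -e in h2 n2 n12 *.
    have /eqP : (y2 - y1) * (y2 + y1) = 0 by ring: h1 h2.
    rewrite mulf_eq0 subr_eq0 addrC addr_eq0 => /orP[/eqP e2|/eqP e2]; last first.
      by rewrite /opp_aff /= e2 eqxx in n12.
    rewrite e2 in n12 *.
    have y0 : y1 != 0.
      by apply: contraNneq n12 => ->; rewrite /opp_aff /= oppr0.
    by split; field.
  have d : x2 - x1 != 0 by rewrite subr_eq0 eq_sym.
  split; first by field.
  apply: (mulfI d); transitivity (y2 ^+ 2 - y1 ^+ 2); first by field.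
  by rewrite h1 h2; ring.
case: key => k1 k2; exists m, (y1 - m * x1).
rewrite /line3 /opp_aff /chord /= -/m.
have e2 : y2 = y1 + m * (x2 - x1) by rewrite -k1; ring.
have kE : k = y1 ^+ 2 - 4 * x1 ^+ 3 by rewrite h1; ring.
set x3 := m ^+ 2 / 4 - x1 - x2.
have e1 : 4 * (x1 + x2 + x3) = m ^+ 2 by rewrite /x3; field.
have e2' : 4 * (x1 * x2 + x1 * x3 + x2 * x3) = - 2 * m * (y1 - m * x1).
  have -> : 4 * (x1 * x2 + x1 * x3 + x2 * x3) = (4 * (x1 + x2 + x3)) * (x1 + x2)
     - 4 * (x1 ^+ 2 + x1 * x2 + x2 ^+ 2) by ring.
  by rewrite e1 -k2 e2; ring.
split=> //; [ring | rewrite e2; ring | ring | split=> //].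
have -> : 4 * (x1 * x2 * x3) = 4 * (x1 * x2 + x1 * x3 + x2 * x3) * x1
  - 4 * (x1 + x2 + x3) * x1 ^+ 2 + 4 * x1 ^+ 3 by ring.
by rewrite e1 e2' kE; ring.
Qed.

Lemma line3_perm m c q1 q2 q3 : line3 m c q1 q2 q3 -> line3 m c q2 q1 q3.
Proof.
case=> h1 h2 h3 h4 [h5 h6]; split=> //; first by rewrite -h4; ring.
by split; [rewrite -h5|rewrite -h6]; ring.
Qed.

Lemma line3_rot m c q1 q2 q3 : line3 m c q1 q2 q3 -> line3 m c q2 q3 q1.
Proof.
case=> h1 h2 h3 h4 [h5 h6]; split=> //; first by rewrite -h4; ring.
by split; [rewrite -h5|rewrite -h6]; ring.
Qed.

Lemma line3_opp m c q1 q2 q3 : line3 m c q1 q2 q3 ->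
  line3 (- m) (- c) (opp_aff q1) (opp_aff q2) (opp_aff q3).
Proof.
case=> h1 h2 h3 h4 [h5 h6]; rewrite /line3 /opp_aff /=.
split; [by rewrite h1; ring|by rewrite h2; ring|by rewrite h3; ring| |split].
- by rewrite h4; ring.
- by rewrite h5; ring.
- by rewrite h6; ring.
Qed.

Lemma line3_slope m c q1 q2 q3 : line3 m c q1 q2 q3 -> on_affine q1 ->
  [/\ m * (q1.2 + q2.2) = 4 * (q1.1 ^+ 2 + q1.1 * q2.1 + q2.1 ^+ 2),
      q1 != opp_aff q2 & chord q1 q2 = opp_aff q3].
Proof.
case: q1 q2 q3 => [x1 y1] [x2 y2] [x3 y3] [/= h1 h2 h3 h4 [h5 h6]] o1.
have k1 : m * (y1 + y2) = 4 * (x1 ^+ 2 + x1 * x2 + x2 ^+ 2).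
  have -> : 4 * (x1 ^+ 2 + x1 * x2 + x2 ^+ 2) =
    4 * (x1 + x2 + x3) * (x1 + x2) - 4 * (x1 * x2 + x1 * x3 + x2 * x3) by ring.
  by rewrite h4 h5 h1 h2; ring.
have n12 : (x1, y1) != opp_aff (x2, y2).
  apply: contraTneq o1 => -[ex ey]; rewrite /on_affine /=.
  have /eqP : 12 * x2 ^+ 2 = 0.
    have -> : 12 * x2 ^+ 2 = 4 * (x1 ^+ 2 + x1 * x2 + x2 ^+ 2) by rewrite ex; ring.
    by rewrite -k1 ey; ring.
  rewrite mulf_eq0 pnatr_eq0 /= sqrf_eq0 => /eqP x20.
  have /eqP : 2 * y2 = 0.
    have -> : 2 * y2 = y2 - y1 by rewrite ey; ring.
    by rewrite h1 h2 ex; ring.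
  rewrite mulf_eq0 pnatr_eq0 /= => /eqP y20.
  by rewrite ex ey x20 y20 oppr0 eqxx andbF.
split=> //.
suff sm : slope (x1, y1) (x2, y2) = m.
  rewrite /chord /opp_aff /= sm.
  have x3E : x3 = m ^+ 2 / 4 - x1 - x2 by rewrite -h4; field.
  by rewrite -x3E; congr pair; rewrite h1 h3; ring.
rewrite /slope /=; case: eqVneq => [e|ne]; last first.
  have d : x2 - x1 != 0 by rewrite subr_eq0 eq_sym.
  by rewrite h2 h1; field.
have y12 : y2 = y1 by rewrite h1 h2 e.
have y0 : y1 != 0.
  by apply: contraNneq n12 => y10; rewrite /opp_aff /= y12 y10 e oppr0.
apply: (mulIf y0); rewrite mulfVK //.
apply: (mulfI nz2); transitivity (m * (y1 + y2)); first by rewrite k1 e; ring.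
by rewrite y12; ring.
Qed.

Lemma line3_on m c q1 q2 q3 : line3 m c q1 q2 q3 ->
  on_affine q1 -> on_affine q2 -> on_affine q3.
Proof.
case: q1 q2 q3 => [x1 y1] [x2 y2] [x3 y3] [/= h1 h2 h3 h4 [h5 h6]] o1 o2.
have kE : k = c ^+ 2 - 4 * (x1 * x2 * x3) by rewrite h6; ring.
apply/andP; split => /=.
  apply/eqP; rewrite h3 kE.
  have -> : (m * x3 + c) ^+ 2 = m ^+ 2 * x3 ^+ 2 - (- 2 * m * c) * x3 + c ^+ 2 by ring.
  by rewrite -h4 -h5; ring.
apply: contraTneq o1 => -[x30 y30].
have c0 : c = 0 by move: h3; rewrite x30 y30 mulr0 add0r.
have k0 : k = 0 by rewrite kE x30 c0; ring.
have /eqP : 4 * (x1 * x2) = 0 by move: h5; rewrite x30 c0 !mulr0 !addr0.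
rewrite mulf_eq0 pnatr_eq0 /= mulf_eq0 => /orP[/eqP x10|/eqP x20].
  by rewrite /on_affine h1 x10 c0 mulr0 addr0 eqxx andbF.
by move: o2; rewrite /on_affine h2 x20 c0 mulr0 addr0 eqxx andbF.
Qed.

(* The slope of the third line is l + p - m. *)
Lemma line3_assoc l c1 m c2 p d a b c s t u :
  on_affine a -> on_affine b -> on_affine c ->
  line3 l c1 a b s -> line3 m c2 b c t -> line3 p d (opp_aff s) c u ->
  c != s -> exists q e, line3 q e a (opp_aff t) u.
Proof.
move=> oa ob oc ls lt lu ncs.
have os : on_affine s := line3_on ls oa ob.
have [Rl _ _] := line3_slope (line3_rot ls) ob.
have [Rm _ _] := line3_slope lt ob.
have [Rp _ _] := line3_slope (line3_perm lu) oc.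
case: a b c s t u oa ob oc os Rl Rm Rp ls lt lu ncs =>
  [a ya] [b yb] [c yc] [s ys] [t yt] [u yu] /= oa ob oc os Rl Rm Rp.
case=> /= sa sb ss s1 [s2 s3]; case=> /= tb tc tt t1 [t2 t3].
case=> /= us uc uu u1 [u2 u3] ncs.
have D1 : m * (c - b) = yc - yb by rewrite tb tc; ring.
have D2 : l * (s - b) = ys - yb by rewrite sb ss; ring.
have D3 : p * (s - c) = - ys - yc by rewrite us uc; ring.
set G := l * p - l * m - p * m + 4 * (b + s + c).
have Gcb : G * (c - b) = 0.
  have -> : G * (c - b) = l * p * (c - b) - (l + p) * (m * (c - b)) +
     (4 * (c ^+ 2 + c * s + s ^+ 2) - 4 * (b ^+ 2 + b * s + s ^+ 2)).
    by rewrite /G; ring.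
  rewrite -Rl -Rp D1.
  have -> : l * p * (c - b) - (l + p) * (yc - yb) +
     (p * (yc - ys) - l * (yb + ys)) =
     l * p * (c - b) + l * (- ys - yc) - p * (ys - yb) by ring.
  by rewrite -D2 -D3; ring.
have Gsc : G * (s - c) = 0.
  have -> : G * (s - c) = l * (p * (s - c)) - l * m * (s - c) -
     m * (p * (s - c)) +
     (4 * (b ^+ 2 + b * s + s ^+ 2) - 4 * (b ^+ 2 + b * c + c ^+ 2)).
    by rewrite /G; ring.
  rewrite -Rl -Rm D3.
  have -> : l * (- ys - yc) - l * m * (s - c) - m * (- ys - yc) +
     (l * (yb + ys) - m * (yb + yc)) =
     - l * (yc - yb) - l * m * (s - c) + m * (ys - yb) by ring.
  by rewrite -D1 -D2; ring.
have G0 : G = 0.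
  apply/eqP; move/eqP: Gcb; move/eqP: Gsc; rewrite !mulf_eq0 !subr_eq0.
  case: (G == 0) => //= /eqP sc /eqP cb; case/negP: ncs; apply/eqP.
  by congr pair; rewrite ?sc // ss tc sc cb -sb -tb.
have sE : s = - (l * p - l * m - p * m) / 4 - b - c.
  apply: (mulfI nz4); transitivity (4 * s - G); first by rewrite G0 subr0.
  by rewrite /G; field.
have ybE : yb = - (m * (c - b) + l * (s - b) + p * (s - c)) / 2.
  by rewrite D1 D2 D3; field.
have aE : a = l ^+ 2 / 4 - b - s by rewrite -s1; field.
have tE : t = m ^+ 2 / 4 - b - c by rewrite -t1; field.
have uE : u = p ^+ 2 / 4 - s - c by rewrite -u1; field.
have ycE : yc = yb + m * (c - b) by rewrite D1; ring.
have yaE : ya = yb + l * (a - b) by rewrite sa sb; ring.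
have ytE : yt = yb + m * (t - b) by rewrite tb tt; ring.
have yuE : yu = yc + p * (u - c) by rewrite uc uu; ring.
pose q := l + p - m; pose e := ya - q * a; exists q, e.
have f1 : ya = q * a + e by rewrite /e; ring.
have f2 : - yt = q * t + e.
  by rewrite ytE /e yaE /q ybE aE tE sE; field.
have f3 : yu = q * u + e.
  by rewrite yuE ycE /e yaE /q ybE aE uE sE; field.
have f4 : 4 * (a + t + u) = q ^+ 2 by rewrite /q aE tE uE sE; field.
have f5 : 4 * (a * t + a * u + t * u) = - 2 * q * e.
  apply/eqP; rewrite -subr_eq0; apply/eqP.
  transitivity (- (4 * (b ^+ 2 + b * c + c ^+ 2) - m * (yb + yc))).
    by rewrite ycE /e yaE /q ybE aE tE uE sE; field.
  by rewrite Rm; ring.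
split=> //=; split=> //.
have kE : k = ya ^+ 2 - 4 * a ^+ 3 by case/andP: oa => /eqP /= -> _; ring.
have -> : 4 * (a * t * u) = 4 * (a * t + a * u + t * u) * a
  - 4 * (a + t + u) * a ^+ 2 + 4 * a ^+ 3 by ring.
by rewrite f4 f5 kE f1; ring.
Qed.
End Law.

Section Group.
Variables (K : numFieldType) (k : rat).
Implicit Types q : option (K * K).
Let kK : K := ratr k.

Definition on_curve q : bool := if q is Some q0 then on_affine kK q0 else true.

Definition opp_coords q := omap (@opp_aff K) q.

Definition add_coords q1 q2 :=
  match q1, q2 with
  | None, _ => q2
  | _, None => q1
  | Some a, Some b => if a == opp_aff b then None else Some (chord a b)
  end.

Lemma opp_affK : involutive (@opp_aff K).
Proof. by case=> x y; rewrite /opp_aff /= opprK. Qed.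

Lemma on_affineN a : on_affine kK a -> on_affine kK (opp_aff a).
Proof.
case: a => x y; rewrite /on_affine /= sqrrN => /andP[-> n0] /=.
by apply: contraNneq n0 => -[-> /eqP]; rewrite oppr_eq0 => /eqP->.
Qed.

Lemma on_curveN q : on_curve q -> on_curve (opp_coords q).
Proof. by case: q => [a|] //; apply: on_affineN. Qed.

Lemma on_curveD q1 q2 :
  on_curve q1 -> on_curve q2 -> on_curve (add_coords q1 q2).
Proof.
case: q1 q2 => [a|] [b|] //= oa ob; case: ifP => //= /negbT nab.
have [m [c abc]] := line3_chord oa ob nab.
by rewrite -[chord a b]opp_affK; apply/on_affineN/(line3_on abc).
Qed.

Lemma add_line3 m d a b c : on_affine kK a -> line3 kK m d a b c ->
  add_coords (Some a) (Some b) = Some (opp_aff c).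
Proof.
by move=> oa l; have [_ /negPf /= -> ->] := line3_slope l oa.
Qed.

Lemma add_coordsC q1 q2 : on_curve q1 -> on_curve q2 ->
  add_coords q1 q2 = add_coords q2 q1.
Proof.
case: q1 q2 => [a|] [b|] //= oa ob.
rewrite -(inv_eq opp_affK) [b == _]eq_sym; case: ifP => // /negbT.
rewrite (inv_eq opp_affK) => nab.
have [m [c abc]] := line3_chord oa ob nab.
by have [_ _ ->] := line3_slope (line3_perm abc) ob; rewrite opp_affK.
Qed.

Lemma add_coordsN q : add_coords (opp_coords q) q = None.
Proof. by case: q => //= a; rewrite eqxx. Qed.

Lemma add_coordsNK q1 q2 : on_curve q1 -> on_curve q2 ->
  add_coords (opp_coords q1) (add_coords q1 q2) = q2.
Proof.
case: q1 q2 => [a|] [b|] //= oa ob; last by rewrite eqxx.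
have [/= ->|nab] := eqVneq; first by rewrite opp_affK.
have [m [c abc]] := line3_chord oa ob nab.
have := add_line3 (on_affineN oa) (line3_rot (line3_perm (line3_opp abc))).
by rewrite !opp_affK.
Qed.

Lemma add_coordsA q1 q2 q3 : on_curve q1 -> on_curve q2 -> on_curve q3 ->
  add_coords q1 (add_coords q2 q3) = add_coords (add_coords q1 q2) q3.
Proof.
have D1 (q q' : option (K * K)) : q = opp_coords q' -> q' = opp_coords q.
  by move=> ->; case: q' => [a|] //=; rewrite opp_affK.
move=> o1 o2 o3.
have [/D1 e12|n12] := eqVneq q1 (opp_coords q2).
  have K1 : opp_coords (opp_coords q1) = q1 by rewrite -(D1 _ _ erefl).
  rewrite e12 in o2 *; rewrite [add_coords q1 (opp_coords q1)]add_coordsC //.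
  by rewrite add_coordsN /= -{1}K1 add_coordsNK.
have [/D1 e23|n23] := eqVneq q2 (opp_coords q3).
  rewrite e23 in o3 *; rewrite [add_coords q2 _]add_coordsC // add_coordsN.
  rewrite [LHS](_ : _ = q1); last by case: (q1).
  by rewrite [RHS]add_coordsC ?[add_coords q1 q2]add_coordsC
     ?add_coordsNK ?on_curveD.
case: q1 q2 q3 o1 o2 o3 n12 n23 => [a|] [b|] [c|] //= oa ob oc;
  last by case: ifP.
rewrite !(inj_eq Some_inj) => nab nbc.
have [l [d1 ls]] := line3_chord oa ob nab; set s := opp_aff _ in ls.
have [m [d2 lt]] := line3_chord ob oc nbc; set t := opp_aff _ in lt.
have os := line3_on ls oa ob; have ot := line3_on lt ob oc.
rewrite (negPf nab) (negPf nbc).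
have -> : chord b c = opp_aff t by rewrite opp_affK.
have -> : chord a b = opp_aff s by rewrite opp_affK.
rewrite -!/(add_coords (Some _) (Some _)).
have [ecs|ncs] := eqVneq c s.
  have <- : opp_aff a = opp_aff t.
    have [_ _ <-] := line3_slope (line3_rot ls) ob.
    by have [_ _ <-] := line3_slope lt ob; rewrite ecs.
  by rewrite /= ecs opp_affK !eqxx.
have [eat|nat] := eqVneq a t.
  have -> : opp_aff s = opp_aff c.
    have [_ _ <-] := line3_slope ls oa.
    by have [_ _ <-] := line3_slope (line3_rot (line3_rot lt)) ot; rewrite eat.
  by rewrite /= eat opp_affK !eqxx.
have nsc : opp_aff s != opp_aff c by rewrite (inj_eq (inv_inj opp_affK)) eq_sym.
have [p [d lu]] := line3_chord (on_affineN os) oc nsc.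
have [q [e lv]] := line3_assoc oa ob oc ls lt lu ncs.
by rewrite (add_line3 oa lv) (add_line3 (on_affineN os) lu).
Qed.
End Group.

Section Isogeny.
Variables (K : numFieldType) (D : rat).
Let dK : K := ratr D.
Let dK' : K := ratr (-27 * D).

Definition phi_aff (q : K * K) : K * K :=
  ((q.1 ^+ 3 + dK) / q.1 ^+ 2, q.2 * (q.1 ^+ 3 - 2 * dK) / q.1 ^+ 3).

Definition phi_coords (q : option (K * K)) : option (K * K) :=
  if q is Some q0 then if q0.1 == 0 then None else Some (phi_aff q0) else None.

Lemma ratr27 : dK' = - 27 * dK.
Proof. by rewrite /dK' rmorphM rmorphN /= ratr_nat. Qed.

Lemma phi_aff_on q : on_affine dK q -> q.1 != 0 -> on_affine dK' (phi_aff q).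
Proof.
case: q => [x y] /andP[/eqP /= h n0] x0; rewrite /on_affine ratr27 /=.
have dE : dK = y ^+ 2 - 4 * x ^+ 3 by rewrite h; ring.
apply/andP; split; first by rewrite dE; apply/eqP; field.
rewrite /phi_aff /=; apply/eqP => -[/eqP].
rewrite mulf_eq0 invr_eq0 expf_eq0 (negPf x0) andbF orbF => /eqP xd /eqP.
rewrite !mulf_eq0 invr_eq0 expf_eq0 (negPf x0) andbF orbF.
have xE : x ^+ 3 = - dK by apply/eqP; rewrite -subr_eq0 opprK xd.
have -> : x ^+ 3 - 2 * dK = - 3 * dK by rewrite xE; ring.
rewrite mulf_eq0 oppr_eq0 pnatr_eq0 /= => y0d0.
have d0 : dK = 0.
  case/orP: y0d0 => [/eqP y0|/eqP//]; apply: (@mulfI _ (- 3)).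
    by rewrite oppr_eq0 pnatr_eq0.
  rewrite mulr0; transitivity (4 * x ^+ 3 + dK); first by rewrite xE; ring.
  by rewrite -h y0; ring.
by move/eqP: xE; rewrite d0 oppr0 expf_eq0 (negPf x0).
Qed.

Lemma phi_on q : on_curve D q -> on_curve (-27 * D) (phi_coords q).
Proof. by case: q => //= a oa; case: eqVneq => //= a0; apply: phi_aff_on. Qed.

Lemma phi_affN q : phi_aff (opp_aff q) = opp_aff (phi_aff q).
Proof. by rewrite /phi_aff /opp_aff /= !mulNr. Qed.

Lemma phi_coordsN q : phi_coords (opp_coords q) = opp_coords (phi_coords q).
Proof. by case: q => //= a; case: ifP => //= _; rewrite phi_affN. Qed.

Lemma phi_line3_gen m c p1 p2 p3 : on_affine dK p1 ->
  line3 dK m c p1 p2 p3 -> p1.1 != 0 -> p2.1 != 0 -> p3.1 != 0 ->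
  exists m' c', line3 dK' m' c' (phi_aff p1) (phi_aff p2) (phi_aff p3).
Proof.
case: p1 p2 p3 => [x1 y1] [x2 y2] [x3 y3] /= o1 [/= h1 h2 h3 e1 [e2 e3]] n1 n2 n3.
pose w := c ^+ 2 - dK.
have w0 : w != 0 by rewrite /w -e3 !mulf_neq0 // pnatr_eq0.
have dE : dK = c ^+ 2 - w by rewrite /w; ring.
have root x : (x - x1) * (x - x2) * (x - x3) = 0 ->
    w = 4 * x ^+ 3 - m ^+ 2 * x ^+ 2 - 2 * m * c * x.
  move=> r0; transitivity (4 * x ^+ 3 - m ^+ 2 * x ^+ 2 + (- 2 * m * c) * x -
      4 * ((x - x1) * (x - x2) * (x - x3))); last by rewrite r0; ring.
  by rewrite -e1 -e2 /w -e3; ring.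
pose m' := m * (3 * dK + c ^+ 2) / w.
pose c' := c - 8 * dK * c / w - m ^+ 3 * dK / w.
have yline x : x != 0 -> (x - x1) * (x - x2) * (x - x3) = 0 ->
    (m * x + c) * (x ^+ 3 - 2 * dK) / x ^+ 3 = m' * ((x ^+ 3 + dK) / x ^+ 2) + c'.
  move=> x0 r0; have wE := root x r0; rewrite /m' /c' dE.
  have w1 := w0; rewrite wE in w1 *.
  by field; rewrite exprMn w1.
have r1 : (x1 - x1) * (x1 - x2) * (x1 - x3) = 0 by ring.
have r2 : (x2 - x1) * (x2 - x2) * (x2 - x3) = 0 by ring.
have r3 : (x3 - x1) * (x3 - x2) * (x3 - x3) = 0 by ring.
have E1 : x1 + x2 + x3 = m ^+ 2 / 4 by rewrite -e1; field.
have E2 : x1 * x2 + x1 * x3 + x2 * x3 = - m * c / 2.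
  by apply: (mulfI (nz4 K)); rewrite e2; field.
have E3 : x1 * x2 * x3 = w / 4 by rewrite /w -e3; field.
pose X x : K := (x ^+ 3 + dK) / x ^+ 2.
have f1 : 4 * (X x1 + X x2 + X x3) = m' ^+ 2.
  rewrite (_ : X x1 + X x2 + X x3 = (x1 + x2 + x3) + dK *
    ((x1 * x2 + x1 * x3 + x2 * x3) ^+ 2 - 2 * (x1 + x2 + x3) * (x1 * x2 * x3))
     / (x1 * x2 * x3) ^+ 2); last by rewrite /X; field; rewrite ?n1 ?n2 ?n3.
  by rewrite E1 E2 E3 /m' dE; field.
have f2 : 4 * (X x1 * X x2 + X x1 * X x3 + X x2 * X x3) = - 2 * m' * c'.
  rewrite (_ : X x1 * X x2 + X x1 * X x3 + X x2 * X x3 =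
     (x1 * x2 + x1 * x3 + x2 * x3) + (dK * ((x1 + x2 + x3) *
       (x1 * x2 + x1 * x3 + x2 * x3) ^+ 2 - 2 * (x1 + x2 + x3) ^+ 2 *
       (x1 * x2 * x3) - (x1 * x2 + x1 * x3 + x2 * x3) * (x1 * x2 * x3)) +
      dK ^+ 2 * ((x1 + x2 + x3) ^+ 2 - 2 * (x1 * x2 + x1 * x3 + x2 * x3)))
     / (x1 * x2 * x3) ^+ 2); last by rewrite /X; field; rewrite ?n1 ?n2 ?n3.
  by rewrite E1 E2 E3 /m' /c' dE; field.
exists m', c'; split; rewrite /phi_aff /=.
- by rewrite h1 yline.
- by rewrite h2 yline.
- by rewrite h3 yline.
- by [].
split=> //.
have /andP[/eqP /= h _] := phi_aff_on o1 n1.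
have -> : dK' = (m' * X x1 + c') ^+ 2 - 4 * X x1 ^+ 3.
  by rewrite /X -yline // -h1 h addrC addKr.
change (4 * (X x1 * X x2 * X x3) = c' ^+ 2 - ((m' * X x1 + c') ^+ 2 - 4 * X x1 ^+ 3)).
transitivity (4 * (X x1 * X x2 + X x1 * X x3 + X x2 * X x3) * X x1
  - 4 * (X x1 + X x2 + X x3) * X x1 ^+ 2 + 4 * X x1 ^+ 3); first by ring.
by rewrite f1 f2; ring.
Qed.

Lemma phi_line3_ker m c p1 p2 p3 : on_affine dK p3 ->
  line3 dK m c p1 p2 p3 -> p1.1 != 0 -> p2.1 != 0 -> p3.1 = 0 ->
  phi_aff p1 = opp_aff (phi_aff p2).
Proof.
case: p1 p2 p3 => [x1 y1] [x2 y2] [x3 y3] /= o3 [/= h1 h2 h3 e1 [e2 e3]] n1 n2 x30.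
rewrite x30 !mulr0 in e1 e2 e3; rewrite !addr0 in e1 e2.
have dE : dK = c ^+ 2 by rewrite -[LHS]addr0 e3; ring.
have x12 : x1 * x2 != 0 by rewrite mulf_neq0.
have : 4 * (x1 * x2) != 0 by rewrite mulf_neq0 ?pnatr_eq0.
rewrite e2 !mulf_eq0 negb_or => /andP[]; rewrite negb_or => /andP[_ m0] c0.
have E2 : x1 * x2 = - m * c / 2.
  by apply: (mulfI (nz4 K)); rewrite e2; field.
have x2E : x2 = m ^+ 2 / 4 - x1 by rewrite -e1; field.
have cE : c = - 2 * (x1 * x2) / m by rewrite E2; field.
have n2' := n2; rewrite x2E in n2'.
have n1' : m ^+ 2 + - x1 * 4 != 0.
  by rewrite (_ : m ^+ 2 + - x1 * 4 = 4 * (m ^+ 2 / 4 - x1)) ?mulf_neq0 ?pnatr_eq0 //; field.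
by rewrite /phi_aff /opp_aff /= h1 h2 dE cE x2E; congr pair; field; rewrite n1 m0 n1'.
Qed.

Lemma phi_line3 m c p1 p2 p3 :
  on_affine dK p1 -> on_affine dK p2 -> on_affine dK p3 ->
  line3 dK m c p1 p2 p3 ->
  add_coords (phi_coords (Some p1)) (phi_coords (Some p2)) =
  opp_coords (phi_coords (Some p3)).
Proof.
move=> o1 o2 o3 l.
have two q1 q2 q3 : on_affine dK q1 -> line3 dK m c q1 q2 q3 -> q1.1 = 0 ->
    q2.1 = 0 -> q3.1 = 0.
  case=> /= oq [h1 h2 h3 e1 [e2 e3]] z1 z2.
  have c0 : c != 0.
    apply: contraTneq oq => c0; rewrite /on_affine (surjective_pairing q1).
    by rewrite h1 z1 c0 mulr0 addr0 eqxx andbF.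
  have /eqP : 2 * c * m = 0.
    transitivity (- (- 2 * m * c)); first by ring.
    by rewrite -e2 z1 z2; ring.
  rewrite mulf_eq0 mulf_eq0 pnatr_eq0 (negPf c0) /= => /eqP m0.
  move: e1; rewrite z1 z2 m0 !add0r expr0n /= => /eqP.
  by rewrite mulf_eq0 pnatr_eq0 /= => /eqP.
rewrite /phi_coords.
case: (eqVneq p1.1 0) => [z1|n1]; case: (eqVneq p2.1 0) => [z2|n2].
- by rewrite (two _ _ _ o1 l z1 z2) eqxx.
- case: (eqVneq p3.1 0) => [z3|n3] /=.
    by rewrite (two _ _ _ o1 (line3_perm (line3_rot (line3_rot l))) z1 z3) eqxx in n2.
  by rewrite (phi_line3_ker o1 (line3_rot l) n2 n3 z1).
- case: (eqVneq p3.1 0) => [z3|n3] /=.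
    by rewrite (two _ _ _ o2 (line3_rot l) z2 z3) eqxx in n1.
  by rewrite (phi_line3_ker o2 (line3_perm (line3_rot (line3_rot l))) n1 n3 z2).
case: (eqVneq p3.1 0) => [z3|n3].
  by rewrite /= (phi_line3_ker o3 l n1 n2 z3) eqxx.
have [m' [c' l']] := phi_line3_gen o1 l n1 n2 n3.
exact: add_line3 (phi_aff_on o1 n1) l'.
Qed.

Lemma phi_coordsD q1 q2 : on_curve D q1 -> on_curve D q2 ->
  phi_coords (add_coords q1 q2) = add_coords (phi_coords q1) (phi_coords q2).
Proof.
case: q1 q2 => [a|] [b|] oa ob //; last by rewrite /=; case: ifP.
have [->|nab] := eqVneq a (opp_aff b).
  by rewrite -[Some (opp_aff b)]/(opp_coords (Some b)) phi_coordsN !add_coordsN.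
have [m [c l]] := line3_chord oa ob nab.
rewrite (phi_line3 oa ob (line3_on l oa ob) l) -phi_coordsN.
by rewrite (add_line3 oa l) /= opp_affK.
Qed.
End Isogeny.

(* The group E^k(K) of K-points of Y^2 = 4 X^3 + k; [None] is the point at
   infinity. *)
Record EC (k : rat) (K : numFieldType) := ECPoint {
  coords : option (K * K);
  coordsP : on_curve k coords
}.

HB.instance Definition _ k K := [isSub for @coords k K].
HB.instance Definition _ k K := [Choice of EC k K by <:].

Section ECZmod.
Variables (k : rat) (K : numFieldType).
Implicit Types P Q R : EC k K.

Definition ec_zero : EC k K := @ECPoint k K None isT.
Definition ec_opp P : EC k K := ECPoint (on_curveN (coordsP P)).
Definition ec_add P Q : EC k K := ECPoint (on_curveD (coordsP P) (coordsP Q)).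

Lemma ec_addA : associative ec_add.
Proof. by move=> P Q R; apply/val_inj/add_coordsA; apply: coordsP. Qed.
Lemma ec_addC : commutative ec_add.
Proof. by move=> P Q; apply/val_inj/(@add_coordsC _ k); apply: coordsP. Qed.
Lemma ec_add0 : left_id ec_zero ec_add.
Proof. by move=> P; apply/val_inj. Qed.
Lemma ec_addN : left_inverse ec_zero ec_opp ec_add.
Proof. by move=> P; apply/val_inj/add_coordsN. Qed.

HB.instance Definition _ :=
  GRing.isZmodule.Build (EC k K) ec_addA ec_addC ec_add0 ec_addN.
End ECZmod.

Section BaseChange.
Variables (k : rat) (K L : numFieldType) (f : {rmorphism K -> L}).

Definition map_coords : option (K * K) -> option (L * L) :=
  omap (fun q => (f q.1, f q.2)).

Lemma map_coords_on q : on_curve k q -> on_curve k (map_coords q).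
Proof.
case: q => //= -[x y] /andP[/eqP /= h n0]; rewrite /on_affine /=.
rewrite -rmorphXn h rmorphD rmorphM rmorphXn rmorph_nat fmorph_rat eqxx /=.
by apply: contraNneq n0 => -[/eqP + /eqP]; rewrite !fmorph_eq0 => /eqP-> /eqP->.
Qed.

Definition ec_map (P : EC k K) : EC k L := ECPoint (map_coords_on (coordsP P)).
End BaseChange.

Section Phi.
Variables (D : rat) (K : numFieldType).

Definition phi (P : EC D K) : EC (-27 * D) K := ECPoint (phi_on (coordsP P)).

Lemma phi_is_zmod_morphism : zmod_morphism phi.
Proof.
move=> P Q; apply/val_inj; rewrite /= phi_coordsD ?phi_coordsN //.
  exact: coordsP.
by apply: on_curveN; apply: coordsP.
Qed.
HB.instance Definition _ :=
  GRing.isZmodMorphism.Build (EC D K) (EC (-27 * D) K) phi phi_is_zmod_morphism.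
End Phi.

Definition phi_image (D : rat) : {pred EC (-27 * D) rat} :=
  fun P => `[< exists Q : EC D rat, phi Q = P >].

Arguments phi_image D _ : clear implicits.

Lemma phi_image_closed D : zmod_closed (phi_image D).
Proof.
split; first by apply/asboolP; exists 0; rewrite raddf0.
move=> _ _ /asboolP[P <-] /asboolP[Q <-].
by apply/asboolP; exists (P - Q); rewrite raddfB.
Qed.
HB.instance Definition _ D :=
  GRing.isZmodClosed.Build (EC (-27 * D) rat) (phi_image D) (phi_image_closed D).

(* The point (0, sqrt k); [insubd] yields the point at infinity if k = 0. *)
Definition sqrt_point (k : rat) : EC k algC :=
  insubd (0 : EC k algC) (Some (0, sqrtC (ratr k))).

Definition generates (A : zmodType) (n : nat) (P : 'I_n -> A) : Prop :=
  forall X, exists c : 'I_n -> int, X = \sum_i P i *~ c i.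

Definition Zindependent (A : zmodType) (n : nat) (P : 'I_n -> A) : Prop :=
  forall c : 'I_n -> int, \sum_i P i *~ c i = 0 -> forall i, c i = 0.

Definition has_rank (A : zmodType) (r : nat) : Prop :=
  (exists P : 'I_r -> A, Zindependent P) /\
  (forall P : 'I_r.+1 -> A, ~ Zindependent P).

(* An abelian group killed by 3 has exactly one F_3-vector space structure,
   namely a x = x *+ a for the lift of a : 'F_3 to nat. *)
Definition F3_isomorphic (A : zmodType) (V : lmodType 'F_3) : Prop :=
  (forall x : A, x *+ 3 = 0) /\
  exists g : A -> V,
    [/\ bijective g, {morph g : x y / x + y} &
        forall (a : 'F_3) x, g (x *+ a) = a *: g x].

(* Every ring endomorphism of algC is bijective and fixes rat, so this is the
   absolute Galois group of the rationals. *)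
Notation absGal := {rmorphism algC -> algC}.

Section Descent.
Variable D : rat.

Definition cohomologous (c c' : absGal -> EC D algC) : Prop :=
  exists2 T : EC D algC, phi T = 0 &
    forall sigma : absGal, c sigma - c' sigma = ec_map sigma T - T.

(* [represents_delta P c]: the map c is a cocycle in the class delta(P) of
   H^1(Q, E^D[phi_D]).  The choice of Q over P is immaterial, and a map
   cohomologous to a cocycle with values in E^D[phi_D] is one itself. *)
Definition represents_delta (P : EC (-27 * D) rat)
    (c : absGal -> EC D algC) : Prop :=
  exists2 Q : EC D algC, phi Q = ec_map (ratr : {rmorphism rat -> algC}) P &
    cohomologous c (fun sigma => ec_map sigma Q - Q).

Definition log3 (zeta x : algC) : 'F_3 :=
  odflt 0 [pick a : 'F_3 | zeta ^+ a == x].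

Definition kummer (zeta : algC) (p : nat) (sigma : absGal) : 'F_3 :=
  log3 zeta (sigma (3.-root p%:R) / 3.-root p%:R).

Definition coefficient_vector (zeta : algC) (n : nat) (p : n.-tuple nat)
    (P : EC (-27 * D) rat) (lam : 'rV['F_3]_n) : Prop :=
  represents_delta P (fun sigma =>
    sqrt_point D *+ (\sum_i lam 0 i * kummer zeta (tnth p i) sigma)%R).

End Descent.

Section NumberFields.
Variable L : fieldExtType rat.

Definition integral_basis (n : nat) (w : n.-tuple L) : Prop :=
  basis_of fullv w /\
  forall x : L, integralOver (intr : int -> L) x <->
    exists c : 'I_n -> int, x = \sum_i tnth w i *~ c i.

Definition field_trace (x : L) : rat :=
  \sum_i coord (vbasis {:L}) i (x * (vbasis {:L})`_i).

Definition has_discriminant (d : rat) : Prop :=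
  exists2 w : (\dim {:L}).-tuple L, integral_basis w &
    d = \det (\matrix_(i, j) field_trace (tnth w i * tnth w j)).

(* The determinant of the coordinates of 1, gamma, gamma^2 on 1, w2, w3 is the
   ratio of 1 /\ gamma /\ gamma^2 to 1 /\ w2 /\ w3; it does not involve x1. *)
Definition index_form (w2 w3 : L) (I : rat -> rat -> rat) : Prop :=
  forall x1 x2 x3 : rat,
    let gamma := x1 *: 1 + x2 *: w2 + x3 *: w3 in
    \det (\matrix_(i < 3, j < 3) coord [tuple 1; w2; w3] j (gamma ^+ i)) =
    I x2 x3.

Definition quasi_monogenic : Prop :=
  exists w2 w3 I,
    [/\ integral_basis [tuple 1; w2; w3], index_form w2 w3 I &
        exists x y : rat, I x y = 1 \/ I x y = -1].

Definition field_iso (L' : fieldExtType rat) : Prop :=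
  exists f : {rmorphism L -> L'}, bijective f.

End NumberFields.

(* The field generated by the real cube root of m. *)
Definition Qcbrt (m : nat) : fieldExtType rat :=
  projT1 (num_field_exists [:: 3.-root (m%:R : algC)]).

Definition qm_cubic_field (d : rat) (L : fieldExtType rat) : Prop :=
  [/\ \dim {:L} = 3%N, has_discriminant L d & quasi_monogenic L].

(* [F] sends the elements of [A] bijectively to the isomorphism classes of the
   fields in [B].  A class is given by its membership predicate, and two
   classes are compared by extensional equivalence. *)
Definition bijective_onto_classes (T : Type) (A : T -> Prop)
    (B : fieldExtType rat -> Prop) (F : T -> fieldExtType rat -> Prop) : Prop :=
  [/\ forall W, A W -> exists2 L, B L & forall L', F W L' <-> field_iso L L',
      forall W W', A W -> A W' -> (forall L, F W L <-> F W' L) -> W = W' &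
      forall L, B L -> exists2 W, A W & forall L', F W L' <-> field_iso L L'].

Section Lines.
Variables (s : nat) (p : s.-tuple nat).

(* Coordinate 0 belongs to the prime 3, coordinate i + 1 to the i-th entry
   of p. *)
Definition radicand (v : 'rV['F_3]_s.+1) : nat :=
  (\prod_(i < s) tnth p i ^ v ord0 (lift ord0 i))%N.

Definition admissible (v : 'rV['F_3]_s.+1) : Prop :=
  [/\ v != 0, v 0 ord0 = 0, forall i : 'I_s, v 0 (lift ord0 i) != 0 &
      ((radicand v)%:Z = 1 %[mod 9])%Z \/ ((radicand v)%:Z = -1 %[mod 9])%Z].

Definition admissible_line (V W : {vspace 'rV['F_3]_s.+1}) : Prop :=
  (W <= V)%VS /\ exists2 v, admissible v & W = <[v]>%VS.

(* The union of the isomorphism classes attached to the generators of W; it is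
   a single class exactly when the field does not depend on the generator. *)
Definition line_class (W : {vspace 'rV['F_3]_s.+1})
    (L : fieldExtType rat) : Prop :=
  exists2 v, W = <[v]>%VS & field_iso (Qcbrt (radicand v)) L.

End Lines.

(* A cubic field of discriminant -3 n^2 with 3 not dividing n exists only for
   squarefree n, while the coefficient vectors for n and n q^3 with q | n span
   the same space: for n = 80 the point (40, -880) has the admissible coefficient
   line of 10, and Q(cbrt 10) has discriminant -300. *)
Definition squarefree (m : nat) : Prop :=
  forall q : nat, prime q -> ~~ (q ^ 2 %| m)%N.

(* Main.v *)
(* The cube of (y - 3n) / x on E^D is the pull-back by phi_D of 4 (Y - 9n), and
   translation by the kernel multiplies (y - 3n) / x by a cube root of unity.
   Hence, up to the sign of n, if P = (X, Y) has coefficient vector lambda, then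
   4 (Y - 9n) is m = prod p_i ^ lambda_i times a rational cube and 4 (Y + 9n) is m^2
   times one; unique factorization makes lambda unique, and Galois descent
   identifies the kernel of P |-> lambda with the image of phi_D.

   A cubic field of discriminant D is quasi-monogenic if and only if it contains a
   generator ga with ga^3 + p ga + q = 0 and -4 p^3 - 27 q^2 = D.  Then
   (-3p, 27q) is a point of E^(-27D), and by Cardano's formula the field contains
   the cube roots of 4 (27q - 9n) and 4 (27q + 9n), so it is Q(cbrt m).  Writing
   m = a b^2, the integers of Q(cbrt m) have discriminant -3 (ab)^2 or -27 (ab)^2
   according to whether m = +-1 mod 9 or not, which gives the conditions on lambda.
   Conversely the index form of Q(cbrt m) is b y^3 - a z^3 up to scaling, and the
   difference of 4 (Y + 9n) and 4 (Y - 9n) solves b y^3 - a z^3 = 1/3. *)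

Require Import Defs.
From HB Require Import structures.
From mathcomp Require Import all_boot all_order all_algebra all_field.
From mathcomp Require Import boolp ring.
Set Implicit Arguments. Unset Strict Implicit. Unset Printing Implicit Defensive.
Import Order.TTheory GRing.Theory Num.Theory.
Local Open Scope ring_scope.

(** * Galois descent *)

(** The root of D in [sqrt_point] and zeta are independent choices; comparing sqrt D with sqrt(-3) =
    2 zeta + 1 fixes N = n or N = -n, and with it which of Y - 9N and Y + 9N carries m. Both
    equations are kept because either side may vanish: this happens at (0, 9n) and (0, -9n), one of
    which is P_0. The point at infinity has no coordinates to put into them, so the uniqueness of
    its vector is read off after adding P_0. No cohomology group is built: a coboundary is absorbed
    into the choice of Q over P, and a function of Q divided by the matching product of cube roots
    is Galois invariant, hence rational. The modulus 9 appears because integers prime to 3 have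
    cubes +-1 modulo 9. If m is +-1 modulo 9, then (1 + e al + f be) / 3 is integral for suitable
    signs e and f, which divides the discriminant by 9. Integrality is turned into congruences by
    means of the three conjugates in [algC]: their trace, norm and Lagrange resolvents.
    Quasi-monogenicity enters through discriminants, since a change of basis multiplies them by the
    square of the determinant. *)

Lemma fixed_Crat (x : algC) :
  (forall sigma : {rmorphism algC -> algC}, sigma x = x) -> x \in Crat.
Proof.
move=> fx; have [p [Dp mon_p] _] := minCpolyP x.
have [r Dr] := closed_field_poly_normal (minCpoly x).
rewrite (monicP (minCpoly_monic x)) scale1r in Dr.
have [Qn [QnC [s1 Ds genQn]]] := num_field_exists r.
have split1 : splittingFieldFor 1 (map_poly (in_alg Qn) p) {:Qn}.
  exists s1 => //; apply/eqpP; exists (1, 1); rewrite ?oner_neq0 // !scale1r.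
  apply: (map_poly_inj QnC); rewrite -map_poly_comp.
  rewrite (eq_map_poly (g := ratr)); last by move=> a /=;
    rewrite alg_num_field fmorph_rat.
  rewrite -Dp Dr -Ds rmorph_prod big_map.
  by apply: eq_bigr => y _ /=; rewrite map_polyXsubC.
have pQ : map_poly (in_alg Qn) p \is a polyOver 1%AS.
  by apply/polyOverP=> i; rewrite coef_map /=; apply/rpredZ/mem1v.
have Qn_ax : FieldExt_isSplittingField _ Qn.
  by constructor; exists (map_poly (in_alg Qn) p).
pose Q' : splittingFieldType rat := HB.pack_for (splittingFieldType rat) Qn Qn_ax.
have gal : galois 1%AS {:Q'}.
  apply/and3P; split; first exact: sub1v.
    apply/separableP => y _; apply: pcharf0_separable => q.
    by rewrite pchar_lalg pchar_num.
  by apply/splitting_normalField; [exact: sub1v|exists (map_poly (in_alg Qn) p)].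
have : x \in r.
  by have := root_minCpoly x; rewrite Dr root_prod_XsubC.
rewrite -Ds => /mapP[y _ Dy].
have : y \in fixedField ('Gal({:Q'} / 1%AS))%g.
  apply/fixedFieldP; first exact: memvf.
  (* An automorphism of the splitting field of the minimal polynomial extends to [algC], and the
     extension fixes x by hypothesis. *)
  move=> s _; have [nu Dnu] := extend_algC_subfield_aut QnC s.
  by apply: (fmorph_inj QnC); rewrite Dnu -Dy fx.
rewrite (galois_fixedField gal) => /vlineP[a Da].
by rewrite Dy Da rmorphZ_num rmorph1 mulr1 Crat_rat.
Qed.

(** * Coefficient vectors *)

Section BaseChangeMorphism.
Variables (k : rat) (K L : numFieldType) (f : {rmorphism K -> L}).

Let fp (q : K * K) : L * L := (f q.1, f q.2).

Let fp_inj : injective fp.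
Proof. by move=> [a b] [c d] [/fmorph_inj -> /fmorph_inj ->]. Qed.

Lemma map_chord (a b : K * K) : fp (chord a b) = chord (fp a) (fp b).
Proof.
have Ds : f (slope a b) = slope (fp a) (fp b).
  rewrite /slope /fp /= (inj_eq (fmorph_inj f)); case: ifP => _.
    by rewrite rmorphM fmorphV rmorphM rmorphXn rmorph_nat.
  by rewrite rmorphM fmorphV !rmorphB.
rewrite /chord -Ds /fp /=.
by rewrite !(rmorph_nat, rmorphXn, rmorphN, rmorphD, fmorphV, rmorphM).
Qed.

Lemma map_add_coords (q1 q2 : option (K * K)) :
  map_coords f (add_coords q1 q2) =
  add_coords (map_coords f q1) (map_coords f q2).
Proof.
case: q1 q2 => [a|] [b|] //=.
rewrite -[(f a.1, f a.2)]/(fp a) -[(f b.1, f b.2)]/(fp b).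
have -> : opp_aff (fp b) = fp (opp_aff b) by rewrite /fp /opp_aff /= rmorphN.
by rewrite (inj_eq fp_inj); case: ifP => // _; rewrite -map_chord.
Qed.

Lemma ec_map_is_zmod_morphism : zmod_morphism (@ec_map k K L f).
Proof.
move=> P Q; apply: val_inj; rewrite /= map_add_coords; congr add_coords.
by case: (coords Q) => //= a; rewrite /opp_aff /= rmorphN.
Qed.
HB.instance Definition _ :=
  GRing.isZmodMorphism.Build (EC k K) (EC k L) (@ec_map k K L f)
    ec_map_is_zmod_morphism.

Lemma ec_map_inj : injective (@ec_map k K L f).
Proof.
move=> P Q /(congr1 (@coords _ _)) /= e; apply: val_inj; move: e => /=.
by case: (coords P) (coords Q) => [a|] [b|] //= [/fmorph_inj ea /fmorph_inj eb];
  rewrite [a]surjective_pairing ea eb -surjective_pairing.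
Qed.

End BaseChangeMorphism.

Lemma phi_ec_map (D : rat) (K L : numFieldType) (f : {rmorphism K -> L})
    (Q : EC D K) : phi (ec_map f Q) = ec_map f (phi Q).
Proof.
apply: val_inj => /=; case: (coords Q) => //= a.
rewrite fmorph_eq0; case: ifP => //= _; congr (Some (_, _)).
  by rewrite !(fmorph_rat, rmorph_nat, rmorphXn, rmorphN, rmorphD, fmorphV,
    rmorphM).
by rewrite !(fmorph_rat, rmorph_nat, rmorphXn, rmorphN, rmorphB, fmorphV, rmorphM).
Qed.

Lemma ec_map_ratr (D : rat) (sigma : {rmorphism algC -> algC}) (P : EC D rat) :
  ec_map sigma (ec_map (ratr : {rmorphism rat -> algC}) P) =
  ec_map (ratr : {rmorphism rat -> algC}) P.
Proof.
apply: val_inj => /=; case: (coords P) => //= a.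
by rewrite !fmorph_rat.
Qed.

Lemma ec_map_descent (D : rat) (Q : EC D algC) :
  (forall sigma : {rmorphism algC -> algC}, ec_map sigma Q = Q) ->
  exists Q0 : EC D rat, ec_map (ratr : {rmorphism rat -> algC}) Q0 = Q.
Proof.
case: Q => [[[x y]|] oQ] fQ; last by exists 0; apply: val_inj.
have fxy (sigma : {rmorphism algC -> algC}) : (sigma x, sigma y) = (x, y).
  by have /(congr1 (@coords _ _)) [-> ->] := fQ sigma.
have /CratP[x0 ex] : x \in Crat by apply: fixed_Crat => s; case: (fxy s).
have /CratP[y0 ey] : y \in Crat by apply: fixed_Crat => s; case: (fxy s).
have o0 : on_curve D (Some (x0, y0)).
  move: (oQ); rewrite ex ey /on_curve /on_affine /=.
  rewrite (_ : 4 * ratr x0 ^+ 3 + ratr D = ratr (4 * x0 ^+ 3 + ratr D)); last first.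
    by rewrite rmorphD rmorphM rmorphXn rmorph_nat fmorph_rat.
  rewrite -rmorphXn (inj_eq (fmorph_inj _)) => /andP[-> n0] /=.
  by apply: contraNneq n0 => -[-> ->]; rewrite !rmorph0.
by exists (ECPoint o0); apply: val_inj; rewrite /= ex ey.
Qed.

Lemma coords_sqrt_point (k : rat) : k != 0 ->
  coords (sqrt_point k) = Some (0, sqrtC (ratr k)).
Proof.
move=> k0; rewrite /sqrt_point -[coords _]/(val _) val_insubd ifT //.
rewrite /on_curve /on_affine /= sqrtCK expr0n mulr0 add0r eqxx /=.
apply: contra k0 => /eqP[/eqP]; rewrite sqrtC_eq0.
by rewrite fmorph_eq0.
Qed.

(** The tangent at (0, sqrt k) is horizontal and meets the curve there three times, so the point is
    an inflection point. For k = 0 the point is infinity by the default in [sqrt_point]. *)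
Lemma sqrt_point2 (k : rat) : sqrt_point k *+ 2 = - sqrt_point k.
Proof.
have [->|k0] := eqVneq k 0.
  have -> : sqrt_point 0 = 0; last by rewrite mul0rn oppr0.
  apply: val_inj; rewrite /sqrt_point val_insubd /on_curve /on_affine /=.
  by rewrite rmorph0 sqrtC0 eqxx andbF.
have d0 : sqrtC (ratr k) != 0 :> algC by rewrite sqrtC_eq0 fmorph_eq0.
apply: val_inj; rewrite mulr2n /=.
change (add_coords (coords (sqrt_point k)) (coords (sqrt_point k)) =
  opp_coords (coords (sqrt_point k))).
rewrite coords_sqrt_point //= ifF; last first.
  apply/negP => /eqP[/eqP]; rewrite -addr_eq0 -mulr2n.
  by rewrite mulrn_eq0 /= (negPf d0).
congr Some; rewrite /chord /slope /opp_aff /= eqxx expr0n /= mulr0 mul0r.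
by rewrite expr0n /= !(mul0r, subr0, addr0).
Qed.

Lemma sqrt_point3 (k : rat) : sqrt_point k *+ 3 = 0.
Proof. by rewrite mulrS sqrt_point2 subrr. Qed.

(** Elements of ['F_3] act on 3-torsion through their lifts to nat, while sums in ['F_3] are reduced
    modulo 3; this reconciles the two. *)
Lemma mulrn_F3 (A : zmodType) (x : A) (m : nat) : x *+ 3 = 0 ->
  x *+ (m %% 3) = x *+ m.
Proof.
by move=> x3; rewrite {2}(divn_eq m 3) mulrnDr mulnC mulrnA x3 mul0rn add0r.
Qed.

Lemma mulrn_F3D (A : zmodType) (x : A) (a b : 'F_3) : x *+ 3 = 0 ->
  x *+ (a + b)%R = x *+ a + x *+ b.
Proof. by move=> x3; rewrite -mulrnDr -[RHS]mulrn_F3. Qed.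

Section CoefficientVectors.
Variables (D : rat) (zeta : algC) (n : nat) (p : n.-tuple nat).
Implicit Types (P : EC (-27 * D) rat) (lam : 'rV['F_3]_n).

Let inC (P : EC (-27 * D) rat) := ec_map (ratr : {rmorphism rat -> algC}) P.
Let a lam (sigma : {rmorphism algC -> algC}) : 'F_3 :=
  \sum_i lam 0 i * kummer zeta (tnth p i) sigma.

(** The T that witnesses the coboundary lies in the kernel of [phi], so Q + T is another preimage of
    P, for which the cocycle is the prescribed one on the nose. From here on no coboundary
    appears. *)
Lemma coefficient_vectorP P lam :
  coefficient_vector zeta p P lam <->
  exists2 Q : EC D algC, phi Q = inC P &
    forall sigma : {rmorphism algC -> algC},
      ec_map sigma Q = Q + sqrt_point D *+ (a lam sigma).
Proof.
split=> [[Q fQ [T fT h]]|[Q fQ h]]; last first.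
  exists Q => //; exists 0 => [|sigma]; first exact: raddf0.
  by rewrite h raddf0 [Q + _]addrC addrK subrr subr0.
exists (Q + T) => [|sigma]; first by rewrite [LHS]raddfD /= fT addr0.
have /eqP := h sigma; rewrite subr_eq => /eqP.
rewrite -/(a lam sigma) => ->; rewrite [LHS]raddfD [_ - T + _]addrACA -opprD.
by rewrite [RHS]addrC [T + Q]addrC subrK addrC.
Qed.

Lemma coefficient_vectorD P P' lam lam' :
  coefficient_vector zeta p P lam -> coefficient_vector zeta p P' lam' ->
  coefficient_vector zeta p (P + P') (lam + lam').
Proof.
move=> /coefficient_vectorP[Q fQ h] /coefficient_vectorP[Q' fQ' h'].
apply/coefficient_vectorP; exists (Q + Q') => [|sigma].
  by rewrite [LHS]raddfD /= fQ fQ' /inC [RHS]raddfD.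
rewrite [LHS]raddfD /= h h' addrACA -mulrn_F3D ?sqrt_point3 //; congr (_ + _ *+ _).
by rewrite /a -big_split /=; congr nat_of_ord; apply: eq_bigr => i _;
  rewrite mxE mulrDl.
Qed.

Lemma coefficient_vectorN P lam :
  coefficient_vector zeta p P lam -> coefficient_vector zeta p (- P) (- lam).
Proof.
move=> /coefficient_vectorP[Q fQ h].
apply/coefficient_vectorP; exists (- Q) => [|sigma].
  by rewrite [LHS]raddfN /= fQ /inC [RHS]raddfN.
rewrite [LHS]raddfN /= h opprD; congr (_ + _).
apply/eqP; rewrite eq_sym -addr_eq0 -mulrn_F3D ?sqrt_point3 //; apply/eqP.
rewrite [X in _ *+ X](_ : _ = 0%N) //.
rewrite (_ : a (- lam) sigma + a lam sigma = 0) // /a -big_split big1 // => i _.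
by rewrite /= -mulrDl mxE addrC subrr mul0r.
Qed.

(** A zero cocycle means that the preimage of P is Galois invariant, hence rational. *)
Lemma coefficient_vector0P P :
  coefficient_vector zeta p P 0 <-> phi_image D P.
Proof.
have a0 sigma : a 0 sigma = 0.
  by rewrite /a big1 // => i _; rewrite mxE mul0r.
rewrite coefficient_vectorP; split=> [[Q fQ h]|/asboolP[Q fQ]].
  have [sigma|Q0 dQ] := @ec_map_descent _ Q; first by rewrite h a0 addr0.
  apply/asboolP; exists Q0;
    apply: (@ec_map_inj _ _ _ (ratr : {rmorphism rat -> algC})).
  by rewrite -phi_ec_map dQ fQ.
exists (ec_map (ratr : {rmorphism rat -> algC}) Q); first by rewrite phi_ec_map fQ.
by move=> sigma; rewrite a0 addr0 ec_map_ratr.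
Qed.

Lemma coefficient_vector_sum (r : nat) (P : 'I_r -> EC (-27 * D) rat)
    (M : 'M['F_3]_(r, n)) (c : 'I_r -> int) :
  (forall i, coefficient_vector zeta p (P i) (row i M)) ->
  coefficient_vector zeta p (\sum_i P i *~ c i) (\sum_i row i M *~ c i).
Proof.
move=> h.
have h0 : coefficient_vector zeta p (0 : EC (-27 * D) rat) 0.
  by apply: (proj2 (coefficient_vector0P 0)); exact: (rpred0 (phi_image D)).
have hn i m : coefficient_vector zeta p (P i *+ m) (row i M *+ m).
  elim: m => [|m IH]; first exact: h0.
  by have := coefficient_vectorD (h i) IH; rewrite -!mulrS.
elim/big_rec2: _ => // i lam Q _ hQ; apply: coefficient_vectorD hQ.
case: (c i) => m; first exact: hn.
by rewrite NegzE !mulrNz; apply: coefficient_vectorN; apply: hn.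
Qed.

End CoefficientVectors.

(** * Kummer theory and the descent map *)

Section Kummer.
Variable zeta : algC.
Hypothesis prim_zeta : 3.-primitive_root zeta.

Lemma zeta_neq1 : zeta != 1.
Proof.
have := prim_order_dvd prim_zeta 1; rewrite expr1 /= => h.
by rewrite -h.
Qed.

Lemma zeta_root : zeta ^+ 2 + zeta + 1 = 0.
Proof.
have z3 := prim_expr_order prim_zeta.
apply: (mulfI (x := zeta - 1)); first by rewrite subr_eq0 zeta_neq1.
by rewrite mulr0 -[RHS](subrr (zeta ^+ 3)) {2}z3; ring.
Qed.

Lemma zetaD (a b : 'F_3) : zeta ^+ (a + b)%R = zeta ^+ a * zeta ^+ b.
Proof. by rewrite -exprD -[RHS](prim_expr_mod prim_zeta). Qed.

Lemma zetaM (a b : 'F_3) : zeta ^+ (a * b)%R = (zeta ^+ b) ^+ a.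
Proof. by rewrite -exprM mulnC -[RHS](prim_expr_mod prim_zeta). Qed.

Lemma kummerP (p : nat) (sigma : {rmorphism algC -> algC}) :
  sigma (3.-root p%:R) = zeta ^+ kummer zeta p sigma * 3.-root p%:R.
Proof.
set r : algC := 3.-root p%:R.
have [r0|r0] := eqVneq r 0; first by rewrite r0 rmorph0 mulr0.
have r3 : r ^+ 3 = p%:R by rewrite rootCK.
have : (sigma r / r) ^+ 3 = 1.
  by rewrite exprMn exprVn -rmorphXn r3 rmorph_nat divff // -r3 expf_neq0.
move=> /(prim_rootP prim_zeta)[i Di]; rewrite /kummer /log3 -/r.
(* The quotient is a power of zeta, so the search in [log3] succeeds and its default value is not
   reached. *)
case: pickP => [b /eqP -> /=|/(_ i)]; first by rewrite divfK.
by rewrite Di eqxx.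
Qed.

(** The m of the overview before the exponent of 3 is known to vanish: unlike [radicand], it ranges
    over every coordinate of the vector. *)
Definition kummer_radicand (n : nat) (p : n.-tuple nat) (lam : 'rV['F_3]_n) : nat :=
  (\prod_i tnth p i ^ lam ord0 i)%N.

(** R is a cube root of m on which the Galois group acts through the same character as in the
    cocycle of lam; dividing by R therefore trivializes that cocycle. *)
Lemma kummer_radical (n : nat) (p : n.-tuple nat) (lam : 'rV['F_3]_n) :
  exists R : algC, R ^+ 3 = (kummer_radicand p lam)%:R /\
  forall sigma : {rmorphism algC -> algC},
    sigma R = zeta ^+ (\sum_i lam 0 i * kummer zeta (tnth p i) sigma)%R * R.
Proof.
exists (\prod_i (3.-root (tnth p i)%:R) ^+ lam ord0 i); split.
  rewrite -prodrXl /kummer_radicand natr_prod; apply: eq_bigr => i _.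
  by rewrite exprAC rootCK // natrX.
move=> sigma; rewrite rmorph_prod.
have -> : zeta ^+ (\sum_i lam 0 i * kummer zeta (tnth p i) sigma)%R =
    \prod_i (zeta ^+ kummer zeta (tnth p i) sigma) ^+ lam ord0 i.
  elim/big_rec2: _ => // i x y _ <-; by rewrite zetaD zetaM.
by rewrite -big_split; apply: eq_bigr => i _ /=; rewrite rmorphXn -exprMn -kummerP.
Qed.

(** The relation between d and zeta squares to d^2 = -3 N^2 and ties the choice of the square root
    to that of zeta: with -N in place of N the multipliers zeta and zeta^2 would be exchanged. The
    computation rests on 4 x^3 = (y - d) (y + d). *)
Lemma chord_kernel (x y d N : algC) : x != 0 -> d != 0 ->
  y ^+ 2 = 4 * x ^+ 3 + d ^+ 2 -> d = - N * (2 * zeta + 1) ->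
  let q := chord (x, y) (0, d) in
  [/\ (x, y) != opp_aff (0, d), q.1 != 0,
      (q.2 - 3 * N) / q.1 = zeta * ((y - 3 * N) / x) &
      (q.2 + 3 * N) / q.1 = zeta ^+ 2 * ((y + 3 * N) / x)].
Proof.
move=> x0 d0 h dE; have z1 := zeta_root.
have n2 : (2 : algC) != 0 by rewrite pnatr_eq0.
have yd0 : y - d != 0.
  rewrite subr_eq0; apply: contraNneq x0 => yd.
  have /eqP : 4 * x ^+ 3 = 0 by rewrite -[LHS](addrK (d ^+ 2)) -h yd subrr.
  by rewrite mulf_eq0 pnatr_eq0 expf_eq0.
have sE : slope (x, y) (0, d) = (y - d) / x.
  by rewrite /slope /= (negPf x0); field.
have x3E : 4 * x ^+ 3 = (y - d) * (y + d) by ring: h.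
have qE : chord (x, y) (0, d) = (- d * (y - d) / (2 * x ^+ 2),
    (y - d) ^+ 2 * d / (2 * x ^+ 3) - d).
  have e1 : ((y - d) / x) ^+ 2 / 4 - x - 0 = - d * (y - d) / (2 * x ^+ 2).
    apply: (mulIf (x := 4 * x ^+ 2));
      first by rewrite mulf_neq0 ?expf_neq0 ?pnatr_eq0.
    transitivity ((y - d) ^+ 2 - 4 * x ^+ 3); first by field.
    by rewrite x3E; field.
  by rewrite /chord sE /= e1; congr pair; field.
have q10 : - d * (y - d) / (2 * x ^+ 2) != 0.
  by rewrite !mulf_neq0 ?oppr_eq0 ?invr_eq0 ?mulf_neq0 ?expf_neq0.
move=> q; rewrite /q qE /=; split=> //.
  by rewrite /opp_aff; apply: contraNneq x0 => -[->].
- apply: (mulIf (x := 2 * x * d)); first by rewrite !mulf_neq0.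
  transitivity (- (y - d) * 2 * d + 4 * x ^+ 3 * (d + 3 * N) / (y - d)).
    by field; rewrite d0 x0 yd0.
  rewrite x3E; transitivity (2 * zeta * d * (y - 3 * N)); last by field.
  transitivity (- (y - d) * 2 * d + (y + d) * (d + 3 * N)); first by field.
  rewrite dE; apply/eqP; rewrite -subr_eq0; apply/eqP.
  transitivity (4 * N * y * (zeta ^+ 2 + zeta + 1)); first by ring.
  by rewrite z1 mulr0.
- apply: (mulIf (x := 2 * x * d)); first by rewrite !mulf_neq0.
  transitivity (- (y - d) * 2 * d + 4 * x ^+ 3 * (d - 3 * N) / (y - d)).
    by field; rewrite d0 x0 yd0.
  rewrite x3E; transitivity (2 * zeta ^+ 2 * d * (y + 3 * N)); last by field.
  transitivity (- (y - d) * 2 * d + (y + d) * (d - 3 * N)); first by field.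
  have -> : zeta ^+ 2 = - zeta - 1 by rewrite -[LHS]subr0 -z1; ring.
  rewrite dE; apply/eqP; rewrite -subr_eq0; apply/eqP.
  transitivity (- 4 * N * y * (zeta ^+ 2 + zeta + 1)); first by ring.
  by rewrite z1 mulr0.
Qed.

Lemma translate_kernel (D : rat) (Q : EC D algC) (x y N : algC) (a : nat) :
  D != 0 -> coords Q = Some (x, y) -> x != 0 ->
  sqrtC (ratr D) = - N * (2 * zeta + 1) ->
  exists x' y', [/\ coords (Q + sqrt_point D *+ a) = Some (x', y'), x' != 0,
      (y' - 3 * N) / x' = zeta ^+ a * ((y - 3 * N) / x) &
      (y' + 3 * N) / x' = (zeta ^+ a) ^+ 2 * ((y + 3 * N) / x)].
Proof.
move=> D0 cQ x0 dE; elim: a => [|a [x' [y' [c' x'0 e1 e2]]]].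
  by exists x, y; rewrite addr0 expr0 !mul1r expr1n mul1r.
have d0 : sqrtC (ratr D) != 0 :> algC by rewrite sqrtC_eq0 fmorph_eq0.
have h : y' ^+ 2 = 4 * x' ^+ 3 + sqrtC (ratr D) ^+ 2.
  have := coordsP (Q + sqrt_point D *+ a); rewrite c' sqrtCK.
  by case/andP => /eqP.
have [n0 q0 f1 f2] := chord_kernel x'0 d0 h dE.
exists (chord (x', y') (0, sqrtC (ratr D))).1, (chord (x', y') (0,
  sqrtC (ratr D))).2.
rewrite mulrSr addrA; split=> //.
- rewrite -surjective_pairing.
  change (add_coords (coords (Q + sqrt_point D *+ a)) (coords (sqrt_point D)) =
    Some (chord (x', y') (0, sqrtC (ratr D)))).
  by rewrite c' coords_sqrt_point // /add_coords (negPf n0).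
- by rewrite f1 e1 exprS mulrA.
- by rewrite f2 e2 mulrA -exprMn -exprS.
Qed.

(** Two numbers with the same Galois character have an invariant quotient; this replaces Hilbert
    90. *)
Lemma radical_quotient_Crat (w R : algC) (c : {rmorphism algC -> algC} -> algC) :
  R != 0 -> (forall sigma, c sigma != 0) ->
  (forall sigma : {rmorphism algC -> algC}, sigma R = c sigma * R) ->
  (forall sigma : {rmorphism algC -> algC}, sigma w = c sigma * w) ->
    exists q : rat, w = R * ratr q.
Proof.
move=> R0 c0 hR hw; have /CratP[q Dq] : w / R \in Crat.
  apply: fixed_Crat => sigma; rewrite rmorphM fmorphV hR hw.
  by field; rewrite R0 c0.
by exists q; rewrite -Dq mulrC divfK.
Qed.

Lemma descent (n D : rat) : n != 0 -> D = -3 * n ^+ 2 ->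
  exists2 N, N = n \/ N = - n &
  forall (s : nat) (p : s.-tuple nat) (P : EC (-27 * D) rat) lam X Y,
    (forall i, 0 < tnth p i)%N ->
    coefficient_vector zeta p P lam -> coords P = Some (X, Y) ->
    exists q q' : rat,
      4 * (Y - 9 * N) = (kummer_radicand p lam)%:R * q ^+ 3 /\
      4 * (Y + 9 * N) = (kummer_radicand p lam)%:R ^+ 2 * q' ^+ 3.
Proof.
move=> n0 DE; have z1 := zeta_root.
have D0 : D != 0 by rewrite DE mulf_neq0 // ?expf_neq0.
pose d : algC := sqrtC (ratr D); pose e := 2 * zeta + 1.
have ee : e ^+ 2 = - 3.
  by rewrite -[RHS](addr0) -[X in _ + X](mulr0 4) -z1 /e; ring.
have e0 : e != 0 by rewrite -sqrf_eq0 ee oppr_eq0 pnatr_eq0.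
(* Both d / sqrt(-3) and n are square roots of n^2; the sign between them is not determined, which
   is why N is only known up to sign. *)
have [N NE dE] : exists2 N, N = n \/ N = - n & d = - ratr N * e.
  have : (d / e) ^+ 2 = ratr n ^+ 2.
    rewrite exprMn exprVn sqrtCK ee DE rmorphM rmorphXn rmorphN rmorph_nat.
    by field.
  move/eqP; rewrite eqf_sqr => /orP[] /eqP h; [exists (- n)|exists n];
    try by [left|right].
    by rewrite -[LHS](divfK e0) h (rmorphN (ratr : {rmorphism rat -> algC})) opprK.
  by rewrite -[LHS](divfK e0) h.
have N2 : ratr D = - 3 * ratr N ^+ 2 :> algC.
  by rewrite -(sqrtCK (ratr D)) -/d dE exprMn ee; ring.
exists N => // s p P lam X Y p0 /coefficient_vectorP[Q fQ h] cP.
have : coords (phi Q) = Some (ratr X, ratr Y) by rewrite fQ /= cP.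
rewrite /= /phi_coords; case cQ: (coords Q) => [[x y]|] //=.
(* At x = 0 the isogeny takes the value infinity, whereas P is affine. *)
case: eqVneq => // x0 [XE YE].
have oQ : y ^+ 2 = 4 * x ^+ 3 + ratr D.
  by have := coordsP Q; rewrite cQ => /andP[/eqP].
have [R [R3 hR]] := kummer_radical p lam.
have m0 : (kummer_radicand p lam)%:R != 0 :> algC.
  rewrite pnatr_eq0 -lt0n /kummer_radicand; apply: prodn_gt0 => i.
  by rewrite expn_gt0 p0.
have R0 : R != 0 by apply: contraNneq m0 => R0; rewrite -R3 R0 expr0n.
pose c (sigma : {rmorphism algC -> algC}) :=
  zeta ^+ (\sum_i lam 0 i * kummer zeta (tnth p i) sigma)%R.
have c0 sigma : c sigma != 0.
  rewrite expf_neq0 //; apply/eqP => z0.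
  by move/eqP: z1; rewrite z0 expr0n !add0r oner_eq0.
have hw (sigma : {rmorphism algC -> algC}) :
    sigma ((y - 3 * ratr N) / x) = c sigma * ((y - 3 * ratr N) / x) /\
    sigma ((y + 3 * ratr N) / x) = c sigma ^+ 2 * ((y + 3 * ratr N) / x).
  have [x' [y' [c' x'0 e1 e2]]] := translate_kernel
    (\sum_i lam 0 i * kummer zeta (tnth p i) sigma)%R D0 cQ x0 dE.
  move: c'; rewrite -h /= cQ /= => -[xE yE].
  rewrite !rmorphM !fmorphV rmorphB rmorphD rmorphM rmorph_nat fmorph_rat.
  by rewrite xE yE e1 e2.
have [q wE] := radical_quotient_Crat R0 c0 hR (fun s => (hw s).1).
have [q' wE'] : exists q' : rat, (y + 3 * ratr N) / x = R ^+ 2 * ratr q'.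
  apply: (@radical_quotient_Crat _ _ (fun s => c s ^+ 2)).
  - by rewrite expf_neq0.
  - by move=> sigma; rewrite expf_neq0.
  - by move=> sigma; rewrite rmorphXn hR exprMn.
  - by move=> sigma; have [_ ->] := hw sigma.
(* With 4 x^3 = y^2 + 3 N^2 the formula for Y becomes y (y^2 + 27 N^2) / (y^2 + 3 N^2), whence Y -
   9N = (y - 3N)^3 / (y^2 + 3 N^2), and likewise with the opposite sign of N. *)
have x3 : x ^+ 3 = (y ^+ 2 + 3 * ratr N ^+ 2) / 4.
  by rewrite oQ N2; field.
have y0 : y ^+ 2 + 3 * ratr N ^+ 2 != 0.
  by rewrite -(mulfVK (nz4 _) (_ + _)) -x3 mulf_neq0 ?expf_neq0 ?pnatr_eq0.
exists q, q'; split; apply: (fmorph_inj (ratr : {rmorphism rat -> algC})).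
  rewrite !(rmorphM, rmorphXn, rmorphB, rmorph_nat) /= -R3 -exprMn -wE -YE N2.
  by move: x3 y0; move: (ratr N) => M x3 y0; rewrite expr_div_n !x3; field;
    rewrite y0.
rewrite !(rmorphXn, rmorphM, rmorphD, rmorph_nat) /= -R3 exprAC -exprMn -wE' -YE N2.
by move: x3 y0; move: (ratr N) => M x3 y0; rewrite expr_div_n !x3; field;
  rewrite y0.
Qed.

End Kummer.

(** * The quotient as a vector space *)

(** C is a relation because a coefficient vector is given by a property and not by a formula. The
    hypotheses make C the graph of a homomorphism from A onto V with kernel I, and the first
    isomorphism theorem applies. *)
Lemma quotient_F3_isomorphic (A : zmodType) (I : zmodClosed A)
    (E : vectType 'F_3) (V : {vspace E}) (C : A -> E -> Prop) :
  (forall x y u v, C x u -> C y v -> C (x + y) (u + v)) ->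
  (forall x u, C x u -> C (- x) (- u)) ->
  (forall x, C x 0 <-> x \in I) ->
  (forall u, C 0 u -> u = 0) ->
  (forall x, exists2 u, C x u & u \in V) ->
  (forall u, u \in V -> exists x, C x u) ->
  F3_isomorphic (Quotient.quot I) (subvs_of V).
Proof.
move=> CD CN C0 Cu Cex Csurj.
have uniqC x y u v : x - y \in I -> C x u -> C y v -> u = v.
  move=> /C0 cxy cx cy; apply/eqP; rewrite -subr_eq0; apply/eqP; apply: Cu.
  have := CD _ _ _ _ cxy (CN _ _ (CD _ _ _ _ cx (CN _ _ cy))).
  by rewrite subrr add0r => /CN; rewrite oppr0 opprK.
have piK x : repr (\pi_(Quotient.quot I)%qT x) - x \in I.
  by rewrite Quotient.idealrBE reprK.
have pi0 x : x \in I -> \pi_(Quotient.quot I)%qT x = 0.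
  by rewrite -{1}[x]subr0 Quotient.idealrBE => /eqP ->; rewrite piE.
have piD x y : \pi_(Quotient.quot I)%qT (x + y) =
    \pi_(Quotient.quot I)%qT x + \pi_(Quotient.quot I)%qT y by rewrite piE.
have piMn x n : \pi_(Quotient.quot I)%qT (x *+ n) = \pi_(Quotient.quot I)%qT x *+ n.
  by elim: n => [|n IH]; rewrite ?mulrS ?piD ?IH // !mulr0n piE.
have CMn x u n : C x u -> C (x *+ n) (u *+ n).
  move=> cx; elim: n => [|n IH]; last by rewrite !mulrS; apply: CD.
  by apply/C0/rpred0.
have E3 (u : E) : u *+ 3 = 0.
  by rewrite -scaler_nat (_ : 3%:R = 0) ?scale0r //; apply: val_inj.
pose lam x := projT1 (cid2 (Cex x)).
have lamC x : C x (lam x) by rewrite /lam; case: cid2.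
have lamV x : lam x \in V by rewrite /lam; case: cid2.
pose g (X : Quotient.quot I) : subvs_of V := Subvs (lamV (repr X)).
have gE X u : C (repr X) u -> vsval (g X) = u.
  by apply: uniqC (lamC _); rewrite subrr rpred0.
have gpi x u : C x u -> vsval (g (\pi_(Quotient.quot I)%qT x)) = u.
  by apply: uniqC (lamC _); apply: piK.
have gD : {morph g : x y / x + y}.
  move=> X Y; apply: val_inj; rewrite -{1}[X]reprK -{1}[Y]reprK -piD /=.
  by apply: gpi; apply: CD; apply: lamC.
have gMn X n : g (X *+ n) = g X *+ n.
  elim: n => [|n IH]; last by rewrite !mulrS gD IH.
  rewrite !mulr0n; apply: (addIr (g 0)); rewrite -gD !add0r //.
split.
  elim/quotW=> x; rewrite -piMn; apply: pi0; apply/C0.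
  have [u cx _] := Cex x.
  by rewrite -(E3 u); apply: CMn.
exists g; split=> //; last first.
  by move=> a X; rewrite gMn -scaler_nat natr_Zp.
have g_inj : injective g.
  move=> X Y gXY; rewrite -[X]reprK -[Y]reprK; apply/eqP.
  rewrite -Quotient.idealrBE; apply/C0.
  rewrite -(subrr (vsval (g X))); apply: CD; first exact: lamC.
  by rewrite gXY; apply/CN/lamC.
have g_surj u : exists X, g X = u.
  have [x cx] := Csurj _ (subvsP u).
  by exists (\pi_(Quotient.quot I)%qT x); apply/val_inj/gpi.
pose h u := projT1 (cid (g_surj u)).
have hK : cancel h g by move=> u; rewrite /h; case: cid.
by exists h => // X; apply: g_inj; rewrite hK.
Qed.

(** * Radicands modulo rational cubes *)

Section Radicands.
Variables (n : nat) (p : n.-tuple nat).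
Hypotheses (p_uniq : uniq p) (p_prime : forall i, prime (tnth p i)).
Implicit Types lam mu : 'rV['F_3]_n.

Lemma kummer_radicand_gt0 lam : (0 < kummer_radicand p lam)%N.
Proof. by rewrite /kummer_radicand; apply: prodn_gt0 => i;
  rewrite expn_gt0 prime_gt0 ?p_prime. Qed.

Lemma logn_prod_tnth (e : 'I_n -> nat) (j : 'I_n) :
  logn (tnth p j) (\prod_i tnth p i ^ e i) = e j.
Proof.
rewrite (bigD1 j) //= lognM ?expn_gt0 ?(prime_gt0 (p_prime _)) //; last first.
  by apply: prodn_gt0 => i; rewrite expn_gt0 prime_gt0 ?p_prime.
rewrite pfactorK // logn_coprime ?addn0 //.
elim/big_rec: _ => [|i x ij cx]; first by rewrite coprimen1.
rewrite coprimeMr cx andbT coprimeXr // prime_coprime // dvdn_prime2 //.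
by apply: contra ij => /eqP e'; apply/eqP/(tuple_uniqP _ p_uniq).
Qed.

(** After clearing denominators, the valuation at each prime of p modulo 3 is the exponent itself,
    which is less than 3. *)
Lemma kummer_radicand_inj lam mu (q : rat) :
  q != 0 ->
  (kummer_radicand p lam)%:R = (kummer_radicand p mu)%:R * q ^+ 3 -> lam = mu.
Proof.
move=> q0 e; apply/rowP=> j.
have e' : (kummer_radicand p lam * `|denq q| ^ 3 =
           kummer_radicand p mu * `|numq q| ^ 3)%N.
  have e' : (kummer_radicand p lam)%:Z * denq q ^+ 3 =
      (kummer_radicand p mu)%:Z * numq q ^+ 3.
    apply: (intr_inj (R := rat));
      rewrite [LHS]intrM [RHS]intrM !rmorphXn /= -!pmulrn e.
    rewrite -{1}(divq_num_den q) expr_div_n -mulrA divfK //.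
    by rewrite expf_neq0 // intr_eq0 denq_neq0.
  by have := congr1 absz e'; rewrite [LHS]abszM [RHS]abszM !abszX.
have lt3 (a : 'F_3) : (a < 3)%N by have := ltn_ord a.
have := congr1 (logn (tnth p j)) e'.
rewrite [LHS]lognM ?[RHS]lognM ?kummer_radicand_gt0 ?expn_gt0 ?absz_gt0
  ?denq_neq0 ?numq_eq0 ?q0 //.
rewrite !logn_prod_tnth !lognX => h; apply: val_inj => /=.
have := congr1 (modn^~ 3) h.
by rewrite /= ![(_ + 3 * _)%N]addnC ![(3 * _)%N]mulnC !modnMDl !modn_small.
Qed.

(** The number c collects the carries that arise when exponents are added modulo 3. *)
Lemma kummer_radicandD lam mu : exists2 c : nat, (0 < c)%N &
  (kummer_radicand p lam * kummer_radicand p mu =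
   kummer_radicand p (lam + mu) * c ^ 3)%N.
Proof.
exists (\prod_i tnth p i ^ ((lam ord0 i + mu ord0 i) %/ 3))%N.
  by apply: prodn_gt0 => i; rewrite expn_gt0 prime_gt0 ?p_prime.
rewrite /kummer_radicand (big_morph (fun x => x ^ 3)%N (fun x y => expnMn x y
  3) (exp1n 3)) -!big_split; apply: eq_bigr => i _ /=.
by rewrite -expnD -expnM -expnD mxE /= [X in _ = (_ ^ X)%N]addnC -divn_eq.
Qed.

(** Since [descent] says nothing about the point at infinity, lam is added to the vector mu of an
    affine point P = P + 0. Then mu and mu + lam are both vectors of P, and their radicands agree up
    to a cube. *)
Lemma coefficient_vector0_uniq (zeta : algC) (m D : rat)
    (P : EC (-27 * D) rat) mu lam :
  3.-primitive_root zeta -> m != 0 -> D = -3 * m ^+ 2 -> P != 0 ->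
  coefficient_vector zeta p P mu ->
  coefficient_vector zeta p (0 : EC (-27 * D) rat) lam -> lam = 0.
Proof.
move=> prim_zeta m0 DE P0 hP h0.
have [N NE h] := descent prim_zeta m0 DE.
have N0 : N != 0 by case: NE => ->; rewrite ?oppr_eq0.
case cP: (coords P) => [[X Y]|]; last by case/eqP: P0; apply: val_inj.
have hP' := coefficient_vectorD hP h0; rewrite addr0 in hP'.
have p0 i : (0 < tnth p i)%N by rewrite prime_gt0 ?p_prime.
have [q [q' [e e']]] := h _ _ _ _ _ _ p0 hP cP.
have [q1 [q1' [f f']]] := h _ _ _ _ _ _ p0 hP' cP.
suff muE : mu + lam = mu by rewrite -(addKr mu lam) muE addNr.
have k0 (nu : 'rV_n) : (kummer_radicand p nu)%:R != 0 :> rat.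
  by rewrite pnatr_eq0 -lt0n kummer_radicand_gt0.
(* If Y = 9N, the first equation only says 0 = 0; the second is then usable because the two left
   sides differ by 72 N. *)
have [Y0|Y0] := eqVneq (4 * (Y - 9 * N)) 0.
  have Y0' : 4 * (Y + 9 * N) != 0.
    have -> : 4 * (Y + 9 * N) = 72 * N + 4 * (Y - 9 * N) by ring.
    by rewrite Y0 addr0 mulf_neq0.
  have q0 : q' != 0 by apply: contraNneq Y0' => q0; rewrite e' q0 expr0n mulr0.
  have q10 : q1' != 0 by apply: contraNneq Y0' => q10; rewrite f' q10 expr0n mulr0.
  rewrite e' in f'.
  (* Here only the squares of the radicands are known to agree up to a cube. Squaring once more
     suffices, because a number and its fourth power differ by a cube. *)
  apply/esym/(@kummer_radicand_inj _ _ (((kummer_radicand p (mu + lam))%:R *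
    q1' ^+ 2) /
     ((kummer_radicand p mu)%:R * q' ^+ 2))).
    by rewrite !mulf_neq0 ?invr_eq0 ?mulf_neq0 ?expf_neq0.
  rewrite expr_div_n !exprMn; move: f' (k0 mu) (k0 (mu + lam)).
  set A := (kummer_radicand p (mu + lam))%:R; set B := (kummer_radicand p mu)%:R.
  move=> f' B0 A0.
  transitivity ((A ^+ 2 * q1' ^+ 3) ^+ 2 / (B ^+ 3 * q' ^+ 6)).
    by rewrite -f'; field; rewrite q0 B0.
  by field; rewrite q0 B0.
have q0 : q != 0 by apply: contraNneq Y0 => q0; rewrite e q0 expr0n mulr0.
have q10 : q1 != 0 by apply: contraNneq Y0 => q10; rewrite f q10 expr0n mulr0.
rewrite e in f.
apply/esym/(@kummer_radicand_inj _ _ (q1 / q));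
  first by rewrite mulf_neq0 ?invr_eq0.
by rewrite expr_div_n mulrA -f mulfK ?expf_neq0.
Qed.

End Radicands.

(** * Pure cubic fields *)

Definition rat_emb (L : fieldExtType rat) : {rmorphism rat -> L} := in_alg L.

Lemma rat_embM (L : fieldExtType rat) (x : rat) (u : L) :
  rat_emb L x * u = x *: u.
Proof. exact: mulr_algl. Qed.

Lemma rat_emb1 (L : fieldExtType rat) (x : rat) : x *: 1 = rat_emb L x.
Proof. by []. Qed.

Arguments rat_emb L : simpl never.
Global Opaque rat_emb.

Section Triples.
Variables (K : fieldType) (V : vectType K) (w1 w2 w3 : V).
Let w := [tuple w1; w2; w3].

Lemma lincomb3 (c : 'I_3 -> K) :
  \sum_i c i *: w`_i = c 0 *: w1 + c 1 *: w2 + c 2 *: w3.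
Proof.
rewrite !big_ord_recl big_ord0 addr0 addrA /=.
by congr (_ *: _ + c _ *: _ + c _ *: _); apply: val_inj.
Qed.

Lemma free3P :
  (forall x y z, x *: w1 + y *: w2 + z *: w3 = 0 -> [/\ x = 0, y = 0 & z = 0]) <->
  free w.
Proof.
split=> [h|/freeP h x y z e].
  apply/freeP => c; rewrite lincomb3 => /h[c0 c1 c2] i.
  case: i => [[|[|[|//]]]] lti;
    [rewrite -[RHS]c0|rewrite -[RHS]c1|rewrite -[RHS]c2];
    by congr c; apply: val_inj.
pose c (i : 'I_3) := [:: x; y; z]`_i.
have hc : \sum_i c i *: w`_i = 0 by rewrite lincomb3.
by split; [exact: (h c hc 0) | exact: (h c hc 1) | exact: (h c hc 2)].
Qed.

Lemma coord3 x y z (j : 'I_3) : free w ->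
  coord w j (x *: w1 + y *: w2 + z *: w3) = [:: x; y; z]`_j.
Proof.
move=> fw; pose c (i : 'I_3) := [:: x; y; z]`_i.
by have := coord_sum_free c j fw; rewrite lincomb3.
Qed.

Lemma basis3 : \dim {:V} = 3%N -> free w -> basis_of fullv w.
Proof.
by move=> d3 fw; rewrite basisEfree fw subvf size_tuple d3.
Qed.

Lemma basis3_expand : basis_of fullv w -> forall v,
  v = coord w 0 v *: w1 + coord w 1 v *: w2 + coord w 2 v *: w3.
Proof.
by move=> bw v; rewrite {1}(coord_basis bw (memvf v)) lincomb3.
Qed.

End Triples.

Section PureCubic.
Variables (L : fieldExtType rat) (a b : rat) (al be : L).
Local Notation iota := (rat_emb L).
Hypotheses (a0 : a != 0) (b0 : b != 0).
Hypothesis noncube : forall t : rat, t ^+ 3 != a * b ^+ 2.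
Hypotheses (al2 : al ^+ 2 = iota b * be) (be2 : be ^+ 2 = iota a * al).
Hypothesis albe : al * be = iota (a * b).

(** A relation with z != 0 gives al^2 = r al + t, hence al^3 = (r^2 + t) al + r t. As al is
    irrational, t = -r^2, and a b^2 = (-r)^3 would be a cube. No dimension is assumed, so that the
    degree of [Qcbrt] can be deduced from this. *)
Lemma pure_cubic_relation (x y z : rat) :
  x *: 1 + y *: al + z *: be = 0 -> [/\ x = 0, y = 0 & z = 0].
Proof.
have al3 : al ^+ 3 = iota (a * b ^+ 2).
  by rewrite exprS al2 mulrCA albe -rmorphM; congr (iota _); ring.
have iota_inj := fmorph_inj iota.
have irr t : al != iota t.
  apply: contra_neq (noncube t) => alt; apply: iota_inj.
  by rewrite rmorphXn -alt al3.
have fromiota u v : iota u * al = iota v -> u = 0 /\ v = 0.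
  move=> uv; have [u0|u0] := eqVneq u 0.
    by split=> //; apply: iota_inj; rewrite -uv u0 rmorph0 mul0r.
  case/negP: (irr (v / u)); apply/eqP.
  by rewrite fmorph_div -uv mulrAC mulfV ?fmorph_eq0 ?mul1r.
move=> e; have [z0|z0] := eqVneq z 0.
  move: e; rewrite z0 scale0r addr0 => /eqP; rewrite addr_eq0 => /eqP e.
  have [y0 x0] : - y = 0 /\ x = 0.
    by apply: fromiota; rewrite rmorphN mulNr rat_embM -e.
  by split=> //; apply/eqP; rewrite -oppr_eq0 y0.
pose r := - b * y / z; pose t := - b * x / z.
have al2E : al ^+ 2 = iota r * al + iota t.
  rewrite al2; apply: (mulfI (x := iota z)); first by rewrite fmorph_eq0.
  have -> : iota z * (iota b * be) = - iota b * (iota x + iota y * al).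
    rewrite mulrCA mulNr -mulrN; congr (_ * _); apply/eqP.
    by rewrite -addr_eq0 addrC !rat_embM e.
  rewrite /r /t !(fmorph_div, rmorphM, rmorphN) /=; field.
  by rewrite fmorph_eq0.
clearbody r t; have [rt /eqP] : r ^+ 2 + t = 0 /\ a * b ^+ 2 - r * t = 0.
  apply: fromiota; rewrite rmorphB -al3 [al ^+ 3]exprS al2E !(rmorphD, rmorphM,
    rmorphXn) /=.
  transitivity (iota r * al ^+ 2 + iota t * al - iota r * iota t); last by ring.
  by rewrite al2E; ring.
rewrite subr_eq0 => /eqP m; case/negP: (noncube (- r)).
have tE : t = - r ^+ 2 by apply/eqP; rewrite -addr_eq0 addrC rt.
by rewrite m tE; apply/eqP; ring.
Qed.

Lemma pure_cubic_free : free [tuple 1; al; be].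
Proof. by apply/free3P => x y z; apply: pure_cubic_relation. Qed.

Hypothesis dimL : \dim {:L} = 3%N.

Lemma pure_cubic_basis : basis_of fullv [tuple 1; al; be].
Proof. exact: basis3 dimL pure_cubic_free. Qed.

Lemma pure_cubicE (u : L) :
  exists x y z, u = iota x + iota y * al + iota z * be.
Proof.
have := basis3_expand pure_cubic_basis u.
set x := coord _ _ _; set y := coord _ _ _; set z := coord _ _ _ => ->.
by exists x, y, z; rewrite !rat_embM.
Qed.

Lemma pure_cubicM (x y z x' y' z' : rat) :
  (iota x + iota y * al + iota z * be) * (iota x' + iota y' * al + iota z' * be) =
  iota (x * x' + a * b * (y * z' + z * y')) +
  iota (x * y' + y * x' + a * z * z') * al +
  iota (x * z' + z * x' + b * y * y') * be.
Proof.
transitivity (iota x * iota x' + (iota y * iota z' + iota z * iota y') * (al * be) +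
  (iota x * iota y' + iota y * iota x') * al +
  (iota x * iota z' + iota z * iota x') * be +
  iota y * iota y' * al ^+ 2 + iota z * iota z' * be ^+ 2); first by ring.
by rewrite al2 be2 albe !(rmorphD, rmorphM) /=; ring.
Qed.

Lemma pure_cubic_inj (x y z x' y' z' : rat) :
  iota x + iota y * al + iota z * be = iota x' + iota y' * al + iota z' * be ->
  [/\ x = x', y = y' & z = z'].
Proof.
move=> e; have [] := @pure_cubic_relation (x - x') (y - y') (z - z').
  rewrite -!rat_embM !rmorphB.
  rewrite -[RHS](subrr (iota x + iota y * al + iota z * be)) {2}e.
  by rewrite mulr1; ring.
by move=> /eqP + /eqP + /eqP; rewrite !subr_eq0 => /eqP -> /eqP -> /eqP ->.
Qed.

(** An element with rational cube is a rational multiple of 1, al or be. This is what recovers the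
    radicand, up to cubes and squaring, from the field alone. *)
Lemma pure_cubic_rational_cube (x y z c : rat) :
  (iota x + iota y * al + iota z * be) ^+ 3 = iota c ->
  [\/ c = x ^+ 3, c = a * b ^+ 2 * y ^+ 3 | c = a ^+ 2 * b * z ^+ 3].
Proof.
rewrite exprS expr2 !pure_cubicM => e.
have {}e := etrans e (_ : iota c = iota c + iota 0 * al + iota 0 * be).
have [|h0 h1 h2] := pure_cubic_inj (e _); first by rewrite !rmorph0 !mul0r !addr0.
have f1 : x ^+ 2 * y + a * x * z ^+ 2 + a * b * y ^+ 2 * z = 0.
  apply: (mulfI (x := 3)) => //; rewrite mulr0 -[RHS]h1; ring.
have f2 : x ^+ 2 * z + b * x * y ^+ 2 + a * b * y * z ^+ 2 = 0.
  apply: (mulfI (x := 3)) => //; rewrite mulr0 -[RHS]h2; ring.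
have cE : c = x ^+ 3 + a * b ^+ 2 * y ^+ 3 + a ^+ 2 * b * z ^+ 3
    + 6 * a * b * x * y * z by rewrite -h0; ring.
have nc : a * z ^+ 3 = b * y ^+ 3 -> y = 0 /\ z = 0.
  move=> h; have [z0|z0] := eqVneq z 0.
    split=> //; move/eqP: h; rewrite z0 expr0n mulr0 eq_sym mulf_eq0 (negPf b0) /=.
    by rewrite expf_eq0 /= => /eqP.
  case/negP: (noncube (b * y / z)); rewrite expr_div_n exprMn.
  rewrite exprSr -mulrA -h; apply/eqP; field.
  by rewrite z0.
(* Eliminating the common terms between the vanishing coefficients of al and be leaves this product;
   its second factor vanishes only for y = z = 0, since (b y / z)^3 would otherwise be a b^2. *)
have : x * (a * z ^+ 3 - b * y ^+ 3) = 0.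
  transitivity ((x ^+ 2 * y + a * x * z ^+ 2 + a * b * y ^+ 2 * z) * z -
     (x ^+ 2 * z + b * x * y ^+ 2 + a * b * y * z ^+ 2) * y); first by ring.
  by rewrite f1 f2; ring.
move/eqP; rewrite mulf_eq0 subr_eq0 => /orP[/eqP x0|/eqP/nc[y0 z0]]; last first.
  by apply: Or31; rewrite cE y0 z0; ring.
move: f1 => /eqP; rewrite x0 expr0n /= mul0r mulr0 !mul0r !add0r.
rewrite !mulf_eq0 (negPf a0) (negPf b0) /= orbb => /orP[] /eqP yz0.
  by apply: Or33; rewrite cE x0 yz0; ring.
by apply: Or32; rewrite cE x0 yz0; ring.
Qed.

(** The target is an arbitrary commutative ring in order to serve twice: with [algC] for the three
    conjugates of an element, and with another cubic field for isomorphisms. *)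
Lemma pure_cubic_hom (R : comNzRingType) (g : {rmorphism rat -> R}) (al' be' : R) :
  al' ^+ 2 = g b * be' -> be' ^+ 2 = g a * al' -> al' * be' = g (a * b) ->
  exists f : {rmorphism L -> R}, forall x y z : rat,
    f (iota x + iota y * al + iota z * be) = g x + g y * al' + g z * be'.
Proof.
move=> al2' be2' albe'.
pose c i u := coord [tuple 1; al; be] i u.
pose f u := g (c 0 u) + g (c 1 u) * al' + g (c 2 u) * be'.
have fE x y z : f (iota x + iota y * al + iota z * be) = g x + g y * al' + g z
  * be'.
  by rewrite /f /c -[iota x]mulr1 !rat_embM !(coord3 _ _ _ _ pure_cubic_free).
have fB : zmod_morphism f.
  by move=> u v; rewrite /f /c !linearB !rmorphB /=; ring.
have fM : monoid_morphism f.
  split.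
    have -> : 1 = iota 1 + iota 0 * al + iota 0 * be.
      by rewrite rmorph1 rmorph0 !mul0r !addr0.
    by rewrite fE rmorph1 rmorph0 !mul0r !addr0.
  move=> u v; have [x [y [z ->]]] := pure_cubicE u.
  have [x' [y' [z' ->]]] := pure_cubicE v; rewrite pure_cubicM !fE.
  transitivity (g x * g x' + (g y * g z' + g z * g y') * (al' * be') +
    (g x * g y' + g y * g x') * al' + (g x * g z' + g z * g x') * be' +
    g y * g y' * al' ^+ 2 + g z * g z' * be' ^+ 2); last by ring.
  by rewrite al2' be2' albe' !(rmorphD, rmorphM) /=; ring.
pose faM := GRing.isZmodMorphism.Build L R f fB.
pose fmM := GRing.isMonoidMorphism.Build L R f fM.
pose fRM : {rmorphism _ -> _} := HB.pack f faM fmM.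
by exists fRM.
Qed.

End PureCubic.

(** For m not a cube this characterizes Q(cbrt m) up to isomorphism, by [cube_field_iso], without
    singling out one of the conjugate roots. *)
Definition cube_field (m : rat) (L : fieldExtType rat) : Prop :=
  \dim {:L} = 3%N /\ exists al : L, al ^+ 3 = rat_emb L m.

Lemma cube_rootE (L : fieldExtType rat) (a b : rat) (al : L) : b != 0 ->
  al ^+ 3 = rat_emb L (a * b ^+ 2) ->
  let be := rat_emb L b^-1 * al ^+ 2 in
  [/\ al ^+ 2 = rat_emb L b * be, be ^+ 2 = rat_emb L a * al &
      al * be = rat_emb L (a * b)].
Proof.
move=> b0 al3 be; have ib0 : rat_emb L b != 0 by rewrite fmorph_eq0.
split; rewrite /be.
- by rewrite fmorphV mulVKf.
- transitivity (rat_emb L b^-1 ^+ 2 * al * al ^+ 3); first by ring.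
  by rewrite al3 fmorphV !(rmorphM, rmorphXn); field.
- rewrite mulrCA -exprS al3 -rmorphM; congr (rat_emb L _).
  by field.
Qed.

Lemma cube_root1E (L : fieldExtType rat) (m : rat) (al : L) :
  al ^+ 3 = rat_emb L m ->
  [/\ al ^+ 2 = rat_emb L 1 * al ^+ 2, (al ^+ 2) ^+ 2 = rat_emb L m * al &
      al * al ^+ 2 = rat_emb L (m * 1)].
Proof.
move=> e; rewrite rmorph1 mul1r mulr1 -e; by split=> //; ring.
Qed.

Lemma cube_field_hom (m : rat) (L L' : fieldExtType rat) :
  (forall t : rat, t ^+ 3 != m) -> cube_field m L -> cube_field m L' ->
  forall (al : L) (al' : L'), al ^+ 3 = rat_emb L m -> al' ^+ 3 = rat_emb L' m ->
  exists f : {rmorphism L -> L'}, forall x y z : rat,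
    f (rat_emb L x + rat_emb L y * al + rat_emb L z * al ^+ 2) =
    rat_emb L' x + rat_emb L' y * al' + rat_emb L' z * al' ^+ 2.
Proof.
move=> nc [dL _] [dL' _] al al' e e'.
have [h1 h2 h3] := cube_root1E e; have [h1' h2' h3'] := cube_root1E e'.
have nc1 (t : rat) : t ^+ 3 != m * 1 ^+ 2 by rewrite expr1n mulr1.
have [f fE] := pure_cubic_hom nc1 h1 h2 h3 dL h1' h2' h3'.
by exists f.
Qed.

Lemma cube_field_iso (m : rat) (L L' : fieldExtType rat) :
  (forall t : rat, t ^+ 3 != m) -> cube_field m L -> cube_field m L' ->
  field_iso L L'.
Proof.
move=> nc hL hL'; have [_ [al e]] := hL; have [_ [al' e']] := hL'.
have [f fE] := cube_field_hom nc hL hL' e e'.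
have [f' fE'] := cube_field_hom nc hL' hL e' e.
have expand (M : fieldExtType rat) (ga : M) : cube_field m M ->
    ga ^+ 3 = rat_emb M m -> forall u, exists x y z,
    u = rat_emb M x + rat_emb M y * ga + rat_emb M z * ga ^+ 2.
  move=> [dM _] eM.
  have nc1 (t : rat) : t ^+ 3 != m * 1 ^+ 2 by rewrite expr1n mulr1.
  have [h1 h2 h3] := cube_root1E eM.
  exact: pure_cubicE nc1 h1 h3 dM.
exists f, f' => [u|u].
  by have [x [y [z ->]]] := expand _ _ hL e u; rewrite fE fE'.
by have [x [y [z ->]]] := expand _ _ hL' e' u; rewrite fE' fE.
Qed.

Lemma rmorph_rat_emb (L L' : fieldExtType rat) (f : {rmorphism L -> L'}) x :
  f (rat_emb L x) = rat_emb L' x.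
Proof.
by rewrite -[rat_emb L x]mulr1 -[rat_emb L' x]mulr1 !rat_embM rmorphZ_num
  rmorph1 -alg_num_field mulr_algl.
Qed.

Lemma field_iso_dim (L L' : fieldExtType rat) :
  field_iso L L' -> \dim {:L} = \dim {:L'}.
Proof.
case=> f [f' fK f'K].
pose g : L -> L' := f.
pose gaM := GRing.isZmodMorphism.Build L L' g (rmorphB f).
pose gsM := GRing.isScalable.Build rat L L' *:%R g (fmorph_numZ f).
pose fL : {linear L -> L'} := HB.pack g gaM gsM.
have fLE u : linfun fL u = f u by rewrite lfunE.
have -> : {:L'}%VS = (linfun fL @: fullv)%VS.
  apply/eqP; rewrite eqEsubv subvf andbT; apply/subvP => u _.
  by rewrite -(f'K u) -fLE memv_img ?memvf.
rewrite limg_dim_eq //; apply/eqP; rewrite capfv; apply/lker0P => u v.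
by rewrite !fLE => /fmorph_inj.
Qed.

Lemma field_iso_cube_field (m : rat) (L L' : fieldExtType rat) :
  field_iso L L' -> cube_field m L -> cube_field m L'.
Proof.
move=> iso [dL [al e]]; split; first by rewrite -(field_iso_dim iso).
by case: iso => f _; exists (f al); rewrite -rmorphXn e rmorph_rat_emb.
Qed.

Lemma Qcbrt_cube_field (m : nat) :
  (forall t : rat, t ^+ 3 != m%:R) -> cube_field m%:R (Qcbrt m).
Proof.
move=> nc; rewrite /Qcbrt;
  case: num_field_exists => L /= [LC [[|al [|//]] //= [e] gen]].
have al3 : al ^+ 3 = rat_emb L m%:R.
  by apply: (fmorph_inj LC); rewrite rmorphXn e rootCK // !rmorph_nat.
split; last by exists al.
have nc1 (t : rat) : t ^+ 3 != m%:R * 1 ^+ 2 by rewrite expr1n mulr1.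
have [h1 h2 h3] := cube_root1E al3.
apply/eqP; rewrite eqn_leq; apply/andP; split; last first.
  have fr := pure_cubic_free nc1 h1 h3.
  have := dimvS (subvf <<[tuple 1; al; al ^+ 2]>>).
  by move: fr; rewrite /free => /eqP ->.
rewrite -gen adjoin_seq1 dim_Fadjoin dimv1 muln1 -ltnS -size_minPoly.
have pE : 'X^3 - (rat_emb L m%:R)%:P \is a polyOver 1%VS.
  by rewrite rpredB ?rpredX ?polyOverX // polyOverC -rat_emb1 rpredZ ?mem1v.
have r0 : root ('X^3 - (rat_emb L m%:R)%:P) al.
  by rewrite rootE !hornerE al3 subrr.
rewrite -(size_XnsubC (rat_emb L m%:R) (isT : 0 < 3)%N).
apply: dvdp_leq; first by rewrite -size_poly_eq0 size_XnsubC.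
exact: minPoly_dvdp pE r0.
Qed.

(** * Traces and discriminants *)

Lemma det_mx33 (R : comNzRingType) (A : 'M[R]_3) :
  \det A = A 0 0 * (A 1 1 * A 2 2 - A 1 2 * A 2 1)
         - A 0 1 * (A 1 0 * A 2 2 - A 1 2 * A 2 0)
         + A 0 2 * (A 1 0 * A 2 1 - A 1 1 * A 2 0).
Proof.
pose f (i j : nat) := A (inord i) (inord j).
have fE (i j : 'I_3) : A i j = f i j by rewrite /f !inord_val.
rewrite (expand_det_row _ ord0) !big_ord_recl big_ord0 /cofactor.
rewrite !(expand_det_row _ ord0) !big_ord_recl !big_ord0 /cofactor !det_mx11 !mxE.
by rewrite !fE /= !/bump /=; ring.
Qed.

Section Discriminant.
Variable L : fieldExtType rat.

(** Expanding each basis in the other and exchanging the sums is the identity tr(ST) = tr(TS). *)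
Lemma field_trace_basis (n : nat) (w : n.-tuple L) (x : L) :
  basis_of fullv w -> field_trace x = \sum_i coord w i (x * w`_i).
Proof.
move=> bw; rewrite /field_trace; set v := vbasis _.
have bv : basis_of fullv v := vbasisP _.
transitivity (\sum_i \sum_(j < n) coord v i (x * w`_j) * coord w j v`_i).
  apply: eq_bigr => i _.
  rewrite {1}(coord_basis bw (memvf v`_i)) mulr_sumr linear_sum /=.
  by apply: eq_bigr => j _; rewrite -scalerAr linearZ /= mulrC.
rewrite exchange_big; apply: eq_bigr => j _ /=.
rewrite {2}(coord_basis bv (memvf (x * w`_j))) linear_sum /=.
by apply: eq_bigr => i _; rewrite linearZ.
Qed.

Lemma field_trace_lin (a : rat) (x y : L) :
  field_trace (a *: x + y) = a * field_trace x + field_trace y.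
Proof.
rewrite /field_trace mulr_sumr -big_split; apply: eq_bigr => i _ /=.
by rewrite mulrDl -scalerAl linearP.
Qed.

Lemma field_traceZ (a : rat) (x : L) : field_trace (a *: x) = a * field_trace x.
Proof.
have f0 : field_trace (0 : L) = 0.
  by rewrite /field_trace big1 // => i _; rewrite mul0r linear0.
by rewrite -[a *: x]addr0 field_trace_lin f0 addr0.
Qed.

Lemma field_trace_sum (I : finType) (F : I -> L) :
  field_trace (\sum_i F i) = \sum_i field_trace (F i).
Proof.
apply: (big_morph (@field_trace L)) => [x y|].
  by rewrite -[x in LHS]scale1r field_trace_lin mul1r.
by rewrite -(scale0r 0) field_traceZ mul0r.
Qed.

Definition tuple_disc (n : nat) (w : n.-tuple L) : rat :=
  \det (\matrix_(i, j) field_trace (tnth w i * tnth w j)).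

Definition coord_mx (n : nat) (w v : n.-tuple L) : 'M[rat]_n :=
  \matrix_(i, j) coord w j (tnth v i).

Lemma coord_mxE (n : nat) (w v : n.-tuple L) i : basis_of fullv w ->
  tnth v i = \sum_j coord_mx w v i j *: tnth w j.
Proof.
move=> bw; rewrite {1}(coord_basis bw (memvf (tnth v i))).
by apply: eq_bigr => j _; rewrite mxE -tnth_nth.
Qed.

Lemma tuple_disc_change (n : nat) (w v : n.-tuple L) : basis_of fullv w ->
  tuple_disc v = \det (coord_mx w v) ^+ 2 * tuple_disc w.
Proof.
move=> bw; rewrite /tuple_disc; set C := coord_mx w v; set T := \matrix_(i, j) _.
set T' := \matrix_(i, j) field_trace (tnth w i * tnth w j).
suff -> : T = C *m T' *m C^T by rewrite !det_mulmx det_tr; ring.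
apply/matrixP => i j; rewrite !mxE (coord_mxE v i bw) (coord_mxE v j bw).
rewrite mulr_suml field_trace_sum.
under [RHS]eq_bigr do rewrite mxE mulr_suml.
rewrite [RHS]exchange_big /=; apply: eq_bigr => k _.
rewrite mulr_sumr field_trace_sum; apply: eq_bigr => l _.
by rewrite !mxE -scalerAl -scalerAr !field_traceZ; ring.
Qed.

Lemma free_coord_mx (n : nat) (w v : n.-tuple L) : basis_of fullv w ->
  \det (coord_mx w v) != 0 -> basis_of fullv v.
Proof.
move=> bw d0; have dimn : \dim {:L} = n := size_basis bw.
rewrite basisEfree subvf size_tuple dimn leqnn !andbT.
apply/freeP => c e i.
have cM : (\row_k c k) *m coord_mx w v = 0.
  apply/rowP => j; rewrite !mxE -[RHS](linear0 (coord w j)) -e linear_sum.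
  by apply: eq_bigr => k _; rewrite !mxE linearZ (tnth_nth 0).
have : \row_k c k = 0.
  by apply: (can_inj (mulmxK (_ : coord_mx w v \in unitmx)));
    rewrite ?mul0mx // unitmxE unitfE.
by move/rowP/(_ i); rewrite !mxE.
Qed.

(** The two transition matrices are integral and inverse to each other, so their determinants are 1
    or -1, with square 1. *)
Lemma integral_basis_disc (n : nat) (w v : n.-tuple L) :
  integral_basis w -> integral_basis v -> tuple_disc w = tuple_disc v.
Proof.
move=> [bw iw] [bv iv].
have intC (w' v' : n.-tuple L) : integral_basis w' -> integral_basis v' ->
    exists Z : 'M[int]_n, coord_mx w' v' = map_mx intr Z.
  move=> [bw' iw'] [_ iv'].
  have ex (i : 'I_n) : exists c : 'rV[int]_n, tnth v' i = \sum_j tnth w' j *~ c 0 j.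
    have [c e] : exists c : 'I_n -> int, tnth v' i = \sum_j tnth w' j *~ c j.
      apply/iw'/iv'; exists (fun j => (i == j)%:Z).
      rewrite (bigD1 i) //= eqxx mulr1z big1 ?addr0 // => j /negPf.
      by rewrite eq_sym => ->; rewrite mulr0z.
    by exists (\row_j c j); rewrite e; apply: eq_bigr => j _; rewrite mxE.
  have [c e] := fin_all_exists ex.
  exists (\matrix_(i, j) c i 0 j); apply/matrixP => i j; rewrite !mxE e.
  have fw' := basis_free bw'.
  have -> : \sum_k tnth w' k *~ c i 0 k = \sum_k (c i 0 k)%:~R *: w'`_k.
    by apply: eq_bigr => k _; rewrite scaler_int -tnth_nth.
  by rewrite coord_sum_free.
have inv (w' v' : n.-tuple L) : basis_of fullv w' -> basis_of fullv v' ->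
    coord_mx w' v' *m coord_mx v' w' = 1%:M.
  move=> bw' bv'; apply/matrixP => i j; rewrite !mxE.
  transitivity (coord v' j (tnth v' i)).
    rewrite {1}(coord_mxE v' i bw') linear_sum.
    by apply: eq_bigr => k _; rewrite linearZ /= [X in _ * X]mxE.
  by rewrite (tnth_nth 0) coord_free ?(basis_free bv') //.
have [Z eZ] := intC _ _ (conj bw iw) (conj bv iv).
have [Z' eZ'] := intC _ _ (conj bv iv) (conj bw iw).
have := congr1 determinant (inv _ _ bw bv).
rewrite det_mulmx det1 eZ eZ' !det_map_mx -intrM => /(intr_inj (x2 := 1)) dd.
rewrite (tuple_disc_change v bw) eZ det_map_mx.
have /eqP := congr1 absz dd; rewrite abszM muln_eq1 => /andP[/eqP Z1 _].
by rewrite [\det Z]intEsign Z1 mulr1 -rmorphXn sqrr_sign rmorph1 mul1r.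
Qed.

Lemma has_discriminantP (n : nat) (w : n.-tuple L) d : integral_basis w ->
  has_discriminant L d <-> d = tuple_disc w.
Proof.
move=> iw; have dimn : n = \dim {:L}.
  by case: iw => bw _; rewrite (size_basis bw).
move: w iw; rewrite {}dimn => w iw; split=> [[w' iw' ->]|->]; last by exists w.
exact: integral_basis_disc.
Qed.

Lemma field_trace3 (w1 w2 w3 u : L) (c : 'I_3 -> 'I_3 -> rat) :
  basis_of fullv [tuple w1; w2; w3] ->
  u * w1 = c 0 0 *: w1 + c 0 1 *: w2 + c 0 2 *: w3 ->
  u * w2 = c 1 0 *: w1 + c 1 1 *: w2 + c 1 2 *: w3 ->
  u * w3 = c 2 0 *: w1 + c 2 1 *: w2 + c 2 2 *: w3 ->
  field_trace u = c 0 0 + c 1 1 + c 2 2.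
Proof.
move=> bw e1 e2 e3; have fw := basis_free bw.
rewrite (field_trace_basis u bw) !big_ord_recl big_ord0 addr0 /= e1 e2 e3.
by rewrite !coord3 //= addrA.
Qed.

End Discriminant.

(** * Norms modulo 27 *)

(** The k-th power of the denominator of t is prime to the numerator and hence divides c. *)
Lemma rat_int_root (k c : nat) (t : rat) :
  (forall q, prime q -> ~~ (q ^ k %| c)%N) ->
  t ^+ k * c%:R \in Num.int -> t \in Num.int.
Proof.
move=> cfree /intrP[z e].
have d0 : (denq t)%:~R != 0 :> rat by rewrite intr_eq0 denq_neq0.
have e' : numq t ^+ k * c%:Z = z * denq t ^+ k.
  apply: (intr_inj (R := rat)); rewrite [LHS]intrM [RHS]intrM !rmorphXn /=.
  rewrite -e numqE -pmulrn exprMn; ring.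
have dv : (`|denq t| ^ k %| c)%N.
  have : (`|denq t| ^ k %| `|numq t| ^ k * c)%N.
    by rewrite -!abszX -[c]/(`|c%:Z|)%N -abszM e' abszM dvdn_mull.
  by rewrite Gauss_dvdr // coprimeXl // coprimeXr // coprime_sym coprime_num_den.
suff d1 : denq t = 1 by apply/intrP; exists (numq t); rewrite numqE d1 mulr1.
have [le1|lt1] := leqP `|denq t| 1.
  by have := denq_gt0 t; move: le1; case: (denq t) => [[|[|?]]|?].
have /negP[] := cfree _ (pdiv_prime lt1).
exact: dvdn_trans (dvdn_exp2r k (pdiv_dvd _)) dv.
Qed.

Lemma euclid3 (x y : int) : (3 %| x * y)%Z -> (3 %| x)%Z \/ (3 %| y)%Z.
Proof. by rewrite !dvdzE abszM Euclid_dvdM // => /orP. Qed.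

Lemma euclid3X (x : int) (n : nat) : (3 %| x ^+ n)%Z -> (3 %| x)%Z.
Proof. by rewrite !dvdzE abszX Euclid_dvdX // => /andP[]. Qed.

Lemma gauss3 (n : nat) (w w' : int) :
  ~~ (3 %| w)%Z -> (3 ^+ n %| w * w')%Z -> (3 ^+ n %| w')%Z.
Proof.
move=> nw; rewrite Gauss_dvdzr // coprimezE abszX coprimeXl //.
by rewrite prime_coprime // -dvdzE.
Qed.

Lemma sign_mod3 (w : int) : ~~ (3 %| w)%Z ->
  exists2 s : int, s ^+ 2 = 1 & exists q, w = s + 3 * q.
Proof.
move=> nw; have wE := divz_eq w 3; set q := (w %/ 3)%Z in wE.
have : (w %% 3)%Z < 3 by rewrite ltz_pmod.
have := modz_ge0 w (isT : 3 != 0 :> int).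
move: wE nw; case: (w %% 3)%Z => [[|[|[|//]]]|//] wE nw _ _.
- by case/negP: nw; apply/dvdzP; exists q; rewrite wE addr0.
- by exists 1 => //; exists q; rewrite [LHS]wE mulrC addrC.
- by exists (-1) => //; exists (q + 1); rewrite [LHS]wE -[Posz 2]/(2 : int); ring.
Qed.

Lemma sign_eq_mod3 (s t : int) : s ^+ 2 = 1 -> t ^+ 2 = 1 -> (3 %| s - t)%Z ->
  s = t.
Proof.
by move=> /eqP; rewrite sqrf_eq1 => /orP[] /eqP -> /eqP;
  rewrite sqrf_eq1 => /orP[] /eqP ->.
Qed.

(* If al^3 = a b^2 and al^2 = b be, the hypotheses on x, y, z say that
   (x + y al + z be) / 3 has an integral characteristic polynomial. *)
Section Norms.
Variables a b x y z : int.
Local Notation A := (a * b ^+ 2 * y ^+ 3).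
Local Notation B := (a ^+ 2 * b * z ^+ 3).
Local Notation N := (x ^+ 3 + A + B - 3 * a * b * x * y * z).
Hypothesis tr2 : (3 %| x ^+ 2 - a * b * y * z)%Z.
Hypothesis nrm : (27 %| N)%Z.

(** For 3 | x the two hypotheses reduce to 27 | a b (b y^3 + a z^3) and 3 | a b y z, which are
    symmetric under exchanging (a, y, z) with (b, z, y). *)
Lemma norm_divisible : ~~ (9 %| a)%Z -> ~~ (9 %| b)%Z ->
  ~ ((3 %| a)%Z /\ (3 %| b)%Z) -> (3 %| x)%Z -> (3 %| y)%Z /\ (3 %| z)%Z.
Proof.
(* By the symmetry d may be taken prime to 3. If c = 3 c', then 9 | d u^3 + 3 c' v^3 gives first 3 |
   u and then 3 | v. If c is prime to 3 as well, 3 divides u or v, and the sum of cubes passes this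
   on to the other. *)
have half (c d u v : int) : ~~ (9 %| c)%Z -> ~~ (3 %| d)%Z ->
    (27 %| c * d * (d * u ^+ 3 + c * v ^+ 3))%Z -> (3 %| c * d * u * v)%Z ->
    (3 %| u)%Z /\ (3 %| v)%Z.
  move=> c9 d3 h huv; rewrite [c * d]mulrC -!mulrA in h huv.
  have {}h := @gauss3 3 _ _ d3 h; have {}huv := @gauss3 1 _ _ d3 huv.
  have [c3|c3] := boolP (3 %| c)%Z.
    case/dvdzP: c3 => c' Dc; have c3' : ~~ (3 %| c')%Z.
      by apply: contra c9 => /dvdzP[q Dq]; apply/dvdzP; exists q;
        rewrite Dc Dq -mulrA.
    have {}h : (9 %| d * u ^+ 3 + 3 * c' * v ^+ 3)%Z.
      apply: (@gauss3 2 c') => //; case/dvdzP: h => q Dq; apply/dvdzP; exists q.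
      apply: (mulfI (x := 3)) => //; transitivity (q * 27); last by ring.
      by rewrite -Dq Dc; ring.
    have u3 : (3 %| u)%Z.
      apply: (@euclid3X _ 3); apply: (@gauss3 1 d) => //.
      case/dvdzP: h => q Dq; apply/dvdzP; exists (3 * q - c' * v ^+ 3).
      have -> : d * u ^+ 3 = q * 9 - 3 * c' * v ^+ 3 by rewrite -Dq; ring.
      by ring.
    split=> //; apply: (@euclid3X _ 3); apply: (@gauss3 1 c') => //.
    case/dvdzP: h => q Dq; case/dvdzP: u3 => u' Du; apply/dvdzP.
    exists (q - 3 * d * u' ^+ 3); apply: (mulfI (x := 3)) => //.
    have -> : 3 * (c' * v ^+ 3) = q * 9 - d * u ^+ 3 by rewrite -Dq; ring.
    by rewrite Du; ring.
  have {}h := @gauss3 3 _ _ c3 h.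
  have cube (e f w t : int) : ~~ (3 %| f)%Z -> (27 %| e * w ^+ 3 + f * t ^+ 3)%Z ->
      (3 %| w)%Z -> (3 %| t)%Z.
    move=> f3 /dvdzP[q Dq] /dvdzP[w' Dw].
    apply: (@euclid3X _ 3); apply: (@gauss3 1 f) => //; apply/dvdzP.
    exists (9 * q - 9 * e * w' ^+ 3).
    have -> : f * t ^+ 3 = q * 27 - e * w ^+ 3 by rewrite -Dq; ring.
    by rewrite Dw; ring.
  have /euclid3[u3|v3] := @gauss3 1 _ _ c3 huv.
    by split=> //; apply: cube h u3.
  by split=> //; rewrite addrC in h; apply: cube h v3.
move=> a9 b9 ab /dvdzP[x' Dx].
have abyz : (3 %| a * b * y * z)%Z.
  case/dvdzP: tr2 => k Dk; apply/dvdzP; exists (x' * x - k).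
  have -> : a * b * y * z = x * x - k * 3 by rewrite -Dk; ring.
  by rewrite {2}Dx; ring.
have h : (27 %| a * b * (b * y ^+ 3 + a * z ^+ 3))%Z.
  case/dvdzP: nrm => l Dl; case/dvdzP: abyz => k Dk; apply/dvdzP.
  exists (l - x' ^+ 3 + x' * k).
  have -> : a * b * (b * y ^+ 3 + a * z ^+ 3) = l * 27 - x ^+ 3 + 3 * x * (k * 3).
    by rewrite -Dl -Dk; ring.
  by rewrite Dx; ring.
have [b3|b3] := boolP (3 %| b)%Z; last by apply: half a9 b3 h abyz.
have a3 : ~~ (3 %| a)%Z by apply/negP => a3; apply: ab.
have [||//] := half b a z y b9 a3.
  by rewrite [b * a]mulrC addrC.
by rewrite [b * a]mulrC -mulrA [z * y]mulrC mulrA.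
Qed.

(* With t = a b y z one has A B = t^3, hence modulo 27
   (A - x^3) (B - x^3) = (t - x^2)^2 (t + 2 x^2) = 0, while the two factors add up
   to 0 modulo 9. *)
Lemma norm_congruent : ~~ (3 %| x)%Z -> (9 %| A - x ^+ 3)%Z.
Proof.
move=> x3; move: tr2 nrm => /dvdzP[k Dk] /dvdzP[l Dl].
set t := a * b * y * z in Dk *.
have [j Dj] : exists j, (A - x ^+ 3) * (B - x ^+ 3) = 27 * j.
  exists (k ^+ 2 * (x ^+ 2 - k) - x ^+ 3 * l).
  have tE : t = x ^+ 2 - 3 * k by rewrite -[3 * k]mulrC -Dk; ring.
  have <- : t ^+ 3 - x ^+ 3 * (l * 27 + 3 * x * t - x ^+ 3) + x ^+ 6
     = 27 * (k ^+ 2 * (x ^+ 2 - k) - x ^+ 3 * l) by rewrite tE; ring.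
  by rewrite -Dl /t; ring.
have [i Di] : exists i, (A - x ^+ 3) + (B - x ^+ 3) = 9 * i.
  exists (3 * l - x * k).
  have -> : 9 * (3 * l - x * k) = l * 27 - 3 * x * (k * 3) by ring.
  by rewrite -Dl -Dk /t; ring.
move: Dj Di; move: (A - x ^+ 3) (B - x ^+ 3) => P Q Dj Di.
have h1 : (3 %| P)%Z.
  have [||] := @euclid3 P Q; first by apply/dvdzP; exists (9 * j); rewrite Dj; ring.
    by [].
  by move=> /dvdzP[q Dq]; apply/dvdzP; exists (3 * i - q);
    rewrite mulrBl -Dq -[P in LHS](addrK Q) Di; ring.
move/dvdzP: h1 => [p Dp];
  have {}Di : Q = 3 * (3 * i - p) by rewrite -[LHS](addKr P) Di Dp; ring.
have {}Dj : p * (3 * i - p) = 3 * j.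
  by apply: (mulfI (x := 9)) => //; transitivity (P * Q);
    [rewrite Dp Di|rewrite Dj]; ring.
have : (3 %| p)%Z.
  have [||] := @euclid3 p (3 * i - p); first by apply/dvdzP; exists j;
    rewrite Dj; ring.
    by [].
  by move=> /dvdzP[q Dq]; apply/dvdzP; exists (i - q); rewrite mulrBl -Dq; ring.
by move=> /dvdzP[q Dq]; apply/dvdzP; exists q; rewrite Dp Dq -mulrA.
Qed.

(** An integer congruent to a sign s modulo 3 has a cube congruent to s modulo 9. So a b^2 y^3 = x^3
    modulo 9 reads a b^2 t = s for the signs s of x and t of y, and e = s t. *)
Lemma norm_sign : ~~ (3 %| x)%Z -> exists2 e : int, e ^+ 2 = 1 &
  (9 %| a * b ^+ 2 - e)%Z /\ (3 %| y - e * x)%Z.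
Proof.
move=> x3; case/dvdzP: (norm_congruent x3) => k Dk.
have y3 : ~~ (3 %| y)%Z.
  apply: contra x3 => /dvdzP[y' Dy]; apply: (@euclid3X _ 3); apply/dvdzP.
  exists (9 * a * b ^+ 2 * y' ^+ 3 - 3 * k).
  have -> : x ^+ 3 = A - k * 9 by rewrite -Dk; ring.
  by rewrite Dy; ring.
have [s s1 [x' Dx]] := sign_mod3 x3; have [t t1 [y' Dy]] := sign_mod3 y3.
exists (s * t); first by rewrite exprMn s1 t1.
have xE : x ^+ 3 = s + 9 * (3 * x' ^+ 3 + 3 * x' ^+ 2 * s + x').
  transitivity (s ^+ 2 * s + 9 * (3 * x' ^+ 3 + 3 * x' ^+ 2 * s + x' * s ^+ 2)).
    by rewrite Dx; ring.
  by rewrite s1; ring.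
have yE : y ^+ 3 = t + 9 * (3 * y' ^+ 3 + 3 * y' ^+ 2 * t + y').
  transitivity (t ^+ 2 * t + 9 * (3 * y' ^+ 3 + 3 * y' ^+ 2 * t + y' * t ^+ 2)).
    by rewrite Dy; ring.
  by rewrite t1; ring.
move: Dk; rewrite xE yE; set X := 3 * x' ^+ 3 + _ + _; set Y := 3 * y' ^+ 3 + _ + _.
move=> Dk; split; apply/dvdzP.
  exists (t * (k + X - a * b ^+ 2 * Y)).
  transitivity (a * b ^+ 2 * t ^+ 2 - s * t); first by rewrite t1 mulr1.
  transitivity (t * (a * b ^+ 2 * (t + 9 * Y) - (s + 9 * X) + 9 * (X - a * b ^+
    2 * Y))).
    by ring.
  by rewrite Dk; ring.
exists (y' - s * t * x'); rewrite Dx Dy.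
transitivity (t - s ^+ 2 * t + (y' - s * t * x') * 3); first by ring.
by rewrite s1 mul1r subrr add0r.
Qed.

(** The integral triples thus lie in the lattice spanned by (3, 0, 0), (0, 3, 0) and (1, e, f). For
    x prime to 3, y = e x comes from [norm_sign], and then x^2 = a b y z = f x z modulo 3 yields z =
    f x. *)
Lemma norm_lattice (e f : int) : e ^+ 2 = 1 -> f ^+ 2 = 1 ->
  (9 %| a * b ^+ 2 - e)%Z -> (3 %| a * b * e * f - 1)%Z ->
  (3 %| y - e * x)%Z /\ (3 %| z - f * x)%Z.
Proof.
move=> e1 f1 /dvdzP[k Dk] /dvdzP[l Dl].
have ab3 : ~~ (3 %| a * b)%Z.
  apply/negP => /dvdzP[q Dq]; have : (3 %| 1)%Z by apply/dvdzP;
    exists (q * e * f - l);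
    rewrite mulrBl -Dl Dq; ring.
  by [].
have a3 : ~~ (3 %| a)%Z by apply: contra ab3; apply: dvdz_mulr.
have b3 : ~~ (3 %| b)%Z by apply: contra ab3; apply: dvdz_mull.
have n9 (c : int) : ~~ (3 %| c)%Z -> ~~ (9 %| c)%Z.
  by apply: contra => /dvdzP[q ->]; apply/dvdzP; exists (3 * q); ring.
have [x3|x3] := boolP (3 %| x)%Z.
  have [] := norm_divisible (n9 _ a3) (n9 _ b3) _ x3; first by case=> /(negP a3).
  by move=> y3 z3; split; rewrite rpredB ?dvdz_mull.
have [g g1 [/dvdzP[k' Dk'] yg]] := norm_sign x3.
have ge : g = e.
  apply: sign_eq_mod3 => //; apply/dvdzP; exists (3 * (k - k')).
  transitivity ((a * b ^+ 2 - e) - (a * b ^+ 2 - g)); first by ring.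
  by rewrite Dk Dk'; ring.
split; first by rewrite -ge.
case/dvdzP: yg => y' Dy; case/dvdzP: tr2 => j Dj; rewrite ge in Dy.
have : (3 ^+ 1 %| x * (z - f * x))%Z.
  have abe : a * b * e = f * (1 + 3 * l).
    transitivity (a * b * e * f ^+ 2); first by rewrite f1 mulr1.
    transitivity (f * (a * b * e * f - 1) + f); first by ring.
    by rewrite Dl; ring.
  have yE : y = e * x + y' * 3 by rewrite -Dy; ring.
  apply/dvdzP; rewrite expr1; exists (- f * (j + l * f * x * z + a * b * y' * z)).
  transitivity (f ^+ 2 * x * z - f * x ^+ 2); first by rewrite f1; ring.
  transitivity (f * (a * b * y * z - x ^+ 2) + f * (f * x * z - a * b * y * z)).
    by ring.
  have -> : a * b * y * z - x ^+ 2 = - (j * 3) by rewrite -Dj; ring.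
  have -> : a * b * y * z = (a * b * e) * x * z + 3 * a * b * y' * z by rewrite
    yE; ring.
  by rewrite abe; ring.
by apply: gauss3.
Qed.

(** Put t = a b e f = 1 + 3k, A = a b^2 e and B = a^2 b f, so that A B = t^3. Then 1 + A + B - 3t =
    (t - 1)^2 (t + 2) - (A - 1) (B - 1), where the first product is 27 k^2 (k + 1), while 9 | A - 1
    and 3 | B - 1. *)
Lemma norm_generator (e f : int) : e ^+ 2 = 1 -> f ^+ 2 = 1 ->
  (9 %| a * b ^+ 2 - e)%Z -> (3 %| a * b * e * f - 1)%Z ->
  (27 %| 1 + a * b ^+ 2 * e + a ^+ 2 * b * f - 3 * a * b * e * f)%Z.
Proof.
move=> e1 f1 /dvdzP[l Dl] /dvdzP[k Dk].
have AE : a * b ^+ 2 * e = 1 + 9 * (l * e).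
  transitivity ((a * b ^+ 2 - e) * e + e ^+ 2); first by ring.
  by rewrite Dl e1; ring.
have tE : a * b * e * f = 1 + 3 * k by rewrite -[LHS](subrK 1) Dk; ring.
have AB : (a * b ^+ 2 * e) * (a ^+ 2 * b * f) = (a * b * e * f) ^+ 3.
  transitivity (a ^+ 3 * b ^+ 3 * (e ^+ 2) * e * (f ^+ 2) * f); last by ring.
  by rewrite e1 f1; ring.
set B := a ^+ 2 * b * f in AB *.
have B1 : B - 1 = 3 * (9 * k ^+ 3 + 9 * k ^+ 2 + 3 * k - 3 * l * e * B).
  transitivity ((1 + 3 * k) ^+ 3 - 1 - 9 * (l * e) * B); last by ring.
  by rewrite -tE -AB AE; ring.
apply/dvdzP; exists (k ^+ 2 * (k + 1) - l * e * (9 * k ^+ 3 + 9 * k ^+ 2 + 3 *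
  k - 3 * l * e * B)).
transitivity ((1 + 3 * k) ^+ 3 - 3 * (1 + 3 * k) + 2 - 9 * (l * e) * (B - 1)).
  have -> : 3 * a * b * e * f = 3 * (a * b * e * f) by ring.
  by rewrite -tE -AB tE AE; ring.
by rewrite B1; ring.
Qed.

End Norms.

(** * Integers of pure cubic fields *)

Lemma integralOver_Aint (L : fieldExtType rat) (f : {rmorphism L -> algC}) (u : L) :
  integralOver (intr : int -> L) u -> f u \in Aint.
Proof.
case=> p mon_p rp; apply: (@root_monic_Aint (map_poly intr p)).
- have -> : map_poly (intr : int ->
  algC) p = map_poly f (map_poly (intr : int -> L) p).
    by rewrite -map_poly_comp; apply: eq_map_poly => c /=; rewrite rmorph_int.
  by rewrite fmorph_root.
- by rewrite monic_map.
- by apply/polyOverP => i; rewrite coef_map intr_int.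
Qed.

Section PureCubicIntegers.
Variables (L : fieldExtType rat) (a b : int) (al be : L).
Local Notation iota := (rat_emb L).
Local Notation A := (a%:~R : rat).
Local Notation B := (b%:~R : rat).
Hypotheses (b0 : b != 0).
Hypothesis noncube : forall t : rat, t ^+ 3 != A * B ^+ 2.
Hypothesis cubefreeA : forall t : rat,
  t ^+ 3 * (A * B ^+ 2) \in Num.int -> t \in Num.int.
Hypothesis cubefreeB : forall t : rat,
  t ^+ 3 * (A ^+ 2 * B) \in Num.int -> t \in Num.int.
Hypotheses (al2 : al ^+ 2 = iota B * be) (be2 : be ^+ 2 = iota A * al).
Hypothesis albe : al * be = iota (A * B).
Hypothesis dimL : \dim {:L} = 3%N.

(** The conjugates u0, u1, u2 of u in [algC] are algebraic integers. Their sum bounds the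
    denominator of x, their resolvents those of y and z; the two divisibilities say that the other
    symmetric functions of u0, u1, u2 are integers. *)
Lemma integral_coords (x y z : rat) :
  integralOver (intr : int -> L) (iota x + iota y * al + iota z * be) ->
  exists X Y Z : int, [/\ x = X%:~R / 3, y = Y%:~R / 3, z = Z%:~R / 3 &
    (3 %| X ^+ 2 - a * b * Y * Z)%Z /\
    (27 %| X ^+ 3 + a * b ^+ 2 * Y ^+ 3 + a ^+ 2 * b * Z ^+ 3
           - 3 * a * b * X * Y * Z)%Z].
Proof.
set u := _ + _ => iu.
have [zeta prim_zeta] := C_prim_root_exists (isT : 0 < 3)%N.
have z1 := zeta_root prim_zeta; have z3 := prim_expr_order prim_zeta.
pose g : {rmorphism rat -> algC} := ratr.
pose al0 : algC := 3.-root (g (A * B ^+ 2)); pose be0 := al0 ^+ 2 / g B.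
have gB : g B != 0 by rewrite fmorph_eq0 intr_eq0.
have ib0 : b%:~R != 0 :> algC by rewrite intr_eq0.
have al03 : al0 ^+ 3 = g (A * B ^+ 2) by rewrite rootCK.
have gAB2 : g (A * B ^+ 2) = g A * g B ^+ 2 by rewrite rmorphM rmorphXn.
have gA2B : g (A ^+ 2 * B) = g A ^+ 2 * g B by rewrite rmorphM rmorphXn.
have al02 : al0 ^+ 2 = g B * be0 by rewrite /be0 mulrC divfK.
have albe0 : al0 * be0 = g (A * B).
  by rewrite /be0 mulrA -exprS al03 gAB2 rmorphM; field.
have be02 : be0 ^+ 2 = g A * al0.
  transitivity (al0 ^+ 3 * al0 / g B ^+ 2); first by rewrite /be0; field.
  by rewrite al03 gAB2; field.
have conj (w : algC) : w ^+ 3 = 1 ->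
    g x + g y * (w * al0) + g z * (w ^+ 2 * be0) \in Aint.
  move=> w3.
  have [|||f fE] := @pure_cubic_hom L A B al be noncube al2 be2 albe dimL
     algC g (w * al0) (w ^+ 2 * be0).
  - by rewrite exprMn al02; ring.
  - by transitivity (w ^+ 3 * w * be0 ^+ 2); [ring|rewrite w3 be02; ring].
  - by transitivity (w ^+ 3 * (al0 * be0)); [ring|rewrite w3 albe0; ring].
  by rewrite -fE; apply: integralOver_Aint.
have Az : zeta \in Aint := Aint_prim_root prim_zeta.
have A0 := conj 1 (expr1n _ _).
have A1 := conj zeta z3.
have A2 := conj (zeta ^+ 2) (etrans (exprAC _ _ _) (etrans (congr1 (fun w => w
  ^+ 2) z3) (expr1n _ _))).
set u0 := _ + _ in A0; set u1 := _ + _ in A1; set u2 := _ + _ in A2.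
have zE : zeta ^+ 2 = - zeta - 1.
  by apply/eqP; rewrite -subr_eq0 -z1; apply/eqP; ring.
have z4 : zeta ^+ 4 = zeta by rewrite exprS z3 mulr1.
pose q := g y * al0; pose r := g z * be0.
have u0E : u0 = g x + q + r by rewrite /u0 /q /r; ring.
have u12 : u1 + u2 = 2 * g x - q - r.
  transitivity (2 * g x + (q + r) * (zeta ^+ 2 + zeta + 1) - q - r
     + r * (zeta ^+ 4 - zeta)); first by rewrite /u1 /u2 /q /r; ring.
  by rewrite z1 z4; ring.
have u1u2 : u1 * u2 = g x ^+ 2 + q ^+ 2 + r ^+ 2 - g x * q - g x * r - q * r.
  transitivity (g x ^+ 2 + zeta ^+ 3 * q ^+ 2 + zeta ^+ 3 * zeta ^+ 3 * r ^+ 2 +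
    g x * q * (zeta ^+ 2 + zeta) + g x * r * (zeta ^+ 2 + zeta ^+ 4) +
    q * r * (zeta ^+ 3 * zeta ^+ 2 + zeta ^+ 4)).
    by rewrite /u1 /u2 /q /r; ring.
  by rewrite z4 z3 zE; ring.
have qr : q * r = g (A * B * y * z).
  rewrite [g _]rmorphM [g (_ * y)]rmorphM -albe0 /q /r; ring.
have q3 : q ^+ 3 = g (A * B ^+ 2 * y ^+ 3).
  by rewrite /q exprMn al03 [RHS]rmorphM rmorphXn mulrC.
have r3 : r ^+ 3 = g (A ^+ 2 * B * z ^+ 3).
  have -> : r ^+ 3 = g z ^+ 3 * (be0 ^+ 2 * be0) by rewrite /r; ring.
  by rewrite be02 -[g A * al0 * be0]mulrA albe0 -rmorphXn -!rmorphM;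
    congr (g _); ring.
have rat_int (t : rat) : g t \in Aint -> t \in Num.int.
  by move=> h; rewrite -Cint_rat Cint_rat_Aint ?Crat_rat.
have /intrP[X DX] : 3 * x \in Num.int.
  apply: rat_int; have -> : g (3 * x) = u0 + u1 + u2; last first.
    exact: rpredD (rpredD A0 A1) A2.
  by rewrite rmorphM rmorph_nat -addrA u12 u0E; ring.
(* The Lagrange resolvent u0 + zeta^2 u1 + zeta u2 isolates 3 y al0; its cube is a rational
   algebraic integer, and a b^2 is cube-free. *)
have /intrP[Y DY] : 3 * y \in Num.int.
  apply/cubefreeA/rat_int.
  have -> : g ((3 * y) ^+ 3 * (A * B ^+ 2)) = (u0 + zeta ^+ 2 * u1 + zeta * u2)
    ^+ 3.
    have -> : u0 + zeta ^+ 2 * u1 + zeta * u2 = 3 * q.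
      transitivity (g x * (zeta ^+ 2 + zeta + 1) + q * (1 + zeta ^+ 3 + zeta ^+ 3)
         + r * (1 + zeta ^+ 4 + zeta ^+ 3 * zeta ^+ 2)).
        by rewrite /u0 /u1 /u2 /q /r; ring.
      by rewrite z4 z3 zE; ring.
    have -> : (3 * y) ^+ 3 * (A * B ^+ 2) = 27 * (A * B ^+ 2 * y ^+ 3) by ring.
    by rewrite rmorphM rmorph_nat [RHS]exprMn q3 -natrX.
  apply: rpredX; apply: rpredD (rpredM Az A2); apply: rpredD A0 _.
  by apply: rpredM A1; apply: rpredX.
have /intrP[Z DZ] : 3 * z \in Num.int.
  apply/cubefreeB/rat_int.
  have -> : g ((3 * z) ^+ 3 * (A ^+ 2 * B)) = (u0 + zeta * u1 + zeta ^+ 2 * u2)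
    ^+ 3.
    have -> : u0 + zeta * u1 + zeta ^+ 2 * u2 = 3 * r.
      transitivity (g x * (zeta ^+ 2 + zeta + 1) + q * (1 + zeta ^+ 2 + zeta ^+ 4)
         + r * (1 + zeta ^+ 3 + zeta ^+ 3 * zeta ^+ 3)).
        by rewrite /u0 /u1 /u2 /q /r; ring.
      by rewrite z4 z3 zE; ring.
    have -> : (3 * z) ^+ 3 * (A ^+ 2 * B) = 27 * (A ^+ 2 * B * z ^+ 3) by ring.
    by rewrite rmorphM rmorph_nat [RHS]exprMn r3 -natrX.
  apply: rpredX; apply: rpredD (rpredD A0 (rpredM Az A1)) _.
  by apply: rpredM A2; apply: rpredX.
have x3 : x = X%:~R / 3 by rewrite -DX; field.
have y3 : y = Y%:~R / 3 by rewrite -DY; field.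
have zz3 : z = Z%:~R / 3 by rewrite -DZ; field.
exists X, Y, Z; split=> //; split.
  have /intrP[k Dk] : 3 * (x ^+ 2 - A * B * y * z) \in Num.int.
    apply: rat_int.
    have -> : g (3 * (x ^+ 2 - A * B * y * z)) = u0 * u1 + u0 * u2 + u1 * u2;
      last first.
      exact: rpredD (rpredD (rpredM A0 A1) (rpredM A0 A2)) (rpredM A1 A2).
    transitivity (u0 * (u1 + u2) + u1 * u2); last by ring.
    rewrite u12 u1u2 u0E rmorphM rmorphB -qr rmorphXn rmorph_nat; ring.
  apply/dvdzP; exists k; apply: (intr_inj (R := rat)).
  by rewrite intrM -Dk x3 y3 zz3 !(rmorphB, rmorphM, rmorphXn) /=; field.
have /intrP[k Dk] : x ^+ 3 + A * B ^+ 2 * y ^+ 3 + A ^+ 2 * B * z ^+ 3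
    - 3 * A * B * x * y * z \in Num.int.
  apply: rat_int.
  have -> : g (x ^+ 3 + A * B ^+ 2 * y ^+ 3 + A ^+ 2 * B * z ^+ 3
    - 3 * A * B * x * y * z) = u0 * u1 * u2; last first.
    exact: rpredM (rpredM A0 A1) A2.
  transitivity (g x ^+ 3 + q ^+ 3 + r ^+ 3 - 3 * g x * (q * r)); last first.
    by rewrite -[RHS]mulrA u1u2 u0E; ring.
  rewrite q3 r3 qr -[3 * g x * _]mulrA -rmorphXn -rmorphM -(rmorph_nat g 3).
  by rewrite -rmorphM -!rmorphD -rmorphB; congr (g _); ring.
apply/dvdzP; exists k; apply: (intr_inj (R := rat)).
by rewrite intrM -Dk x3 y3 zz3 !(rmorphD, rmorphB, rmorphM, rmorphXn) /=; field.
Qed.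

End PureCubicIntegers.

Lemma sum_tnth3 (V : zmodType) (w1 w2 w3 : V) (c : 'I_3 -> int) :
  \sum_i tnth [tuple w1; w2; w3] i *~ c i = w1 *~ c 0 + w2 *~ c 1 + w3 *~ c 2.
Proof.
have E1 : lift ord0 ord0 = 1 :> 'I_3 by apply: val_inj.
have E2 : lift ord0 (lift ord0 ord0) = 2 :> 'I_3 by apply: val_inj.
have E0 : ord0 = 0 :> 'I_3 by apply: val_inj.
by rewrite !big_ord_recl big_ord0 addr0 addrA E2 E1 E0 !(tnth_nth 0).
Qed.

Lemma integral_sum3 (L : fieldExtType rat) (w1 w2 w3 : L) (c : 'I_3 -> int) :
  integralOver (intr : int -> L) w1 -> integralOver (intr : int -> L) w2 ->
  integralOver (intr : int -> L) w3 ->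
  integralOver (intr : int -> L) (\sum_i tnth [tuple w1; w2; w3] i *~ c i).
Proof.
move=> i1 i2 i3; rewrite sum_tnth3 -(mulrzr w1) -(mulrzr w2) -(mulrzr w3).
have ic (k : int) : integralOver (intr : int ->
  L) k%:~R by exact: (integral_id (intr : {rmorphism int -> L})).
by apply: integral_add; [apply: integral_add|]; apply: integral_mul.
Qed.

Lemma integral_cube_root (L : fieldExtType rat) (u : L) (k : int) :
  u ^+ 3 = k%:~R -> integralOver (intr : int -> L) u.
Proof.
move=> h; exists ('X^3 - k%:P); first by rewrite monicXnsubC.
by rewrite rmorphB /= map_polyXn map_polyC rootE !hornerE h subrr.
Qed.

Section PureCubicBases.
Variables (L : fieldExtType rat) (a b : int) (al be : L).
Local Notation iota := (rat_emb L).
Local Notation A := (a%:~R : rat).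
Local Notation B := (b%:~R : rat).
Hypothesis b0 : b != 0.
Hypothesis noncube : forall t : rat, t ^+ 3 != A * B ^+ 2.
Hypothesis cubefreeA : forall t : rat,
  t ^+ 3 * (A * B ^+ 2) \in Num.int -> t \in Num.int.
Hypothesis cubefreeB : forall t : rat,
  t ^+ 3 * (A ^+ 2 * B) \in Num.int -> t \in Num.int.
Hypotheses (al2 : al ^+ 2 = iota B * be) (be2 : be ^+ 2 = iota A * al).
Hypothesis albe : al * be = iota (A * B).
Hypothesis dimL : \dim {:L} = 3%N.

Let iota_int (k : int) : iota k%:~R = k%:~R. Proof. exact: rmorph_int. Qed.

Let bas : basis_of fullv [tuple 1; al;
  be] := pure_cubic_basis noncube al2 albe dimL.

Lemma trace_pure_cubic (x y z : rat) :
  field_trace (iota x + iota y * al + iota z * be) = 3 * x.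
Proof.
pose c (i j : 'I_3) : rat := nth 0 (nth [::] [:: [:: x; y; z];
  [:: A * B * z; x; B * y]; [:: A * B * y; A * z; x]] i) j.
rewrite (@field_trace3 _ _ _ _ _ c bas); first by rewrite /c /=; ring.
- by rewrite mulr1 /c /= -!rat_embM !mulr1.
- rewrite /c /= -!rat_embM mulr1 !rmorphM /=.
  transitivity (iota x * al + iota y * al ^+ 2 + iota z * (al * be)); first by ring.
  by rewrite al2 albe rmorphM; ring.
- rewrite /c /= -!rat_embM mulr1 !rmorphM /=.
  transitivity (iota x * be + iota z * be ^+ 2 + iota y * (al * be)); first by ring.
  by rewrite be2 albe rmorphM; ring.
Qed.

Lemma pure_cubic_disc : tuple_disc [tuple 1; al; be] = -27 * (A * B) ^+ 2.
Proof.
have tr u x y z : u = iota x + iota y * al + iota z * be -> field_trace u = 3 * x.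
  by move=> ->; apply: trace_pure_cubic.
rewrite /tuple_disc det_mx33 !mxE !(tnth_nth 0) /=.
rewrite !mul1r !mulr1 [be * al]mulrC.
rewrite (tr 1 1 0 0); last by rewrite rmorph1 rmorph0; ring.
rewrite (tr al 0 1 0); last by rewrite rmorph1 rmorph0; ring.
rewrite (tr be 0 0 1); last by rewrite rmorph1 rmorph0; ring.
rewrite (tr (al * al) 0 0 B); last by rewrite -expr2 al2 rmorph0; ring.
rewrite (tr (be * be) 0 A 0); last by rewrite -expr2 be2 rmorph0; ring.
rewrite (tr (al * be) (A * B) 0 0); last by rewrite albe rmorph0; ring.
by ring.
Qed.

Lemma pure_cubic_charpoly (x y z : rat) :
  let u := iota x + iota y * al + iota z * be in
  u ^+ 3 = iota (3 * x) * u ^+ 2 - iota (3 * (x ^+ 2 - A * B * y * z)) * u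
    + iota (x ^+ 3 + A * B ^+ 2 * y ^+ 3 + A ^+ 2 * B * z ^+ 3 - 3 * A * B * x
      * y * z).
Proof.
move=> u; have uu : u ^+ 2 = iota (x * x + A * B * (y * z + z * y)) +
    iota (x * y + y * x + A * z * z) * al + iota (x * z + z * x + B * y * y) * be.
  by rewrite expr2 (pure_cubicM al2 be2 albe).
by rewrite exprS uu (pure_cubicM al2 be2 albe) /u; ring.
Qed.

Let integral_al : integralOver (intr : int -> L) al.
Proof.
apply: (@integral_cube_root _ _ (a * b ^+ 2)); rewrite -iota_int.
by rewrite exprS al2 mulrCA albe -rmorphM; congr (iota _);
  rewrite intrM rmorphXn /=; ring.
Qed.

Let integral_be : integralOver (intr : int -> L) be.
Proof.
apply: (@integral_cube_root _ _ (a ^+ 2 * b)); rewrite -iota_int.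
by rewrite exprS be2 mulrCA [be * al]mulrC albe -rmorphM; congr (iota _);
  rewrite intrM rmorphXn /=; ring.
Qed.

Let integral1 : integralOver (intr : int -> L) 1.
Proof. exact: (integral1 (intr : {rmorphism int -> L})). Qed.

(** Without a sign congruent to a b^2 modulo 9, [norm_sign] leaves only triples with 3 | x, and
    [norm_divisible] then makes all three thirds integers. *)
Lemma integral_basis_pure :
  ~~ (9 %| a)%Z -> ~~ (9 %| b)%Z -> ~ ((3 %| a)%Z /\ (3 %| b)%Z) ->
  (forall e : int, e ^+ 2 = 1 -> ~~ (9 %| a * b ^+ 2 - e)%Z) ->
  integral_basis [tuple 1; al; be].
Proof.
move=> a9 b9 ab3 n9; split=> // u; split; last first.
  by case=> c ->; apply: integral_sum3.
have [x [y [z ->]]] := pure_cubicE noncube al2 albe dimL u.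
move/(integral_coords b0 noncube cubefreeA cubefreeB al2 be2 albe dimL).
case=> X [Y [Z [-> -> -> [tr nm]]]].
have X3 : (3 %| X)%Z.
  apply/negPn/negP => X3; have [e e1 [e9 _]] := norm_sign tr nm X3.
  by case/negP: (n9 e e1).
have [Y3 Z3] := norm_divisible tr nm a9 b9 ab3 X3.
case/dvdzP: X3 => X' ->; case/dvdzP: Y3 => Y' ->; case/dvdzP: Z3 => Z' ->.
exists (fun i : 'I_3 => nth 0 [:: X'; Y'; Z'] i); rewrite sum_tnth3 /=.
have simp (k : int) : (k * 3)%:~R / 3 = k%:~R :> rat by rewrite intrM; field.
by rewrite !simp !iota_int -(mulrzr (1 : L)) -(mulrzr al) -(mulrzr be); ring.
Qed.

Section Unramified.
Variables e f : int.
Hypotheses (e1 : e ^+ 2 = 1) (f1 : f ^+ 2 = 1).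
Hypotheses (ab9 : (9 %| a * b ^+ 2 - e)%Z) (ab3 : (3 %| a * b * e * f - 1)%Z).
Let ga := iota (1 / 3) + iota (e%:~R / 3) * al + iota (f%:~R / 3) * be.

Let integral_ga : integralOver (intr : int -> L) ga.
Proof.
case/dvdzP: ab3 => k Dk; case/dvdzP: (norm_generator e1 f1 ab9 ab3) => l Dl.
(* The characteristic polynomial X^3 - X^2 - k X - l of [ga]: its trace is 1, its second symmetric
   function is (1 - a b e f) / 3 = -k and its norm is l. *)
exists (Poly [:: - l; - k; -1; 1]).
  by rewrite monicE lead_coefE (PolyK (c := 0)).
rewrite map_Poly rootE horner_Poly /= mul0r add0r.
have kE : 3 * ((1 / 3) ^+ 2 - A * B * (e%:~R / 3) * (f%:~R / 3)) = - k%:~R :> rat.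
  have h : (a * b * e * f - 1)%:~R = (k * 3)%:~R :> rat by rewrite Dk.
  transitivity (- (a * b * e * f - 1)%:~R / 3 : rat); first by field.
  by rewrite h; field.
have lE : (1 / 3) ^+ 3 + A * B ^+ 2 * (e%:~R / 3) ^+ 3 + A ^+ 2 * B * (f%:~R /
  3) ^+ 3
    - 3 * A * B * (1 / 3) * (e%:~R / 3) * (f%:~R / 3) = l%:~R :> rat.
  have h : (1 + a * b ^+ 2 * (e ^+ 2 * e) + a ^+ 2 * b * (f ^+ 2 * f)
      - 3 * a * b * e * f)%:~R = (l * 27)%:~R :> rat.
    by rewrite e1 f1 !mul1r Dl.
  transitivity ((1 + a * b ^+ 2 * (e ^+ 2 * e) + a ^+ 2 * b * (f ^+ 2 * f)
      - 3 * a * b * e * f)%:~R / 27 : rat); first by field.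
  by rewrite h; field.
have := pure_cubic_charpoly (1 / 3) (e%:~R / 3) (f%:~R / 3).
have e3 : 3 * (1 / 3) = 1 :> rat by field.
rewrite -/ga kE lE e3 rmorphN !iota_int rmorph1 => h.
apply/eqP; rewrite !rmorphN rmorph1 mul1r.
transitivity (ga ^+ 3 - (ga ^+ 2 + k%:~R * ga + l%:~R)); first by ring.
by rewrite h; ring.
Qed.

Lemma coord_det_unramified : \det (coord_mx [tuple 1; al; be] [tuple 1; al;
  ga]) = f%:~R / 3.
Proof.
have fw := basis_free bas.
have cE u x y z (j : 'I_3) : u = iota x + iota y * al + iota z * be ->
    coord [tuple 1; al; be] j u = nth 0 [:: x; y; z] j.
  by move=> ->; rewrite !rat_embM -[iota x]mulr1 rat_embM coord3.
have c1 j : coord [tuple 1; al; be] j 1 = nth 0 [:: 1; 0; 0] j.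
  by apply: cE; rewrite rmorph1 rmorph0; ring.
have c2 j : coord [tuple 1; al; be] j al = nth 0 [:: 0; 1; 0] j.
  by apply: cE; rewrite rmorph1 rmorph0; ring.
rewrite det_mx33 !mxE !(tnth_nth 0) /= !c1 !c2 !(cE ga _ _ _ _ erefl) /=.
by ring.
Qed.

Lemma integral_basis_unramified : integral_basis [tuple 1; al; ga].
Proof.
have f0 : f%:~R != 0 :> rat.
  rewrite intr_eq0; apply/eqP => f0; move: f1; rewrite f0.
  by rewrite expr0n.
split; first by apply: free_coord_mx bas _; rewrite coord_det_unramified mulf_neq0.
move=> u; split; last by case=> c ->; apply: integral_sum3.
have [x [y [z ->]]] := pure_cubicE noncube al2 albe dimL u.
move/(integral_coords b0 noncube cubefreeA cubefreeB al2 be2 albe dimL).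
case=> X [Y [Z [-> -> -> [tr nm]]]].
have [Y3 Z3] := norm_lattice tr nm e1 f1 ab9 ab3.
case/dvdzP: Y3 => Y' DY; case/dvdzP: Z3 => Z' DZ.
(* Comparing the coefficients of be forces the multiple f Z of [ga], since 1 / f = f; the other two
   entries are what then remains of X / 3 and Y / 3. *)
exists (fun i : 'I_3 => nth 0 [:: - f * Z'; Y' - e * f * Z'; f * Z] i).
rewrite sum_tnth3 /= -(mulrzr (1 : L)) -(mulrzr al) -(mulrzr ga) -!iota_int /ga.
have EX : X = 3 * (- f * Z') + f * Z.
  transitivity (f ^+ 2 * X + f * (Z - f * X - Z' * 3)); last by ring.
  by rewrite DZ f1; ring.
have EY : Y = 3 * (Y' - e * f * Z') + e * (f * Z).
  transitivity (e * f ^+ 2 * X + 3 * Y' + (Y - e * X - Y' * 3)).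
    by rewrite f1; ring.
  transitivity (e * f ^+ 2 * X + 3 * Y'); first by rewrite DY; ring.
  transitivity (3 * Y' + e * f * (Z - (Z - f * X - Z' * 3) - Z' * 3));
    first by ring.
  by rewrite DZ; ring.
have EZ : Z = f * (f * Z) by rewrite mulrA -expr2 f1 mul1r.
have x3 : X%:~R / 3 = (- f * Z')%:~R + 1 / 3 * (f * Z)%:~R :> rat.
  by rewrite {1}EX; field.
have y3 : Y%:~R / 3 = (Y' - e * f * Z')%:~R + e%:~R / 3 * (f * Z)%:~R :> rat.
  by rewrite {1}EY; field.
have z3 : Z%:~R / 3 = f%:~R / 3 * (f * Z)%:~R :> rat by rewrite {1}EZ; field.
rewrite x3 y3 z3; move: (1 / 3) (e%:~R / 3) (f%:~R / 3) => t t' t''.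
by rewrite !(rmorphD iota) !(rmorphM iota); ring.
Qed.

(** Passing to [ga] has determinant f / 3, whose square 1/9 turns -27 into -3. *)
Lemma unramified_disc : tuple_disc [tuple 1; al; ga] = -3 * (A * B) ^+ 2.
Proof.
rewrite (tuple_disc_change _ bas) coord_det_unramified pure_cubic_disc.
have h : (f ^+ 2)%:~R = 1 :> rat by rewrite f1.
transitivity (- 3 * (f ^+ 2)%:~R * (A * B) ^+ 2); first by field.
by rewrite h mulr1.
Qed.


End Unramified.

End PureCubicBases.

(** * Quasi-monogenic generators *)

Section CubicFields.
Variable L : fieldExtType rat.
Local Notation iota := (rat_emb L).

Lemma depressed_cubic_disc (ga : L) (p q : rat) :
  basis_of fullv [tuple 1; ga; ga ^+ 2] ->
  ga ^+ 3 = - iota p * ga - iota q ->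
  tuple_disc [tuple 1; ga; ga ^+ 2] = - 4 * p ^+ 3 - 27 * q ^+ 2.
Proof.
move=> bg g3.
have tr u x y z : u = iota x + iota y * ga + iota z * ga ^+ 2 ->
    field_trace u = 3 * x - 2 * p * z.
  move=> uE.
  pose c (i j : 'I_3) : rat := nth 0 (nth [::] [:: [:: x; y; z];
    [:: - q * z; x - p * z; y]; [:: - q * y; - p * y - q * z; x - p * z]] i) j.
  have gu : u * ga = iota (- q * z) + iota (x - p * z) * ga + iota y * ga ^+ 2.
    transitivity (iota x * ga + iota y * ga ^+ 2 + iota z * ga ^+ 3).
      by rewrite uE; ring.
    by rewrite g3 !(rmorphB iota, rmorphN iota, rmorphM iota); ring.
  have ggu : u * ga ^+ 2 = iota (- q * y) + iota (- p * y - q * z) * ga +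
      iota (x - p * z) * ga ^+ 2.
    transitivity (iota (- q * z) * ga + iota (x - p * z) * ga ^+ 2 + iota y *
      ga ^+ 3).
      by rewrite [ga ^+ 2 in LHS]expr2 mulrA gu; ring.
    by rewrite g3 !(rmorphB iota, rmorphN iota, rmorphM iota); ring.
  rewrite (@field_trace3 _ _ _ _ _ c bg); first by rewrite /c /=; ring.
  - by rewrite mulr1 /c /= -!rat_embM mulr1.
  - by rewrite /c /= -!rat_embM mulr1.
  - by rewrite /c /= -!rat_embM mulr1.
rewrite /tuple_disc det_mx33 !mxE !(tnth_nth 0) /= !mul1r !mulr1.
have g4 : ga * ga ^+ 2 = - iota p * ga - iota q by rewrite -exprS.
have g5 : ga ^+ 2 * ga ^+ 2 = - iota p * ga ^+ 2 - iota q * ga.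
  by rewrite {1}expr2 -mulrA g4; ring.
rewrite [ga ^+ 2 * ga]mulrC -[ga * ga]expr2 g4 g5.
have -> : field_trace (1 : L) = 3.
  by rewrite (tr 1 1 0 0) ?rmorph1 ?rmorph0; ring.
have -> : field_trace ga = 0.
  by rewrite (tr ga 0 1 0) ?rmorph1 ?rmorph0; ring.
have -> : field_trace (ga ^+ 2) = - 2 * p.
  by rewrite (tr _ 0 0 1) ?rmorph1 ?rmorph0; ring.
have -> : field_trace (- iota p * ga - iota q) = - 3 * q.
  by rewrite (tr _ (- q) (- p) 0) ?rmorphN ?rmorph0; ring.
have -> : field_trace (- iota p * ga ^+ 2 - iota q * ga) = 2 * p ^+ 2.
  by rewrite (tr _ 0 (- q) (- p)) ?rmorphN ?rmorph0; ring.
by ring.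
Qed.

(* A rational solution of I = +-1 is a ga for which 1, ga, ga^2 has the same
   discriminant as an integral basis; I ignores the rational part of ga, which can
   therefore be chosen to have trace 0. *)
Lemma quasi_monogenic_generator (d : rat) :
  qm_cubic_field d L -> exists ga p q,
  [/\ basis_of fullv [tuple 1; ga; ga ^+ 2],
      ga ^+ 3 = - iota p * ga - iota q & d = - 4 * p ^+ 3 - 27 * q ^+ 2].
Proof.
case=> dimL hd [w2 [w3 [I [iw hI [x [y Ixy]]]]]].
have [bw _] := iw; have dE := proj1 (has_discriminantP d iw) hd.
have Ixy2 : I x y ^+ 2 = 1 by case: Ixy => ->; rewrite ?sqrrN expr1n.
have det1 x1 ga : ga = x1 *: 1 + x *: w2 + y *: w3 ->
    \det (coord_mx [tuple 1; w2; w3] [tuple 1; ga; ga ^+ 2]) = I x y.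
  move=> gE; rewrite -(hI x1) -gE; congr (\det _); apply/matrixP => i j.
  rewrite !mxE (tnth_nth 0); congr (coord _ _ _).
  by case: i => [[|[|[|//]]] ?] /=.
have bas x1 ga : ga = x1 *: 1 + x *: w2 + y *: w3 ->
    basis_of fullv [tuple 1; ga; ga ^+ 2].
  move=> gE; apply: (free_coord_mx bw); rewrite (det1 _ _ gE) -sqrf_eq0 Ixy2.
  by rewrite oner_eq0.
pose g0 := 0 *: 1 + x *: w2 + y *: w3.
have := basis3_expand (bas 0 g0 erefl) (g0 ^+ 3).
set c0 := coord _ _ _; set c1 := coord _ _ _; set c2 := coord _ _ _ => g03.
rewrite -!rat_embM mulr1 in g03.
pose t := c2 / 3; pose ga := g0 - iota t.
have gE : ga = (- t) *: 1 + x *: w2 + y *: w3.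
  by rewrite /ga /g0 scale0r add0r -!rat_embM mulr1 rmorphN; ring.
exists ga, (- (c1 + 3 * t ^+ 2)), (- (c0 - t ^+ 3 + (c1 + 3 * t ^+ 2) * t)).
have g3 : ga ^+ 3 = - iota (- (c1 + 3 * t ^+ 2)) * ga -
    iota (- (c0 - t ^+ 3 + (c1 + 3 * t ^+ 2) * t)).
  have c2E : c2 = 3 * t by rewrite /t; field.
  have g0E : g0 = ga + iota t by rewrite /ga subrK.
  transitivity ((ga + iota t) ^+ 3 - 3 * iota t * (ga + iota t) ^+ 2
     + 3 * iota t ^+ 2 * ga + 2 * iota t ^+ 3); first by ring.
  by rewrite -g0E g03 c2E g0E; ring.
split=> //; first exact: bas gE.
rewrite -(depressed_cubic_disc (bas _ _ gE) g3).
by rewrite (tuple_disc_change _ bw) (det1 _ _ gE) Ixy2 mul1r.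
Qed.

(** If ga = u + v with u v = -p, then ga^2 + 2p = u^2 + v^2, and -p (u^2 + v^2) = B u + A v.
    Subtracting A ga leaves (B - A) u. So u and v are rational expressions in ga and lie in L
    itself; this uses A != B. *)
Lemma cardano (ga : L) (p A B : rat) : A != B ->
  ga ^+ 3 = - 3 * iota p * ga + iota (A + B) -> p ^+ 3 = - A * B ->
  exists u v, [/\ ga = u + v, u ^+ 3 = iota A & v ^+ 3 = iota B].
Proof.
move=> AB g3 p3.
have cE (C E : rat) : C != E -> C + E = A + B -> C * E = A * B ->
    ((- iota p * (ga ^+ 2 + 2 * iota p) - iota C * ga) / iota (E - C)) ^+ 3 =
      iota C.
  move=> CE s pr; have EC : iota (E - C) != 0 by rewrite fmorph_eq0 subr_eq0 eq_sym.
  rewrite expr_div_n; apply: (mulIf (expf_neq0 3 EC)); rewrite divfK ?expf_neq0 //.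
  have h1 : ga ^+ 3 = - 3 * iota p * ga + iota C + iota E by rewrite g3 -s; ring.
  have h2 : iota p ^+ 3 = - iota C * iota E.
    by rewrite -rmorphXn p3 mulNr -pr; ring.
  rewrite rmorphB; move: (iota p) (iota C) (iota E) h1 h2 => P c e h1 h2.
  have h4 : ga ^+ 4 = - 3 * P * ga ^+ 2 + (c + e) * ga by rewrite exprS h1; ring.
  have w2 : (- P * (ga ^+ 2 + 2 * P) - c * ga) ^+ 2 =
      (c - e) * (c * ga ^+ 2 - P ^+ 2 * ga + 2 * c * P).
    transitivity (P ^+ 2 * ga ^+ 4 + 2 * c * P * ga ^+ 3 + (c ^+ 2 + 4 * P ^+
      3) * ga ^+ 2
      + 4 * c * P ^+ 2 * ga + 4 * P * P ^+ 3); first by ring.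
    rewrite h4 h1; transitivity ((c ^+ 2 + P ^+ 3) * ga ^+ 2
      + (e - c) * P ^+ 2 * ga + 2 * c * P * (c + e) + 4 * P * P ^+ 3);
        first by ring.
    by rewrite h2; ring.
  rewrite exprS w2.
  transitivity (- (c - e) * (c * P * ga ^+ 4 + (c ^+ 2 - P ^+ 3) * ga ^+ 3
    + 3 * c * P ^+ 2 * ga ^+ 2 + (2 * c ^+ 2 * P - 2 * P * P ^+ 3) * ga
    + 4 * c * P ^+ 3)); first by ring.
  by rewrite h4 h1 h2; ring.
pose u := (- iota p * (ga ^+ 2 + 2 * iota p) - iota A * ga) / iota (B - A).
pose v := (- iota p * (ga ^+ 2 + 2 * iota p) - iota B * ga) / iota (A - B).
exists u, v; split; [|exact: cE|].
  have BA : iota B - iota A != 0.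
    by rewrite -rmorphB fmorph_eq0 subr_eq0 eq_sym.
  rewrite /u /v -[A - B]opprB !rmorphN !rmorphB.
  by field; rewrite oppr_eq0 BA.
by apply: cE; [rewrite eq_sym | rewrite addrC | rewrite mulrC].
Qed.

(** A second cube root of a rational cube would put sqrt(-3) into L, but 2 does not divide 3. *)
Lemma cube_root_unique (u : L) (c : rat) : \dim {:L} = 3%N ->
  u ^+ 3 = iota (c ^+ 3) -> u = iota c.
Proof.
move=> dimL u3; apply/eqP; rewrite -subr_eq0; apply/negPn/negP => uc.
have q0 : u ^+ 2 + iota c * u + iota c ^+ 2 = 0.
  apply: (mulfI uc); rewrite mulr0 -[RHS](subrr (u ^+ 3)) {2}u3 rmorphXn; ring.
have c0 : iota c != 0.
  apply: contraNneq uc => c0; move: u3; rewrite rmorphXn c0 expr0n => /eqP.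
  by rewrite expf_eq0 /= subr0.
(* For u / c a primitive cube root of unity, this is 2 (u / c) + 1, a square root of -3. *)
pose e := (2 * u + iota c) / iota c.
have e2 : e ^+ 2 = iota (- 3).
  have -> : e ^+ 2 = (4 * (u ^+ 2 + iota c * u + iota c ^+ 2) - 3 * iota c ^+
    2) / iota c ^+ 2.
    by rewrite /e; field.
  by rewrite q0 mulr0 sub0r rmorphN rmorph_nat; field.
have eQ : e \notin 1%VS.
  apply/negP => /vlineP[r]; rewrite rat_emb1 => er.
  have /(fmorph_inj iota) r2 : iota (r ^+ 2) = iota (- 3) by rewrite rmorphXn -er.
  by have := sqr_ge0 r; rewrite r2 oppr_ge0 lern0.
have dv : (\dim <<1; e>> %| \dim {:L})%N.
  by apply: (@field_dimS _ _ <<1; e>>%AS {:L}%AS); apply: subvf.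
have le2 : (adjoin_degree 1 e <= 2)%N.
  rewrite -ltnS -size_minPoly.
  have pE : 'X^2 - (iota (- 3))%:P \is a polyOver 1%VS.
    by rewrite rpredB ?rpredX ?polyOverX // polyOverC -rat_emb1 rpredZ ?mem1v.
  have r0 : root ('X^2 - (iota (- 3))%:P) e by rewrite rootE !hornerE e2 subrr.
  rewrite -(size_XnsubC (iota (- 3)) (isT : 0 < 2)%N).
  apply: dvdp_leq; first by rewrite -size_poly_eq0 size_XnsubC.
  exact: minPoly_dvdp pE r0.
move: dv; rewrite dim_Fadjoin dimv1 muln1 dimL.
case: (adjoin_degree 1 e) (adjoin_deg_eq1 1 e) le2 => [|[|[|]]] //.
by rewrite (negPf eQ).
Qed.

End CubicFields.

(** * Fields attached to coefficient vectors *)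

Lemma coord_mxM (L : fieldExtType rat) (n : nat) (w0 w v : n.-tuple L) :
  basis_of fullv w -> coord_mx w0 v = coord_mx w v *m coord_mx w0 w.
Proof.
move=> bw; apply/matrixP => i j; rewrite !mxE {1}(coord_mxE v i bw) linear_sum.
by apply: eq_bigr => k _; rewrite linearZ /= [X in _ = _ * X]mxE.
Qed.

(* In the coordinates (x, y, z) on 1, al, be the index form is b y^3 - a z^3 up to
   a constant factor. *)
Lemma pure_cubic_quasi_monogenic (L : fieldExtType rat) (a b e f : int) (al be : L)
    (ga := rat_emb L (1 / 3) + rat_emb L (e%:~R / 3) * al + rat_emb L (f%:~R /
      3) * be)
    (y z : rat) :
  al ^+ 2 = rat_emb L b%:~R * be -> be ^+ 2 = rat_emb L a%:~R * al ->
  al * be = rat_emb L (a%:~R * b%:~R) ->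
  basis_of fullv [tuple 1; al; be] -> integral_basis [tuple 1; al; ga] ->
  f ^+ 2 = 1 -> \det (coord_mx [tuple 1; al; be] [tuple 1; al; ga]) = f%:~R / 3 ->
  b%:~R * y ^+ 3 - a%:~R * z ^+ 3 = 1 / 3 -> quasi_monogenic L.
Proof.
move=> al2 be2 albe bas iw f1 detw yz; have [bw _] := iw.
have F1 : f%:~R ^+ 2 = 1 :> rat by rewrite -rmorphXn /= f1.
have F0 : f%:~R != 0 :> rat by rewrite -sqrf_eq0 F1 oner_eq0.
pose Y x2 x3 : rat := x2 + e%:~R / 3 * x3.
pose Z x3 : rat := f%:~R / 3 * x3.
pose I (x2 x3 : rat) : rat := 3 * f%:~R * (b%:~R * Y x2 x3 ^+ 3 - a%:~R * Z x3
  ^+ 3).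
exists al, ga, I; split => // [x1 x2 x3 u|]; last first.
  (* These arguments solve Y = y and Z = z, by f^2 = 1; the index form then has the value 3 f / 3 =
     f, a sign. *)
  exists (y - e%:~R * f%:~R * z), (3 * f%:~R * z).
  have -> : I (y - e%:~R * f%:~R * z) (3 * f%:~R * z) = f%:~R.
    have YE : Y (y - e%:~R * f%:~R * z) (3 * f%:~R * z) = y by rewrite /Y; field.
    have ZE : Z (3 * f%:~R * z) = z.
      transitivity (f%:~R ^+ 2 * z : rat); first by rewrite /Z; field.
      by rewrite F1 mul1r.
    by rewrite /I YE ZE yz; field.
  move/eqP: f1; rewrite sqrf_eq1 => /orP[] /eqP ->; first by left.
  by right; rewrite rmorphN.
set W := \matrix_(i, j) _.
have WE : W = coord_mx [tuple 1; al; ga] [tuple 1; u; u ^+ 2].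
  apply/matrixP => i j; rewrite !mxE (tnth_nth 0); congr (coord _ _ _).
  by case: i => [[|[|[|//]]] ?].
(* The determinant is computed in the basis 1, al, be, where multiplication is simple, and
   transferred with the factor f / 3. *)
have := congr1 determinant (coord_mxM [tuple 1; al; be] [tuple 1; u; u ^+ 2] bw).
rewrite det_mulmx detw -WE => detE.
have -> : \det W = 3 * f%:~R * \det (coord_mx [tuple 1; al; be] [tuple 1; u;
  u ^+ 2]).
  rewrite detE; transitivity (f%:~R ^+ 2 * \det W); first by rewrite F1 mul1r.
  by field.
congr (_ * _).
have cE v t t' t'' (j : 'I_3) :
    v = rat_emb L t + rat_emb L t' * al + rat_emb L t'' * be ->
    coord [tuple 1; al; be] j v = nth 0 [:: t; t'; t''] j.
  by move=> ->; rewrite !rat_embM -[rat_emb L t]mulr1 rat_embM coord3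
    ?(basis_free bas).
pose X : rat := x1 + x3 / 3.
have uE : u = rat_emb L X + rat_emb L (Y x2 x3) * al + rat_emb L (Z x3) * be.
  rewrite /u -!rat_embM mulr1 /ga /X /Y /Z.
  rewrite -[x3 / 3]mul1r; move: (e%:~R / 3) (f%:~R / 3) => t t'.
  have -> : 1 * (x3 / 3) = x3 * (1 / 3) by field.
  by move: (1 / 3) => t'';
    rewrite !(rmorphD (rat_emb L)) !(rmorphM (rat_emb L)); ring.
have c1 j : coord [tuple 1; al; be] j 1 = nth 0 [:: 1; 0; 0] j.
  by apply: cE; rewrite rmorph1 rmorph0; ring.
have cu j : coord [tuple 1; al; be] j u = nth 0 [:: X; Y x2 x3; Z x3] j.
  exact: cE.
have := pure_cubicM al2 be2 albe X (Y x2 x3) (Z x3) X (Y x2 x3) (Z x3).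
rewrite -uE -expr2 => u2E.
rewrite det_mx33 !mxE !(tnth_nth 0) /= !c1 !cu !(cE _ _ _ _ _ u2E) /=.
by ring.
Qed.

(** * The decomposition m = a b^2 and the resulting discriminants *)

Section RadicandFactors.
Variables (n : nat) (p : n.-tuple nat).
Hypotheses (p_uniq : uniq p) (p_prime : forall i, prime (tnth p i)).

Lemma powerfree_prod (k : nat) (c : 'I_n -> nat) (q : nat) :
  (0 < k)%N -> (forall i, c i < k)%N -> prime q ->
  ~~ (q ^ k %| \prod_i tnth p i ^ c i)%N.
Proof.
move=> k0 ck pq; rewrite pfactor_dvdn //; last first.
  by apply: prodn_gt0 => i; rewrite expn_gt0 prime_gt0 ?p_prime.
rewrite -ltnNge; case: (pickP (fun j => tnth p j == q)) => [j /eqP <-|npq].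
  by rewrite (logn_prod_tnth p_uniq p_prime).
rewrite logn_coprime //; elim/big_rec: _ => [|i x _ cx]; first by rewrite coprimen1.
rewrite coprimeMr cx andbT coprimeXr // prime_coprime // dvdn_prime2 ?p_prime //.
by rewrite eq_sym npq.
Qed.

Variable lam : 'rV['F_3]_n.

(** With [radicand2], the a and b of m = a b^2; for distinct primes p they are squarefree and
    coprime, hence a b^2 and a^2 b are cube-free. *)
Definition radicand1 : nat := (\prod_i tnth p i ^ (lam 0%R i == 1%R))%N.
Definition radicand2 : nat := (\prod_i tnth p i ^ (lam 0%R i == 2%R))%N.

Lemma F3_cases (x : 'F_3) : [\/ x = 0, x = 1 | x = 2].
Proof.
by case: x => [[|[|[|//]]]] h; [apply: Or31|apply: Or32|apply: Or33];
  apply: val_inj.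
Qed.

Lemma kummer_radicandE : kummer_radicand p lam = (radicand1 * radicand2 ^ 2)%N.
Proof.
rewrite /radicand2 (big_morph (fun x => x ^ 2)%N (fun x y => expnMn x y 2)
  (exp1n 2)).
rewrite -big_split; apply: eq_bigr => i _ /=; rewrite -expnM -expnD.
by case: (F3_cases (lam 0 i)) => ->.
Qed.

Lemma radicand21E : (radicand1 ^ 2 * radicand2)%N =
  (\prod_i tnth p i ^ (2 * (lam 0%R i == 1%R) + (lam 0%R i == 2%R)))%N.
Proof.
rewrite /radicand1 (big_morph (fun x => x ^ 2)%N (fun x y => expnMn x y 2)
  (exp1n 2)).
by rewrite -big_split; apply: eq_bigr => i _ /=; rewrite -expnM -expnD mulnC.
Qed.

Lemma radicandME : (radicand1 * radicand2)%N =
  (\prod_i tnth p i ^ (lam 0%R i != 0%R))%N.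
Proof.
rewrite -big_split; apply: eq_bigr => i _ /=; rewrite -expnD.
by case: (F3_cases (lam 0 i)) => ->.
Qed.

Lemma radicand1_gt0 : (0 < radicand1)%N.
Proof. by apply: prodn_gt0 => i; rewrite expn_gt0 prime_gt0 ?p_prime. Qed.

Lemma radicand2_gt0 : (0 < radicand2)%N.
Proof. by apply: prodn_gt0 => i; rewrite expn_gt0 prime_gt0 ?p_prime. Qed.

Lemma kummer_radicand_noncube : lam != 0 ->
  forall t : rat, t ^+ 3 != (kummer_radicand p lam)%:R.
Proof.
move=> lam0 t; apply: contra lam0 => /eqP t3.
have t0 : t != 0.
  apply: contra_eq_neq t3 => ->; rewrite expr0n /= eq_sym pnatr_eq0 -lt0n.
  exact: kummer_radicand_gt0.
apply/eqP/(kummer_radicand_inj p_uniq p_prime t0); rewrite -t3.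
have -> : kummer_radicand p (0 : 'rV_n) = 1%N.
  by rewrite /kummer_radicand big1 // => i _; rewrite mxE.
by rewrite mul1r.
Qed.

(** Discriminants come as equivalences so that a prescribed discriminant selects the case. In the
    second case only the equation b y^3 - a z^3 = 1/3 is left to be solved for
    quasi-monogenicity. *)
Lemma kummer_field_cases (L : fieldExtType rat) (a := radicand1%:Z) (b :=
  radicand2%:Z) :
  lam != 0 -> cube_field (kummer_radicand p lam)%:R L ->
  ((forall e : int, e ^+ 2 = 1 -> ~~ (9 %| a * b ^+ 2 - e)%Z) /\
   forall d, has_discriminant L d <-> d = - 27 * (a%:~R * b%:~R) ^+ 2) \/
  [/\ exists2 e : int, e ^+ 2 = 1 & (9 %| a * b ^+ 2 - e)%Z,
   forall d, has_discriminant L d <-> d = - 3 * (a%:~R * b%:~R) ^+ 2 &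
   forall y z : rat, b%:~R * y ^+ 3 - a%:~R * z ^+ 3 = 1 / 3 -> quasi_monogenic L].
Proof.
move=> lam0 [dimL [al al3]].
have a0 : a != 0 by rewrite -lt0n radicand1_gt0.
have b0 : b != 0 by rewrite -lt0n radicand2_gt0.
have B0 : b%:~R != 0 :> rat by rewrite intr_eq0.
have mE : (kummer_radicand p lam)%:R = a%:~R * b%:~R ^+ 2 :> rat.
  by rewrite kummer_radicandE natrM natrX.
have nc t : t ^+ 3 != a%:~R * b%:~R ^+ 2 :> rat.
  by rewrite -mE; apply: kummer_radicand_noncube.
rewrite mE in al3; have [al2 be2 albe] := cube_rootE B0 al3.
set be := _ * al ^+ 2 in al2 be2 albe.
have cfA (t : rat) : t ^+ 3 * (a%:~R * b%:~R ^+ 2) \in Num.int -> t \in Num.int.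
  rewrite -mE /kummer_radicand; apply: rat_int_root => q.
  by apply: powerfree_prod => // i; case: (F3_cases (lam 0 i)) => ->.
have cfB (t : rat) : t ^+ 3 * (a%:~R ^+ 2 * b%:~R) \in Num.int -> t \in Num.int.
  have -> : a%:~R ^+ 2 * b%:~R = (radicand1 ^ 2 * radicand2)%:R :> rat.
    by rewrite natrM natrX.
  rewrite radicand21E; apply: rat_int_root => q.
  by apply: powerfree_prod => // i; case: (F3_cases (lam 0 i)) => ->.
have a9 : ~~ (9 %| a)%Z.
  by rewrite dvdzE; apply: (@powerfree_prod 2 _ 3) => // i; case: eqP.
have b9 : ~~ (9 %| b)%Z.
  by rewrite dvdzE; apply: (@powerfree_prod 2 _ 3) => // i; case: eqP.
have ab3 : ~ ((3 %| a)%Z /\ (3 %| b)%Z).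
  rewrite !dvdzE /a /b /= => -[da db].
  have := @powerfree_prod 2 (fun i => (lam 0%R i != 0%R)) 3.
  rewrite -radicandME (dvdn_mul da db) => /(_ isT) h.
  by have /negP[] : ~~ true by apply: h => // i; case: eqP.
have bas := pure_cubic_basis nc al2 albe dimL.
have [[e e1 e9]|ne] := EM (exists2 e : int,
  e ^+ 2 = 1 & (9 %| a * b ^+ 2 - e)%Z); last first.
  left; split=> [e e1|d]; first by apply/negP => e9; apply: ne; exists e.
  rewrite -(pure_cubic_disc nc al2 be2 albe dimL).
  apply: has_discriminantP.
  apply: (integral_basis_pure b0 nc cfA cfB al2 be2 albe dimL a9 b9 ab3).
  by move=> e e1; apply/negP => e9; apply: ne; exists e.
right.
have ab30 : ~~ (3 %| a * b * e)%Z.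
  apply/negP => /dvdzP[q qE]; case/dvdzP: e9 => k kE.
  have : (3 %| (1 : int))%Z; last by [].
  apply/dvdzP; exists (q * b - 3 * e * k).
  transitivity (a * b * e * b - e * (a * b ^+ 2 - e)).
    by rewrite -e1; ring.
  by rewrite qE kE; ring.
(* The sign f is a b e modulo 3, so that a b e f = f^2 = 1 modulo 3. *)
have [f f1 [q fE]] := sign_mod3 ab30.
have abef : (3 %| a * b * e * f - 1)%Z.
  apply/dvdzP; exists (q * f); rewrite fE.
  transitivity (f ^+ 2 - 1 + q * f * 3); first by ring.
  by rewrite f1 subrr add0r.
have iw := integral_basis_unramified b0 nc cfA cfB al2 be2 albe dimL e1 f1 e9 abef.
split; first by exists e.
  by move=> d; rewrite -(unramified_disc nc al2 be2 albe dimL e f1);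
    exact: has_discriminantP.
move=> y z; apply: (pure_cubic_quasi_monogenic al2 be2 albe bas iw f1).
exact: coord_det_unramified nc al2 albe dimL e f.
Qed.

End RadicandFactors.

Lemma squarefree_prod_primes (m : nat) : (0 < m)%N -> squarefree m ->
  m = (\prod_(q <- primes m) q)%N.
Proof.
move=> m0 sf; rewrite [LHS](prod_prime_decomp m0) prime_decompE big_map /=.
apply: eq_big_seq => q; rewrite mem_primes => /and3P[pq _ dq].
suff -> : logn q m = 1%N by rewrite expn1.
apply/eqP; rewrite eqn_leq -pfactor_dvdn // expn1 dq andbT leqNgt.
by rewrite -pfactor_dvdn // sf.
Qed.

Lemma line_scale (K : fieldType) (V : vectType K) (c : K) (v : V) :
  c != 0 -> (<[c *: v]> = <[v]>)%VS.
Proof.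
move=> c0; apply/eqP; rewrite eqEsubv -!memvE memvZ ?memv_line //=.
by rewrite -{1}(scalerK c0 v) memvZ // memv_line.
Qed.

Lemma on_curve_rat (k x y : rat) :
  y ^+ 2 = 4 * x ^+ 3 + k -> (x, y) != (0, 0) -> on_curve k (Some (x, y)).
Proof.
by move=> h ne; rewrite /on_curve /on_affine /ratr divq_num_den /= h eqxx.
Qed.

(** * Lines of vectors and isomorphism classes of fields *)

Section Fields.
Variables (n : nat) (p : n.-tuple nat).
Hypotheses (p_uniq : uniq p) (p_prime : forall i, prime (tnth p i)).
Implicit Types v w : 'rV['F_3]_n.
Local Notation kr v := (kummer_radicand p v).

Lemma F3_double v : v + v = - v.
Proof.
apply/eqP; rewrite -subr_eq0 opprK; apply/eqP/rowP => i; rewrite !mxE.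
by case: (F3_cases (v 0 i)) => ->; apply: val_inj.
Qed.

(** In characteristic 3 the vector -v is 2 v, whose radicand is m^2 up to a cube; so the square of a
    cube root of m, divided by a natural number, serves. Hence the field depends only on the
    line. *)
Lemma cube_field_opp v (L : fieldExtType rat) :
  cube_field (kr v)%:R L -> cube_field (kr (- v))%:R L.
Proof.
case=> dL [al e]; split=> //.
have [c c0 cE] := kummer_radicandD p_prime v v; rewrite F3_double in cE.
exists (al ^+ 2 / c%:R); rewrite expr_div_n exprAC e.
have c0L : c%:R ^+ 3 != 0 :> L.
  by rewrite expf_neq0 // -(rmorph_nat (rat_emb L)) fmorph_eq0 pnatr_eq0 -lt0n.
apply: (mulIf c0L); rewrite divfK // !rmorph_nat -natrX -natrX -natrM -cE.
by rewrite mulnn.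
Qed.

Lemma cube_field_line v w (L : fieldExtType rat) : (<[v]> = <[w]>)%VS -> v != 0 ->
  cube_field (kr w)%:R L -> cube_field (kr v)%:R L.
Proof.
move=> vw v0; have /vlineP[c vE] : v \in <[w]>%VS by rewrite -vw memv_line.
move: v0; rewrite vE; case: (F3_cases c) => ->; rewrite ?scale0r ?eqxx // => _.
  by rewrite scale1r.
have -> : 2 *: w = - w by rewrite -F3_double scaler_nat mulr2n.
exact: cube_field_opp.
Qed.

(** A cube root of the second radicand in Q(al) is a rational multiple of 1, al or al^2; the first
    is excluded because that radicand is not a cube, and the others give w = v and w = 2 v. *)
Lemma cube_field_same_line v w (L : fieldExtType rat) : v != 0 -> w != 0 ->
  cube_field (kr v)%:R L -> cube_field (kr w)%:R L -> (<[v]> = <[w]>)%VS.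
Proof.
move=> v0 w0 [dL [al e]] [_ [ro e']].
have nc (t : rat) : t ^+ 3 != (kr v)%:R * 1 ^+ 2.
  by rewrite expr1n mulr1; apply: kummer_radicand_noncube.
have [h1 h2 h3] := cube_root1E e.
have [x [y [z roE]]] := pure_cubicE nc h1 h3 dL ro.
have kw0 : (kr w)%:R != 0 :> rat by rewrite pnatr_eq0 -lt0n kummer_radicand_gt0.
have kv0 : (kr v)%:R != 0 :> rat by rewrite pnatr_eq0 -lt0n kummer_radicand_gt0.
rewrite roE in e'; case: (pure_cubic_rational_cube kv0 (oner_neq0 _) nc h1 h2
  h3 e').
- by move/esym/eqP; rewrite (negPf (kummer_radicand_noncube p_uniq p_prime w0 _)).
- rewrite expr1n mulr1 => kE.
  have y0 : y != 0 by apply: contraNneq kw0 => y0; rewrite kE y0 expr0n mulr0.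
  by rewrite (kummer_radicand_inj p_uniq p_prime y0 kE).
- rewrite mulr1 => kE; have [c c0 cE] := kummer_radicandD p_prime v v.
  have z0 : c%:R * z != 0.
    rewrite mulf_neq0 ?pnatr_eq0 -?lt0n //.
    by apply: contraNneq kw0 => z0; rewrite kE z0 expr0n mulr0.
  rewrite (@kummer_radicand_inj _ _ p_uniq p_prime w (v + v) _ z0).
    have -> : v + v = 2 *: v by rewrite scaler_nat mulr2n.
    by rewrite line_scale.
  transitivity ((kr v * kr v)%:R * z ^+ 3 : rat); first by rewrite kE natrM; ring.
  by rewrite cE natrM natrX; ring.
Qed.

End Fields.

(** * From admissible vectors to quasi-monogenic fields and back *)

Section Assembly.
Variables (n : int) (s : nat) (p : s.-tuple nat).
Hypotheses (n0 : n != 0) (n3 : ~~ (3 %| n)%Z) (pE : perm_eq p (primes `|n|%N)).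
Let ps := cons_tuple 3%N p.
Let nQ : rat := n%:~R.

Lemma mem_p q : (q \in p) = prime q && (q %| `|n|)%N.
Proof. by rewrite (perm_mem pE) mem_primes absz_gt0 n0. Qed.

Lemma ps_prime i : prime (tnth ps i).
Proof.
have := mem_tnth i ps; rewrite inE => /orP[/eqP -> //|].
by rewrite mem_p => /andP[].
Qed.

Lemma ps_uniq : uniq ps.
Proof.
rewrite /= (perm_uniq pE) primes_uniq andbT mem_p /=.
by move: n3; rewrite dvdzE.
Qed.

Lemma kummer_radicand_cons (v : 'rV['F_3]_s.+1) : v 0 ord0 = 0 ->
  kummer_radicand ps v = radicand p v.
Proof.
move=> v0; rewrite /kummer_radicand big_ord_recl v0 /= expn0 mul1n.
by apply: eq_bigr => i _; rewrite !(tnth_nth 0%N).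
Qed.

Lemma prod_support (v : 'rV['F_3]_s.+1) : squarefree `|n|%N ->
  v 0 ord0 = 0 -> (forall i, v 0 (lift ord0 i) != 0) ->
  (radicand1 ps v * radicand2 ps v = `|n|)%N.
Proof.
move=> sf v0 vi; rewrite radicandME big_ord_recl v0 eqxx expn0 mul1n.
have n_gt0 : (0 < `|n|)%N by rewrite absz_gt0.
rewrite [RHS](squarefree_prod_primes n_gt0 sf) -(perm_big _ pE) /=.
rewrite big_tuple; apply: eq_bigr => i _.
by rewrite vi expn1 !(tnth_nth 0%N).
Qed.

(** The valuation of |n| at an entry of [ps] is 1 or 0 according to whether that coordinate of v is
    nonzero; it is 0 at 3 and positive at the prime factors of n. *)
Lemma support_of_disc (v : 'rV['F_3]_s.+1) :
  (radicand1 ps v * radicand2 ps v = `|n|)%N ->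
  v 0 ord0 = 0 /\ (forall i, v 0 (lift ord0 i) != 0).
Proof.
rewrite radicandME => h.
have lg j : logn (tnth ps j) `|n| = (v 0 j != 0) :> nat.
  by rewrite -h (logn_prod_tnth ps_uniq ps_prime).
split=> [|i].
  have := lg ord0; rewrite (tnth_nth 0%N) /= lognE /= absz_gt0 n0.
  by move: n3; rewrite dvdzE => /negPf ->; case: eqP.
have : tnth ps (lift ord0 i) \in p.
  by rewrite (_ : tnth ps _ = tnth p i) ?mem_tnth // !(tnth_nth 0%N).
rewrite mem_p => /andP[pq dq].
have : (0 < logn (tnth ps (lift ord0 i)) `|n|)%N.
  by rewrite logn_gt0 mem_primes pq absz_gt0 n0 dq.
by rewrite lg lt0b.
Qed.

Variables (zeta : algC) (V : {vspace 'rV['F_3]_s.+1}).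
Let D : rat := -3 * nQ ^+ 2.
Hypothesis prim_zeta : 3.-primitive_root zeta.
Hypothesis V_total : forall P : EC (-27 * D) rat,
  exists2 v, coefficient_vector zeta ps P v & v \in V.
Hypothesis V_surj : forall v, v \in V ->
  exists P : EC (-27 * D) rat, coefficient_vector zeta ps P v.
Hypothesis V_uniq : forall v,
  coefficient_vector zeta ps (0 : EC (-27 * D) rat) v -> v = 0.

Lemma nQ0 : nQ != 0. Proof. by rewrite intr_eq0. Qed.

Lemma admissible_qm (v : 'rV['F_3]_s.+1) : squarefree `|n|%N ->
  v \in V -> admissible p v -> qm_cubic_field D (Qcbrt (radicand p v)).
Proof.
move=> sf vV [v0 v00 vi m9]; rewrite -kummer_radicand_cons //.
have cf : cube_field (kummer_radicand ps v)%:R (Qcbrt (kummer_radicand ps v)).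
  by apply/Qcbrt_cube_field/kummer_radicand_noncube => //;
    [exact: ps_uniq|exact: ps_prime].
have ab := prod_support sf v00 vi.
case: (kummer_field_cases ps_uniq ps_prime v0 cf) => [[ne _]|[_ disc qm]].
  have mE : (radicand p v)%:Z = (radicand1 ps v)%:Z * (radicand2 ps v)%:Z ^+ 2.
    by rewrite -kummer_radicand_cons // kummer_radicandE.
  case: m9 => /eqP; rewrite eqz_mod_dvd mE => d9.
    by have := ne 1 (expr1n _ _); rewrite d9.
  by have := ne (- 1) (etrans (sqrrN _) (expr1n _ _)); rewrite d9.
set a := (radicand1 ps v)%:Z in disc qm; set b := (radicand2 ps v)%:Z in disc qm.
have nab : nQ ^+ 2 = (a%:~R * b%:~R) ^+ 2.
  rewrite -intrM -!rmorphXn /=; congr (_%:~R).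
  by rewrite {1}[n]intEsign exprMn sqrr_sign mul1r -ab.
split; first by case: cf.
  by apply/disc; rewrite /D nab.
have [P hP] := V_surj vV.
(* Infinity has only the zero vector, so a point with vector v != 0 is affine. *)
case cP: (coords P) => [[X Y]|]; last first.
  have P0 : P = 0 by apply: val_inj.
  by case/eqP: v0; apply: V_uniq; rewrite -P0.
have [N NE hN] := descent prim_zeta nQ0 (erefl D).
have ps0 i : (0 < tnth ps i)%N by rewrite prime_gt0 ?ps_prime.
have [q [q' [e e']]] := hN _ _ _ _ _ _ ps0 hP cP.
have mE : (kummer_radicand ps v)%:R = a%:~R * b%:~R ^+ 2 :> rat.
  by rewrite kummer_radicandE natrM natrX.
have ab0 : a%:~R * b%:~R != 0 :> rat.
  by rewrite -sqrf_eq0 -nab sqrf_eq0 nQ0.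
have [t t1 NE'] : exists2 t : rat, t ^+ 2 = 1 & N = t * (a%:~R * b%:~R).
  have /eqP : N ^+ 2 = (a%:~R * b%:~R) ^+ 2 by case: NE => ->; rewrite ?sqrrN nab.
  rewrite eqf_sqr => /orP[] /eqP ->; [exists 1|exists (- 1)];
    by rewrite ?sqrrN ?expr1n ?mul1r ?mulN1r.
(* Subtracting the two equations gives 72 N = m^2 q'^3 - m q^3; division by a b yields 72 t = a b^3
   q'^3 - b q^3. As 216 = 6^3 and 72 / 216 = 1/3, scaling by -t / 6 produces the required 1/3. *)
apply: (qm (- t * q / 6) (- t * b%:~R * q' / 6)).
have h : 72 * t = a%:~R * b%:~R ^+ 3 * q' ^+ 3 - b%:~R * q ^+ 3.
  apply: (mulfI ab0); transitivity (4 * (Y + 9 * N) - 4 * (Y - 9 * N)).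
    by rewrite NE'; ring.
  by rewrite e e' mE; ring.
transitivity (t ^+ 2 * t * (a%:~R * b%:~R ^+ 3 * q' ^+ 3 - b%:~R * q ^+ 3) / 216).
  by field.
by rewrite -h t1 mul1r; transitivity (t ^+ 2 / 3); [field | rewrite t1].
Qed.

(* The point attached to ga^3 + c ga + q = 0 is (-3c, 27q). *)
Lemma qm_admissible (L : fieldExtType rat) : qm_cubic_field D L ->
  exists v, [/\ v \in V, admissible p v & cube_field (kummer_radicand ps v)%:R L].
Proof.
move=> qmL; have [dimL discL _] := qmL.
have [ga [c [q [bas g3 DE]]]] := quasi_monogenic_generator qmL.
(* A and B are the roots of T^2 + q T - (c/3)^3, whose discriminant is n^2 / 9. In terms of Y = 27 q
   they are 4 (Y - 9n) and 4 (Y + 9n) times (-1/6)^3, which links Cardano's formula to [descent]. *)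
pose A := - q / 2 + nQ / 6; pose B := - q / 2 - nQ / 6.
have key : 4 * c ^+ 3 + 27 * q ^+ 2 = 3 * nQ ^+ 2.
  by transitivity (- D); [rewrite DE; ring | rewrite /D; ring].
have AB : A != B.
  rewrite -subr_eq0 /A /B (_ : _ - _ = nQ / 3); last by field.
  by rewrite mulf_neq0 ?nQ0.
have [|| u [w [gaE u3 w3]]] := @cardano L ga (c / 3) A B AB.
- rewrite g3 (_ : A + B = - q); last by rewrite /A /B; field.
  rewrite rmorphN; congr (_ * _ - _).
  transitivity (- rat_emb L (3 * (c / 3))); first by congr (- rat_emb L _); field.
  by rewrite rmorphM rmorph_nat; ring.
- have c3 : c ^+ 3 = (3 * nQ ^+ 2 - 27 * q ^+ 2) / 4 by rewrite -key; field.
  by rewrite expr_div_n c3 /A /B; field.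
have oP : on_curve (-27 * D) (Some (- 3 * c, 27 * q)).
  apply: on_curve_rat.
    rewrite /D; transitivity (27 * (27 * q ^+ 2)); first by ring.
    transitivity (27 * (3 * nQ ^+ 2 - 4 * c ^+ 3)); last by ring.
    by rewrite -key; ring.
  apply/negP => /eqP[/eqP c0 /eqP q0]; case/negP: nQ0.
  move: c0 q0; rewrite !mulf_eq0 !orFb => /eqP c0 /eqP q0.
  rewrite -sqrf_eq0; apply/eqP; apply: (mulfI (x := 3)) => //.
  by rewrite -key c0 q0; ring.
have [v hv vV] := V_total (ECPoint oP).
have [N NE hN] := descent prim_zeta nQ0 (erefl D).
have ps0 i : (0 < tnth ps i)%N by rewrite prime_gt0 ?ps_prime.
have [q1 [q2 [e e']]] := hN _ _ _ _ _ _ ps0 hv erefl.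
set m := (kummer_radicand ps v)%:R in e e'.
have [t [t' [u' [w' [gaE' u3' w3']]]]] : exists t t' u' w', [/\ ga = u' + w',
    u' ^+ 3 = rat_emb L (m * t ^+ 3) & w' ^+ 3 = rat_emb L (m ^+ 2 * t' ^+ 3)].
  exists (- q1 / 6), (- q2 / 6).
  have mA : m * (- q1 / 6) ^+ 3 = - (27 * q - 9 * N) / 54.
    transitivity (- (m * q1 ^+ 3) / 216); first by field.
    by rewrite -e; field.
  have mB : m ^+ 2 * (- q2 / 6) ^+ 3 = - (27 * q + 9 * N) / 54.
    transitivity (- (m ^+ 2 * q2 ^+ 3) / 216); first by field.
    by rewrite -e'; field.
  rewrite mA mB; case: NE => ->.
    exists u, w; split=> //.
      by rewrite u3; congr (rat_emb L _); rewrite /A; field.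
    by rewrite w3; congr (rat_emb L _); rewrite /B; field.
  exists w, u; split=> //; first by rewrite addrC.
    by rewrite w3; congr (rat_emb L _); rewrite /B; field.
  by rewrite u3; congr (rat_emb L _); rewrite /A; field.
have gaQ (x : rat) : ga != rat_emb L x.
  apply/eqP => gx; have /free3P h := basis_free bas.
  have [] := h x (- 1) 0; last by move=> _ /eqP; rewrite oppr_eq0 oner_eq0.
  by rewrite scale0r addr0 scaleN1r rat_emb1 -gx subrr.
(* For v = 0 both summands of ga would be cube roots of rational cubes, hence rational, and so would
   ga. *)
have v0 : v != 0.
  apply/eqP => v0; have m1 : m = 1.
    by rewrite /m v0 /kummer_radicand big1 // => i _; rewrite mxE.
  have u'E : u' = rat_emb L t.
    by apply: (cube_root_unique dimL); rewrite u3' m1 mul1r.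
  have w'E : w' = rat_emb L t'.
    by apply: (cube_root_unique dimL); rewrite w3' m1 expr1n mul1r.
  by have := gaQ (t + t'); rewrite gaE' u'E w'E rmorphD eqxx.
have m0 : m != 0.
  by rewrite pnatr_eq0 -lt0n kummer_radicand_gt0 //; exact: ps_prime.
have cf : cube_field m L.
  split=> //; have [t0|t0] := eqVneq t 0; last first.
    exists (u' / rat_emb L t); have tL : rat_emb L t != 0 by rewrite fmorph_eq0.
    by rewrite expr_div_n u3' -rmorphXn -fmorph_div mulfK ?expf_neq0.
  have [t'0|t'0] := eqVneq t' 0.
    have := gaQ 0; rewrite gaE' rmorph0.
    have -> : u' = 0.
      by apply/eqP; have := expf_eq0 u' 3;
        rewrite u3' t0 expr0n mulr0 rmorph0 eqxx => /esym/andP[].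
    have -> : w' = 0.
      by apply/eqP; have := expf_eq0 w' 3;
        rewrite w3' t'0 expr0n mulr0 rmorph0 eqxx => /esym/andP[].
    by rewrite addr0 eqxx.
  (* When the first summand vanishes, the second provides a cube root of m^2; its square over m is
     one of m, since m^4 / m^3 = m. *)
  exists ((w' / rat_emb L t') ^+ 2 / rat_emb L m).
  rewrite expr_div_n exprAC expr_div_n w3' -!rmorphXn -fmorph_div mulfK
    ?expf_neq0 //.
  by rewrite -rmorphXn -fmorph_div; congr (rat_emb L _); field.
exists v; split=> //.
(* A discriminant -27 (a b)^2 equal to -3 n^2 would make n divisible by 3; this rules out the first
   case below. *)
have n9 (k : int) : n ^+ 2 = 9 * k ^+ 2 -> False.
  move=> h; case/negP: n3; apply: (@euclid3X _ 2); rewrite h.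
  by apply/dvdzP; exists (3 * k ^+ 2); ring.
case: (kummer_field_cases ps_uniq ps_prime v0 cf) => [[_ disc]|[[e1 e11 e9]
  disc _]].
  have /disc dE := discL; case: (n9 ((radicand1 ps v)%:Z * (radicand2 ps v)%:Z)).
  apply: (intr_inj (R := rat)); apply: (mulfI (x := - 3)) => //.
  transitivity D; first by rewrite /D /nQ; ring.
  by rewrite dE; ring.
have /disc dE := discL.
have ab : (radicand1 ps v * radicand2 ps v = `|n|)%N.
  have h : n ^+ 2 = ((radicand1 ps v)%:Z * (radicand2 ps v)%:Z) ^+ 2.
    apply: (intr_inj (R := rat)); apply: (mulfI (x := - 3)) => //.
    transitivity D; first by rewrite /D /nQ; ring.
    by rewrite dE; ring.
  apply/eqP; rewrite -(eqn_exp2r _ _ (isT : 0 < 2)%N); apply/eqP.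
  by have := congr1 absz h; rewrite !abszX abszM /= => ->.
have [v00 vi] := support_of_disc ab; split=> //.
have mE : (radicand p v)%:Z = (radicand1 ps v)%:Z * (radicand2 ps v)%:Z ^+ 2.
  by rewrite -kummer_radicand_cons // kummer_radicandE.
move: e9; rewrite -mE -eqz_mod_dvd => /eqP e9.
by move/eqP: e11; rewrite sqrf_eq1 => /orP[] /eqP e1E; rewrite e1E in e9;
  [left|right].
Qed.

End Assembly.

(** [line_class] ranges over all generators of the line; by [cube_field_line] a single one
    decides. *)
Lemma line_class_cube_field (s : nat) (p : s.-tuple nat) (v : 'rV['F_3]_s.+1)
    (L : fieldExtType rat) :
  uniq (cons_tuple 3%N p) -> (forall i, prime (tnth (cons_tuple 3%N p) i)) ->
  v != 0 -> v 0 ord0 = 0 ->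
  line_class p <[v]>%VS L <->
  cube_field (kummer_radicand (cons_tuple 3%N p) v)%:R L.
Proof.
move=> pu pp v0 v00; have nc (w : 'rV['F_3]_s.+1) := @kummer_radicand_noncube _
  _ pu pp w.
split=> [[w vw iso]|cf].
  have w0 : w != 0.
    apply: contraNneq v0 => w0; move: (memv_line v).
    by rewrite vw w0 => /vlineP[c ->]; rewrite scaler0.
  have w00 : w 0 ord0 = 0.
    by move: (memv_line w); rewrite -vw => /vlineP[c ->]; rewrite mxE v00 mulr0.
  apply: (cube_field_line pp vw v0).
  apply: field_iso_cube_field iso _; rewrite -kummer_radicand_cons //.
  by apply: Qcbrt_cube_field; apply: nc.
exists v => //; rewrite -kummer_radicand_cons //.
apply: (@cube_field_iso (kummer_radicand (cons_tuple 3%N p) v)%:R) => //;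
  first exact: nc.
by apply: Qcbrt_cube_field; apply: nc.
Qed.

Theorem theorem7p9 (n : int) (D : rat) (s r : nat) (p : s.-tuple nat)
    (zeta : algC) (P : 'I_r.+1 -> EC (-27 * D) rat)
    (M : 'M['F_3]_(r.+1, s.+1)) :
  n != 0 -> ~~ (3 %| n)%Z -> D = -3 * n%:~R ^+ 2 ->
  perm_eq p (primes `|n|%N) ->
  3.-primitive_root zeta ->
  has_rank (EC (-27 * D) rat) r ->
  ec_map (ratr : {rmorphism rat -> algC}) (P ord0) = sqrt_point (-27 * D) ->
  generates P ->
  (forall i, coefficient_vector zeta (cons_tuple 3%N p) (P i) (row i M)) ->
  let V := (<<[tuple row i M | i < r.+1]>>)%VS in
  F3_isomorphic (Quotient.quot (phi_image D)) (subvs_of V) /\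
  (squarefree `|n|%N ->
   bijective_onto_classes (admissible_line p V) (qm_cubic_field D)
     (line_class p)).
Proof.
move=> n0 n3 DE pE prim_zeta _ P0E Pgen PM V; subst D.
have pu := ps_uniq n0 n3 pE; have pp := ps_prime n0 pE.
have nQ0 : n%:~R != 0 :> rat by rewrite intr_eq0.
have D0 : -27 * (-3 * n%:~R ^+ 2) != 0 :> rat.
  by do 2![apply: mulf_neq0; first by rewrite oppr_eq0 pnatr_eq0]; apply: expf_neq0.
(* This is the affine point with a known vector that [coefficient_vector0_uniq] calls for. *)
have P0 : P ord0 != 0.
  apply/eqP => P00; have := coords_sqrt_point D0.
  by rewrite -P0E P00 raddf0.
have Vrow i : row i M \in V.
  by apply: memv_span; apply/tnthP; exists i; rewrite tnth_mktuple.
have V_total (X : EC (-27 * (-3 * n%:~R ^+ 2)) rat) :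
    exists2 v, coefficient_vector zeta (cons_tuple 3%N p) X v & v \in V.
  have [c ->] := Pgen X; exists (\sum_i row i M *~ c i).
    exact: coefficient_vector_sum.
  by apply: rpred_sum => i _; apply: rpredMz.
have V_surj (v : 'rV['F_3]_s.+1) : v \in V ->
    exists X : EC (-27 * (-3 * n%:~R ^+ 2)) rat,
      coefficient_vector zeta (cons_tuple 3%N p) X v.
  (* The coordinates over ['F_3] are lifted to integers, which turns a combination of rows into one
     of the generators. *)
  move=> /coord_span ->;
    exists (\sum_i P i *~ (coord [tuple row i M | i < r.+1] i v : nat)).
  have -> : \sum_i coord [tuple row i M | i < r.+1] i v *: [tuple row i M | i <
    r.+1]`_i =
      \sum_i row i M *~ (coord [tuple row i M | i < r.+1] i v : nat).
    apply: eq_bigr => i _; rewrite -tnth_nth tnth_mktuple -pmulrn -scaler_nat.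
    by rewrite natr_Zp.
  exact: coefficient_vector_sum.
have V_uniq v : coefficient_vector zeta (cons_tuple 3%N p)
    (0 : EC (-27 * (-3 * n%:~R ^+ 2)) rat) v -> v = 0.
  exact: (coefficient_vector0_uniq pu pp prim_zeta nQ0 erefl P0 (PM ord0)).
split.
  apply: (quotient_F3_isomorphic (C := coefficient_vector zeta (cons_tuple 3%N
    p))) => //.
  - by move=> X Y v w; apply: coefficient_vectorD.
  - by move=> X v; apply: coefficient_vectorN.
  - by move=> X; apply: coefficient_vector0P.
move=> sf.
have lcE v L : admissible p v -> line_class p <[v]>%VS L <->
    cube_field (kummer_radicand (cons_tuple 3%N p) v)%:R L.
  by case=> v0 v00 _ _; apply: line_class_cube_field.
have isoE v L L' : admissible p v ->
    cube_field (kummer_radicand (cons_tuple 3%N p) v)%:R L ->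
    line_class p <[v]>%VS L' <-> field_iso L L'.
  move=> av cf; rewrite (lcE v L' av); split=> [cf'|iso].
    by apply: cube_field_iso cf cf'; apply: kummer_radicand_noncube => //; case: av.
  exact: field_iso_cube_field iso cf.
have Qcf v : admissible p v ->
    cube_field (kummer_radicand (cons_tuple 3%N p) v)%:R (Qcbrt (radicand p v)).
  case=> v0 v00 _ _; rewrite -(kummer_radicand_cons p v00).
  by apply: Qcbrt_cube_field; apply: kummer_radicand_noncube.
split.
- move=> W [WV [v av WE]]; subst W.
  exists (Qcbrt (radicand p v)); last by move=> L'; apply: isoE (Qcf v av).
  apply: (admissible_qm n0 n3 pE prim_zeta V_surj V_uniq sf _ av).
  by rewrite memvE.
- move=> W W' [_ [v av ->]] [_ [w aw ->]] h.
  have cf : cube_field (kummer_radicand (cons_tuple 3%N p) w)%:R (Qcbrt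
    (radicand p v)).
    by apply/lcE/h/lcE => //; apply: Qcf.
  by apply: (cube_field_same_line pu pp) (Qcf v av) cf; [case: av | case: aw].
- move=> L /(qm_admissible n0 n3 pE prim_zeta V_total)[v [vV av cf]].
  exists <[v]>%VS; last by move=> L'; apply: isoE.
  by split; [rewrite -memvE | exists v].
Qed.
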